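(* Let $(R,\mathfrak m,k)$ be a local ring, let $M\to N$ be an $R$-linear map of $R$-modules, and set $$r=\operatorname{rank}_k\bigl(M/(M\cap\mathfrak m N)\bigr).$$ If $R$ is singular and the projective dimension of $N$ over $R$ is finite, then for each $n\in\mathbb Z$ there is an equality $$\mu^n_R(M\cap\mathfrak m N)=\mu^n_R(M)+r\,\mu^{n-1}_R(k).$$
   Context: A local ring $(R,\mathfrak m,k)$ is a commutative noetherian local ring $R$ with maximal ideal $\mathfrak m$ and residue field $k=R/\mathfrak m$. It is called singular when it is not a regular local ring. Given an $R$-linear map $\beta\colon M\to N$ and a submodule $N'\subseteq N$, $M\cap N'$ denotes the submodule $\beta^{-1}(N')$ of $M$. The $n$-th Bass number of an $R$-module $M$ is $\mu^n_R(M)=\operatorname{rank}_k\operatorname{Ext}^n_R(k,M)$, where $\operatorname{rank}_k$ is the dimension of a $k$-vector space; it is $0$ for $n<0$. If the modules are not finitely generated, ranks may be infinite, and the equality is then read as an equality of cardinals. *)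

(* Defs.v *)
From HB Require Import structures.
From mathcomp Require Import all_boot all_order all_algebra.
From mathcomp Require Import ring_quotient.
From mathcomp Require Import boolp classical_sets functions cardinality.
From mathcomp.multinomials Require Import freeg.

Set Implicit Arguments.
Unset Strict Implicit.
Unset Printing Implicit Defensive.

Import GRing.Theory.
Local Open Scope ring_scope.
Local Open Scope quotient_scope.

Record submodule (R : pzRingType) (M : lmodType R) := Submodule {
  smem :> {pred M};
  smemP : submod_closed smem }.

HB.instance Definition _ (R : pzRingType) (M : lmodType R) (U : submodule M) :=
  GRing.isSubmodClosed.Build R M (smem U) (smemP U).

Record submod (R : pzRingType) (M : lmodType R) (U : submodule M) := SubMod {
  submod_val :> M;
  submod_valP : submod_val \in smem U }.

HB.instance Definition _ (R : pzRingType) (M : lmodType R) (U : submodule M) :=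
  [isSub for @submod_val R M U].
HB.instance Definition _ (R : pzRingType) (M : lmodType R) (U : submodule M) :=
  [Choice of submod U by <:].
HB.instance Definition _ (R : pzRingType) (M : lmodType R) (U : submodule M) :=
  [SubChoice_isSubLmodule of submod U by <:].

Section QuotMod.
Variables (R : pzRingType) (M : lmodType R) (U : submodule M).

Definition quotmod := Quotient.quot (smem U).
HB.instance Definition _ := GRing.Zmodule.on quotmod.
HB.instance Definition _ := EqQuotient.on quotmod.
HB.instance Definition _ := ZmodQuotient.on quotmod.

Definition quotmod_scale (a : R) (x : quotmod) : quotmod :=
  \pi_quotmod (a *: repr x).

Lemma pi_scale a (x : M) :
  quotmod_scale a (\pi_quotmod x) = \pi_quotmod (a *: x).
Proof.
apply/eqP; rewrite /quotmod_scale -Quotient.idealrBE -scalerBr rpredZ //.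
by rewrite Quotient.idealrBE reprK.
Qed.

Let piD (x y : M) : \pi_quotmod (x + y) = \pi_quotmod x + \pi_quotmod y.
Proof. exact: (Quotient.pi_add (smem U) x y). Qed.

Lemma quotmod_scaleA a b v :
  quotmod_scale a (quotmod_scale b v) = quotmod_scale (a * b) v.
Proof. by elim/quotW: v => v; rewrite (pi_scale b) !pi_scale scalerA. Qed.

Lemma quotmod_scale1r : left_id 1 quotmod_scale.
Proof. by elim/quotW=> v; rewrite pi_scale scale1r. Qed.

Lemma quotmod_scalerDr : right_distributive quotmod_scale +%R.
Proof.
move=> a; elim/quotW=> u; elim/quotW=> v.
by rewrite -piD !pi_scale -piD scalerDr.
Qed.

Lemma quotmod_scalerDl v : {morph quotmod_scale^~ v : a b / a + b}.
Proof. by move=> a b; elim/quotW: v => v; rewrite !pi_scale -piD scalerDl. Qed.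

HB.instance Definition _ := GRing.Zmodule_isLmodule.Build R quotmod
  quotmod_scaleA quotmod_scale1r quotmod_scalerDr quotmod_scalerDl.

Lemma quotmod_eq0 (x : M) : (\pi_quotmod x = 0) <-> (x \in smem U).
Proof.
have -> : (0 : quotmod) = \pi_quotmod 0 by rewrite raddf0.
split=> [/eqP|xU]; first by rewrite -Quotient.idealrBE subr0.
by apply/eqP; rewrite -Quotient.idealrBE subr0.
Qed.

Lemma quotmodZ a (x : M) : a *: \pi_quotmod x = \pi_quotmod (a *: x).
Proof. exact: pi_scale. Qed.

End QuotMod.

Lemma preim_closed (R : pzRingType) (M N : lmodType R) (f : {linear M -> N})
  (V : submodule N) : submod_closed [pred x | f x \in smem V].
Proof.
split=> [|a x y]; rewrite !inE ?linear0 ?rpred0 // => fx fy.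
by rewrite linearP rpredD ?rpredZ.
Qed.

Definition preim_submodule (R : pzRingType) (M N : lmodType R)
    (f : {linear M -> N}) (V : submodule N) : submodule M :=
  Submodule (preim_closed f V).

Lemma ker_closed (R : pzRingType) (M N : lmodType R) (f : {linear M -> N}) :
  submod_closed [pred x | f x == 0].
Proof.
split=> [|a x y]; rewrite !inE ?linear0 // => /eqP fx /eqP fy.
by rewrite linearP fx fy scaler0 addr0.
Qed.

Definition kermod (R : pzRingType) (M N : lmodType R) (f : {linear M -> N}) :
    submodule M :=
  Submodule (ker_closed f).

Definition generates (R : pzRingType) (M : lmodType R) (s : seq M)
    (U : {pred M}) : Prop :=
  forall x, x \in U <-> exists a : 'I_(size s) -> R, x = \sum_i a i *: s`_i.

Definition maximal_ideal (R : comNzRingType) (I : {pred R}) : Prop :=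
  idealr_closed I /\
  forall J : {pred R}, idealr_closed J -> {subset I <= J} -> {subset J <= I}.

Definition noetherian (R : comNzRingType) : Prop :=
  forall I : submodule R^o, exists s : seq R^o, generates s I.

HB.mixin Record isNoetherianLocal R of GRing.ComNzRing R := {
  maxideal : {pred R};
  maxidealP : maximal_ideal maxideal;
  maxideal_unique : forall I : {pred R}, maximal_ideal I -> I =i maxideal;
  local_noetherian : noetherian R }.

#[short(type="localRingType")]
HB.structure Definition LocalRing :=
  { R of GRing.ComNzRing R & isNoetherianLocal R }.

Arguments maxideal s : clear implicits.

HB.instance Definition _ (R : localRingType) :=
  isIdealr.Build R (maxideal R) (proj1 (@maxidealP R)).

(** A chain of primes of length [n] is [p 0 < p 1 < ... < p n]; only the values
    of [p] at [0 .. n] matter. *)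
Definition prime_chain (R : comNzRingType) (n : nat) : Prop :=
  exists p : nat -> prime_idealr R, forall i, (i < n)%N ->
    {subset p i <= p i.+1} /\ ~ {subset p i.+1 <= p i}.

Definition krull_dim (R : comNzRingType) (d : nat) : Prop :=
  prime_chain R d /\ forall n, prime_chain R n -> (n <= d)%N.

Definition regular (R : localRingType) : Prop :=
  exists s : seq R^o, generates s (maxideal R) /\ krull_dim R (size s).

Definition singular (R : localRingType) : Prop := ~ regular R.

Section ResidueField.
Variable R : localRingType.
Implicit Types x y : R.

Definition residue := {ideal_quot maxideal R}.
HB.instance Definition _ := GRing.ComNzRing.on residue.
HB.instance Definition _ := EqQuotient.on residue.
HB.instance Definition _ := NzRingQuotient.on residue.

Lemma residue_eq0 x : (\pi_residue x == 0) = (x \in maxideal R).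
Proof.
have -> : (0 : residue) = \pi_residue 0 by rewrite rmorph0.
by rewrite -Quotient.idealrBE subr0.
Qed.

Lemma maxideal_inv x : x \notin maxideal R ->
  exists y, y * x - 1 \in maxideal R.
Proof.
move=> xm; apply: contrapT => noy.
pose J : {pred R} :=
  [pred z | `[< exists y m, m \in maxideal R /\ z = y * x + m >]].
have Jid : idealr_closed J.
  split=> [||a u v /asboolP[y [m [mm ->]]] /asboolP[z [n [nm ->]]]].
  - by apply/asboolP; exists 0, 0; rewrite rpred0 mul0r addr0.
  - apply/asboolP => -[y [m [mm e]]]; apply: noy; exists y.
    by rewrite e opprD addrA subrr sub0r rpredN.
  - apply/asboolP; exists (a * y + z), (a * m + n); split.
      by rewrite rpredD // idealMr.
    by rewrite mulrDr mulrDl !mulrA addrACA.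
have [_ maxm] := @maxidealP R.
move/negP: xm; apply; apply: (maxm J Jid).
  by move=> z zm; apply/asboolP; exists 0, z; rewrite mul0r add0r.
by apply/asboolP; exists 1, 0; rewrite rpred0 mul1r addr0.
Qed.

Lemma residue_inv (x : residue) : exists y : residue, x <> 0 -> y * x = 1.
Proof.
have [->|x0] := eqVneq x 0; first by exists 0.
have xm : repr x \notin maxideal R by rewrite -residue_eq0 reprK.
have [y ym] := maxideal_inv xm; exists (\pi_residue y) => _.
rewrite -[x]reprK -rmorphM -(rmorph1 (\pi_residue)).
by apply/eqP; rewrite -Quotient.idealrBE.
Qed.

Definition residue_invr (x : residue) : residue :=
  if x == 0 then 0 else sval (cid (residue_inv x)).

Lemma residue_mulVf (x : residue) : x != 0 -> residue_invr x * x = 1.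
Proof.
rewrite /residue_invr; case: eqP => // xn0 _; by case: cid => y /= ->.
Qed.

Lemma residue_invr0 : residue_invr 0 = 0.
Proof. by rewrite /residue_invr eqxx. Qed.

HB.instance Definition _ := GRing.ComNzRing_isField.Build residue
  residue_mulVf residue_invr0.

Definition residue_scale (a : R) (x : residue) : residue := \pi_residue a * x.

Lemma residue_scaleA a b v :
  residue_scale a (residue_scale b v) = residue_scale (a * b) v.
Proof. by rewrite /residue_scale rmorphM mulrA. Qed.

Lemma residue_scale1r : left_id 1 residue_scale.
Proof. by move=> v; rewrite /residue_scale rmorph1 mul1r. Qed.

Lemma residue_scalerDr : right_distributive residue_scale +%R.
Proof. by move=> a u v; rewrite /residue_scale mulrDr. Qed.

Lemma residue_scalerDl v : {morph residue_scale^~ v : a b / a + b}.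
Proof. by move=> a b; rewrite /residue_scale rmorphD mulrDl. Qed.

HB.instance Definition _ := GRing.Zmodule_isLmodule.Build R residue
  residue_scaleA residue_scale1r residue_scalerDr residue_scalerDl.

Definition killed (E : lmodType R) : Prop :=
  forall (a : R) (x : E), a \in maxideal R -> a *: x = 0.

Lemma residue_killed : killed residue.
Proof.
move=> a x; rewrite -residue_eq0 => /eqP a0.
by rewrite [LHS]/GRing.scale /= /residue_scale a0 mul0r.
Qed.

End ResidueField.

Section MaxidealMul.
Variables (R : localRingType) (N : lmodType R).

Definition in_mmul (x : N) : Prop :=
  exists n (a : 'I_n -> R) (y : 'I_n -> N),
    (forall i, a i \in maxideal R) /\ x = \sum_i a i *: y i.

Lemma mmul_closed : submod_closed [pred x | `[< in_mmul x >]].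
Proof.
split=> [|c u v /asboolP[n [a [y [am ->]]]] /asboolP[p [b [z [bm ->]]]]].
  by apply/asboolP; exists 0%N, (fun=> 0), (fun=> 0); rewrite big_ord0; split=> [[]|].
apply/asboolP; exists (n + p)%N.
exists (fun i => match fintype.split i with inl j => c * a j | inr j => b j end).
exists (fun i => match fintype.split i with inl j => y j | inr j => z j end); split.
  by move=> i; case: fintype.split => j //; exact: idealMr.
rewrite big_split_ord /= scaler_sumr; congr (_ + _); apply: eq_bigr => i _.
  by rewrite -[lshift _ i]/(unsplit (inl i)) unsplitK scalerA.
by rewrite -[rshift _ i]/(unsplit (inr i)) unsplitK.
Qed.

Definition mmul : submodule N := Submodule mmul_closed.

End MaxidealMul.

Section Dimension.
Variables (K : fieldType) (V : lmodType K).

Definition free_set (B : set V) : Prop :=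
  forall (s : seq V) (a : V -> K), uniq s -> (forall x, x \in s -> B x) ->
    \sum_(x <- s) a x *: x = 0 -> forall x, x \in s -> a x = 0.

Definition spanning_set (B : set V) : Prop :=
  forall v, exists (s : seq V) (a : V -> K),
    (forall x, x \in s -> B x) /\ v = \sum_(x <- s) a x *: x.

Definition is_basis (B : set V) : Prop := free_set B /\ spanning_set B.

Lemma basis_exists : exists B, is_basis B.
Proof.
have [F Ffree Ftot|A [Afree Amax]] := @Zorn_bigcup V free_set.
  move=> s a us sF; suff [->//|[X FX sX]] : s = [::] \/
    exists2 X, F X & forall x, x \in s -> X x by exact: (Ffree X).
  elim: s {us a} sF => [|x s IH] sF; first by left.
  right; have [X FX Xx] := sF x (mem_head _ _).
  have [|->|[Y FY sY]] := IH.
  - by move=> y ys; apply: sF; rewrite inE ys orbT.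
  - by exists X => // y; rewrite inE => /eqP ->.
  have [XY|YX] := Ftot _ _ FX FY.
    by exists Y => // y; rewrite inE => /orP[/eqP ->|/sY//]; exact: XY.
  by exists X => // y; rewrite inE => /orP[/eqP ->//|/sY/YX].
exists A; split=> // v; have [Av|nAv] := pselect (A v).
  exists [:: v], (fun=> 1); split; first by move=> x; rewrite inE => /eqP ->.
  by rewrite big_seq1 scale1r.
apply: contrapT => nspan; apply: (Amax (A `|` [set v])%classic).
  by split; [move=> x; left|move/(_ v (or_intror erefl))].
move=> s a us sAv s0.
have [vs|vs] := boolP (v \in s); last first.
  apply: (Afree s a us _ s0) => x xs.
  by have [//|/= xv] := sAv x xs; rewrite -xv xs in vs.
move: s0; rewrite (big_rem v) //=.
have rA x : x \in rem v s -> A x.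
  rewrite mem_rem_uniq // inE => /andP[/eqP xv /sAv[]//].
have [av|av] := eqVneq (a v) 0.
  rewrite av scale0r add0r => s0 x xs; have [->//|xv] := eqVneq x v.
  apply: (Afree _ _ (rem_uniq _ us) rA s0).
  by rewrite mem_rem_uniq // inE xv.
move=> s0; exfalso; apply: nspan.
exists (rem v s), (fun x => - (a v)^-1 * a x); split=> //.
under eq_bigr do rewrite -scalerA; rewrite -scaler_sumr.
move/eqP: s0; rewrite addrC addr_eq0 => /eqP ->.
by rewrite scaleNr scalerN opprK scalerA mulVf // scale1r.
Qed.

(** [dim V] is the index type of a chosen basis: its cardinal is the (possibly
    infinite) dimension of [V]. *)
Definition dim : Type := {x : V | sval (cid basis_exists) x}.

End Dimension.

(** An [R]-module killed by the maximal ideal is a vector space over the residue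
    field, by [\pi a *: x = a *: x]. *)

Section ResidueSpace.
Variables (R : localRingType) (E : lmodType R).

Definition kspace (kE : killed E) : Type := E.

Variable kE : killed E.
HB.instance Definition _ := GRing.Zmodule.on (kspace kE).

Definition kspace_scale (c : residue R) (x : kspace kE) : kspace kE :=
  (repr c *: (x : E))%R.

Lemma kspace_pi a x : kspace_scale (\pi_(residue R) a) x = a *: (x : E).
Proof.
apply/eqP; rewrite -subr_eq0 /kspace_scale; apply/eqP.
rewrite -[LHS]/(repr (\pi_(residue R) a) *: (x : E) - a *: (x : E)) -scalerBl.
by apply: kE; rewrite Quotient.idealrBE reprK.
Qed.

Lemma kspace_scaleA a b v :
  kspace_scale a (kspace_scale b v) = kspace_scale (a * b) v.
Proof. by rewrite -[a]reprK -[b]reprK -rmorphM !kspace_pi scalerA. Qed.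

Lemma kspace_scale1r : left_id 1 kspace_scale.
Proof. by move=> v; rewrite -(rmorph1 \pi_(residue R)) kspace_pi scale1r. Qed.

Lemma kspace_scalerDr : right_distributive kspace_scale +%R.
Proof. by move=> a u v; rewrite /kspace_scale scalerDr. Qed.

Lemma kspace_scalerDl v : {morph kspace_scale^~ v : a b / a + b}.
Proof.
by move=> a b; rewrite -[a]reprK -[b]reprK -rmorphD !kspace_pi scalerDl.
Qed.

HB.instance Definition _ := GRing.Zmodule_isLmodule.Build (residue R)
  (kspace kE)
  kspace_scaleA kspace_scale1r kspace_scalerDr kspace_scalerDl.

Definition rank : Type := dim (kspace kE).

End ResidueSpace.

(** [M cap m N], meaning the inverse image of [m N] under [f : M -> N] *)

Definition cap_mmul (R : localRingType) (M N : lmodType R)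
    (f : {linear M -> N}) : submodule M :=
  preim_submodule f (mmul N).

Lemma quot_cap_mmul_killed (R : localRingType) (M N : lmodType R)
  (f : {linear M -> N}) : killed (quotmod (cap_mmul f)).
Proof.
move=> a x am; rewrite -[x]reprK quotmodZ; apply/quotmod_eq0.
apply/asboolP; rewrite linearZ /=.
by exists 1%N, (fun=> a), (fun=> f (repr x)); rewrite big_ord1.
Qed.

Arguments quot_cap_mmul_killed {R M N} f a x _.

Definition projective (R : pzRingType) (P : lmodType R) : Prop :=
  forall (A B : lmodType R) (g : {linear A -> B}) (f : {linear P -> B}),
    (forall b, exists a, g a = b) ->
    exists h : {linear P -> A}, forall x, g (h x) = f x.

Record resolution (R : pzRingType) (A : lmodType R) := Resolution {
  res_mod :> nat -> lmodType R;
  res_diff : forall n, {linear res_mod n.+1 -> res_mod n};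
  res_aug : {linear res_mod 0%N -> A};
  res_proj : forall n, projective (res_mod n);
  res_aug_surj : forall x, exists y, res_aug y = x;
  res_exact0 : forall x, res_aug x = 0 <-> exists y, res_diff 0%N y = x;
  res_exactS : forall n x,
    res_diff n x = 0 <-> exists y, res_diff n.+1 y = x }.

Definition finite_pd (R : pzRingType) (A : lmodType R) : Prop :=
  exists (P : resolution A) (n : nat),
    forall i, (n < i)%N -> forall x : P i, x = 0.

(** Every module has a projective resolution: iterate the cover of a module by
    the free module on its elements. *)

Section FreeCover.
Variables (R : nzRingType) (V : lmodType R).

Lemma fglift_linear (S : choiceType) (g : S -> V) : linear (fglift g).
Proof.
have addL : zmod_morphism (fglift g) := lift_is_additive g.
pose L : {additive {freeg S / R} -> V} :=
  HB.pack (fglift g) (GRing.isZmodMorphism.Build _ _ _ addL).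
suff Z (a : R) (x : {freeg S / R}) : L (a *: x) = a *: L x.
  by move=> a u v; rewrite -[LHS]/(L (a *: u + v)) raddfD Z.
have Lx : L x = \sum_(z <- dom x) L << coeff z x *g z >>.
  by rewrite -[in LHS](freeg_sumE x) raddf_sum.
have Lax : L (a *: x) = \sum_(z <- dom x) L << a * coeff z x *g z >>.
  by rewrite -raddf_sum.
rewrite Lax Lx scaler_sumr; apply: eq_bigr => z _.
by rewrite /= !liftU scalerA.
Qed.

HB.instance Definition _ (S : choiceType) (g : S -> V) :=
  GRing.isLinear.Build R {freeg S / R} V *:%R (fglift g) (fglift_linear g).

Definition free_cover : lmodType R := {freeg V / R}.
Definition free_aug : {linear free_cover -> V} := fglift (@id V).

Lemma free_aug_surj x : exists y, free_aug y = x.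
Proof. by exists << x >>%R; rewrite /= liftU scale1r. Qed.

End FreeCover.

Lemma freeg_projective (R : nzRingType) (S : choiceType) :
  projective ({freeg S / R} : lmodType R).
Proof.
move=> A B g f gsurj.
have /choice[l lP] : forall x : S, exists a, g a = f << x >>%R by [].
exists (fglift l) => x; rewrite -[x]freeg_sumE !linear_sum; apply: eq_bigr => z _.
have -> : << coeff z x *g z >> = coeff z x *: << z >> :> {freeg S / R}.
  by apply/eqP/freeg_eqP => y; rewrite coeffZ !coeffU mul1r.
by rewrite !linearZ /= liftU scale1r lP.
Qed.

Section StandardResolution.
Variables (R : nzRingType) (A : lmodType R).

Fixpoint syzygy (n : nat) : lmodType R :=
  if n is n'.+1 then submod (kermod (free_aug (syzygy n'))) else A.

Definition std_mod (n : nat) : lmodType R := free_cover (syzygy n).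

Definition std_diff (n : nat) : {linear std_mod n.+1 -> std_mod n} :=
  (val : submod (kermod (free_aug (syzygy n))) -> std_mod n)
    \o free_aug (syzygy n.+1).

Lemma std_exact0 x :
  free_aug (syzygy 0) x = 0 <-> exists y, std_diff 0 y = x.
Proof.
split=> [/eqP x0|[y <-]]; last by apply/eqP; exact: (submod_valP (free_aug _ y)).
have [y yP] := free_aug_surj (@SubMod _ _ (kermod (free_aug (syzygy 0))) x x0 : syzygy 1).
by exists y; rewrite /= yP.
Qed.

Lemma std_exactS n x :
  std_diff n x = 0 <-> exists y, std_diff n.+1 y = x.
Proof.
have E : std_diff n x = 0 <-> free_aug (syzygy n.+1) x = 0.
  split=> [e|e]; first exact: val_inj.
  by rewrite [LHS]/(val (free_aug (syzygy n.+1) x)) e.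
rewrite E; split=> [/eqP x0|[y <-]].
  have [y yP] := free_aug_surj (@SubMod _ _ (kermod (free_aug (syzygy n.+1))) x x0 : syzygy n.+2).
  by exists y; rewrite /= yP.
by apply/eqP; exact: (submod_valP (free_aug (syzygy n.+2) y)).
Qed.

Definition std_resolution : resolution A :=
  @Resolution R A std_mod std_diff (free_aug (syzygy 0))
    (fun n => @freeg_projective R (syzygy n))
    (@free_aug_surj R A) std_exact0 std_exactS.

End StandardResolution.

Section Cohomology.
Variables (R : comNzRingType) (A : lmodType R) (P : resolution A).
Variables (M : lmodType R).

Definition is_cocycle (n : nat) (f : P n -> M) : Prop :=
  linear f /\ forall x, f (res_diff P n x) = 0.

Definition is_coboundary (n : nat) : (P n -> M) -> Prop :=
  match n with
  | 0 => fun f => forall x, f x = 0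
  | n'.+1 => fun f =>
      exists g : {linear P n' -> M}, forall x, f x = g (res_diff P n' x)
  end.

Lemma cocycle_closed n : submod_closed [pred f : P n -> M | `[< is_cocycle f >]].
Proof.
split=> [|c f g /asboolP[fL f0] /asboolP[gL g0]]; apply/asboolP; split.
- by move=> a x y; rewrite scaler0 addr0.
- by [].
- move=> a x y; rewrite -[LHS]/(c *: f (a *: x + y) + g (a *: x + y)).
  rewrite -[(c *: f + g) x]/(c *: f x + g x) -[(c *: f + g) y]/(c *: f y + g y).
  by rewrite fL gL !scalerDr !scalerA [c * a]mulrC addrACA.
- by move=> x; rewrite -[LHS]/(c *: f _ + g _) f0 g0 scaler0 addr0.
Qed.

Definition cocycle n : submodule (P n -> M) := Submodule (@cocycle_closed n).

Lemma coboundaryP n : submod_closed [pred f : P n -> M | `[< is_coboundary f >]].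
Proof.
split=> [|c f g /asboolP fB /asboolP gB]; apply/asboolP.
  by case: n => [|n] //=; exists \0.
case: n f g fB gB => [|n] f g /= fB gB.
  by move=> x; rewrite -[LHS]/(c *: f x + g x) fB gB scaler0 addr0.
have [[f' fE] [g' gE]] := (fB, gB); exists (c \*: f' \+ g') => x /=.
by rewrite -[LHS]/(c *: f x + g x) fE gE.
Qed.

Lemma coboundary_closed n :
  submod_closed [pred f : submod (cocycle n) | `[< is_coboundary (val f) >]].
Proof.
have [B0 BL] := @coboundaryP n; split=> [|c f g fB gB]; first exact: B0.
exact: (BL c (val f) (val g)).
Qed.

Definition coboundary n : submodule (submod (cocycle n)) :=
  Submodule (@coboundary_closed n).

Definition cohom n : lmodType R := quotmod (coboundary n).

End Cohomology.

(** Ext in the first variable is computed on one fixed projective resolution. *)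
Definition Ext (R : comNzRingType) (n : nat) (A M : lmodType R) : lmodType R :=
  cohom (std_resolution A) M n.

Section Corestriction.
Variables (R : pzRingType) (Q C : lmodType R) (U : submodule C).
Variables (f : {linear Q -> C}) (fU : forall x, f x \in smem U).

Definition corestr (x : Q) : submod U := SubMod (fU x).

Lemma corestr_linear : linear corestr.
Proof. by move=> a x y; apply: val_inj; rewrite /= linearP. Qed.

HB.instance Definition _ :=
  GRing.isLinear.Build R Q (submod U) *:%R corestr corestr_linear.

End Corestriction.

Lemma lift_exact (R : pzRingType) (Q B C D : lmodType R)
    (g : {linear B -> C}) (h : {linear C -> D}) (f : {linear Q -> C}) :
  projective Q -> (forall x, h x = 0 <-> exists y, g y = x) ->
  (forall x, h (f x) = 0) -> exists s : {linear Q -> B}, forall x, g (s x) = f x.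
Proof.
move=> Qproj ex hf.
have fU x : f x \in smem (kermod h) by apply/eqP.
have gU x : g x \in smem (kermod h) by apply/eqP/ex; exists x.
have [[c cU]|s sP] := Qproj _ _ (corestr gU : {linear _ -> _})
  (corestr fU : {linear _ -> _}).
  have /ex[y yc] : h c = 0 by exact/eqP.
  by exists y; apply: val_inj.
by exists s => x; have /(congr1 val) := sP x.
Qed.

Section CohomologyKilled.
Variables (R : localRingType) (A : lmodType R) (kA : killed A).
Variables (P : resolution A) (a : R) (am : a \in maxideal R).

Lemma homotopy n : exists s : {linear P n -> P n.+1}, forall y : P n.+1,
  res_diff P n (a *: y - s (res_diff P n y)) = 0.
Proof.
elim: n => [|n [s sP]].
  have [|||s sP] := @lift_exact _ (P 0%N) _ _ _ (res_diff P 0) (res_aug P)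
    (a \*: idfun).
  - exact: res_proj.
  - exact: res_exact0.
  - by move=> x /=; rewrite linearZ /= kA.
  exists s => y; rewrite linearB linearZ /= sP /= subrr //.
have [|||t tP] := @lift_exact _ (P n.+1) _ _ _ (res_diff P n.+1) (res_diff P n)
  ((a \*: idfun) \- (s \o res_diff P n)).
- exact: res_proj.
- exact: res_exactS.
- by move=> x /=; rewrite sP.
exists t => y; rewrite linearB linearZ /= tP /=.
have -> : res_diff P n (res_diff P n.+1 y) = 0 by apply/res_exactS; exists y.
by rewrite linear0 subr0 subrr.
Qed.

Lemma cocycle_killed n (M : lmodType R) (f : P n -> M) :
  is_cocycle f -> is_coboundary (a *: f).
Proof.
case: n f => [|n] f [fL f0] /=.
  move=> x; rewrite -[LHS]/(a *: f x).
  pose F : {linear P 0%N -> M} := HB.pack f (GRing.isLinear.Build _ _ _ _ f fL).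
  have /res_exact0[y yE] : res_aug P (a *: x) = 0 by rewrite linearZ /= kA.
  by rewrite -[LHS]/(a *: F x) -linearZ /= -yE; exact: f0.
pose F : {linear P n.+1 -> M} := HB.pack f (GRing.isLinear.Build _ _ _ _ f fL).
have [s sP] := homotopy n; exists (F \o s) => y.
have /res_exactS[z zE] := sP y.
apply/eqP; rewrite -subr_eq0 -[X in X - _]/(a *: F y) -linearZ -linearB /= -zE.
exact/eqP/f0.
Qed.

Lemma cohom_killed_aux n M (x : cohom P M n) : a *: x = 0.
Proof.
elim/quotW: x => f; rewrite quotmodZ; apply/quotmod_eq0/asboolP.
by apply: cocycle_killed; exact/asboolP/(submod_valP f).
Qed.

End CohomologyKilled.

Lemma cohom_killed (R : localRingType) (A : lmodType R) (P : resolution A)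
  n (M : lmodType R) : killed A -> killed (cohom P M n).
Proof. by move=> kA a x am; exact: cohom_killed_aux. Qed.

Lemma Ext_residue_killed (R : localRingType) n (M : lmodType R) :
  killed (Ext n (residue R) M).
Proof. exact/cohom_killed/residue_killed. Qed.

Arguments Ext_residue_killed {R} n M a x _.

(** A cardinal is represented by a type: equality of cardinals is [#=] between
    full sets, sums and products are those of types. *)

Definition bass (R : localRingType) (n : int) (M : lmodType R) : Type :=
  match n with
  | Posz n => rank (Ext_residue_killed n M)
  | Negz _ => void
  end.

(* Main.v *)
From HB Require Import structures.
Require Import Defs.
From mathcomp Require Import all_boot all_order all_algebra.
From mathcomp Require Import ring_quotient ring.
From mathcomp Require Import boolp classical_sets functions cardinality.
From mathcomp.multinomials Require Import freeg.

(** Write [k] for the residue field, [M'] for [M cap m N] and [Q = M / M'], a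
    vector space over [k] of dimension [r].  The exact sequence
    [0 -> M' -> M -> Q -> 0] gives the equality as soon as the maps
    [Ext^n (k, M) -> Ext^n (k, Q)] are zero: the long exact sequence then breaks up
    into [0 -> Ext^(n-1) (k, Q) -> Ext^n (k, M') -> Ext^n (k, M) -> 0], and
    [Ext^(n-1) (k, Q)] is a sum of [r] copies of [Ext^(n-1) (k, k)] because [k] has
    a resolution by finitely generated modules ([product_basis]).  As [Q] embeds
    into [N / m N], its coordinate forms extend to linear forms on [N], and it
    suffices that [Ext^n (k, N) -> Ext^n (k, k)] is zero for every linear form
    [phi : N -> k] ([finite_pd_form_zero]).

    Let [alpha] be a class in [Ext^n (k, N)].  Cap product with [alpha] maps
    [Tor_(n+j) (k, k)] to [Tor_j (N, k)], which is zero for [j > pd N]; so cap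
    product with [phi alpha], from [Tor_(n+j) (k, k)] to [Tor_j (k, k)], is zero for
    large [j].  Suppose that some chain map of degree -2 on the resolution of the
    second factor induces surjections [Tor_(i+2) (k, k) -> Tor_i (k, k)].  It
    commutes with cap products, which act through the first factor, and the
    vanishing comes down from [j + 2] to [j], hence to [j = 0]
    ([pairing_boundary]).  For [j = 0] the cap product is evaluation of [phi alpha],
    which is therefore zero ([ext_map_zero]).

    The chain map is where singularity is used.  When the ring is singular, minimal
    generators [x] of the maximal ideal have a syzygy that is not a consequence of
    the Koszul relations [x_i x_j = x_j x_i]: otherwise [x] is a regular sequence,
    the ideals generated by its initial segments form a chain of primes, and by
    Krull's theorem there is no longer chain, so that the ring is regular
    ([syzygies_koszul_regular], [singular_syzygy]).  A coordinate of syzygies modulo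
    the Koszul ones is a class in [Ext^2 (k, k)], and the chain map [Th] extends it.
    In a Tate resolution it would be the derivation with respect to a variable of
    degree 2, and the divided powers of that variable would show that it is onto.
    Here the divided powers come from the 2-periodic complex of free modules with
    differential [d_x + (z wedge -)] on the exterior algebra, where [z] is the
    syzygy: its action on the resolution satisfies the Leibniz rule with [Th] up to
    homotopy ([homotopyP]), which is enough ([shift_map_onto]).

    Dimensions may be infinite; they are compared through families that induce bases
    of subquotients ([relative_basis]), and Steinitz exchange by Zorn's lemma shows
    that the cardinal of a basis is well defined ([basis_family_card]). *)

Set Implicit Arguments.
Unset Strict Implicit.
Unset Printing Implicit Defensive.

Import GRing.Theory.
Local Open Scope ring_scope.

(** * Chains of primes in a noetherian ring *)

Definition ideal (R : comNzRingType) (I : R -> Prop) : Prop :=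
  [/\ I 0, forall x y, I x -> I y -> I (x + y) & forall a x, I x -> I (a * x)].

Definition prime_ideal (R : comNzRingType) (P : R -> Prop) : Prop :=
  [/\ ideal P, ~ P 1 & forall x y, P (x * y) -> P x \/ P y].

Definition included (R : comNzRingType) (I J : R -> Prop) : Prop :=
  forall x, I x -> J x.

Lemma idealB (R : comNzRingType) (I : R -> Prop) x y :
  ideal I -> I x -> I y -> I (x - y).
Proof. by case=> _ D M Ix Iy; apply: (D) => //; rewrite -mulN1r; apply: M. Qed.

Lemma ideal_sum (R : comNzRingType) (I : R -> Prop) (T : Type) (s : seq T)
    (P : pred T) (F : T -> R) :
  ideal I -> (forall t, P t -> I (F t)) -> I (\sum_(t <- s | P t) F t).
Proof.
by case=> I0 D _ IF; elim/big_ind: _ => // x y; exact: D.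
Qed.

Lemma ideal_prod_congr (R : comNzRingType) (I : R -> Prop) (T : Type) (s : seq T)
    (F G : T -> R) :
  ideal I -> (forall t, I (F t - G t)) -> I (\prod_(t <- s) F t - \prod_(t <- s) G t).
Proof.
move=> idI FG; elim: s => [|t s IH].
  by rewrite !big_nil subrr; case: idI.
rewrite !big_cons; set f := \prod_(_ <- _) _; set g := \prod_(_ <- _) _.
have -> : F t * f - G t * g = f * (F t - G t) + G t * (f - g) by ring.
by have [_ D M] := idI; apply: D; apply: M.
Qed.

Lemma ideal_det_congr (R : comNzRingType) (I : R -> Prop) n (A B : 'M[R]_n) :
  ideal I -> (forall i j, I (A i j - B i j)) -> I (\det A - \det B).
Proof.
move=> idI AB; rewrite /determinant -sumrB; apply: ideal_sum => // s _.
by rewrite -mulrBr; have [_ _ M] := idI; apply: M; apply: ideal_prod_congr.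
Qed.

Lemma noetherian_ideal (R : comNzRingType) (I : R -> Prop) :
  noetherian R -> ideal I ->
  exists n (g : 'I_n -> R), (forall k, I (g k)) /\
    forall c, I c -> exists a : 'I_n -> R, c = \sum_k a k * g k.
Proof.
move=> noeR [I0 D M].
have Ucl : @submod_closed R R^o [pred x | `[< I x >]].
  split=> [|a u v /asboolP Iu /asboolP Iv]; apply/asboolP => //.
  by apply: D => //; apply: M.
have [s sP] := noeR (Submodule Ucl).
exists (size s), (fun k => s`_k); split=> [k|c Ic]; last exact/(sP c)/asboolP.
apply/asboolP/(sP s`_k); exists (fun j => (j == k)%:R).
rewrite (bigD1 k) //= eqxx scale1r big1 ?addr0 // => j /negbTE ->.
by rewrite scale0r.
Qed.

Lemma noetherian_acc (R : comNzRingType) (f : nat -> R -> Prop) :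
  noetherian R -> (forall n, ideal (f n)) ->
  (forall n, included (f n) (f n.+1)) ->
  exists n, forall m, included (f m) (f n).
Proof.
move=> noeR idf incf.
have le_f m n : (m <= n)%N -> included (f m) (f n).
  move=> /subnK <-; elim: (n - m)%N => // k IH x fx.
  by rewrite addSn; apply: incf; exact: IH.
have idU : ideal (fun x => exists n, f n x).
  split=> [|x y [m fx] [n fy]|a x [n fx]].
  - by exists 0%N; case: (idf 0%N).
  - exists (maxn m n); have [_ D _] := idf (maxn m n); apply: D.
      by apply: le_f fx; rewrite leq_maxl.
    by apply: le_f fy; rewrite leq_maxr.
  - by exists n; case: (idf n) => _ _; apply.
have [s [g [/choice[k kP] gP]]] := noetherian_ideal noeR idU.
exists (\max_i k i) => m x fx; have /gP[a ->] : exists n, f n x by exists m.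
apply: (@ideal_sum R (f (\max_i k i))) => // i _; have [_ _ M] := idf (\max_i k i); apply: M.
by apply: le_f (kP i); exact: leq_bigmax.
Qed.

Lemma noetherian_max (R : comNzRingType) (F : (R -> Prop) -> Prop) :
  noetherian R -> (forall I, F I -> ideal I) -> (exists I, F I) ->
  exists I, F I /\ forall J, F J -> included I J -> included J I.
Proof.
move=> noeR idF [I0 FI0]; apply: contrapT => nomax.
pose T := {I : R -> Prop | F I}.
have /choice[g gP] : forall I : T, exists J : T,
    included (sval I) (sval J) /\ ~ included (sval J) (sval I).
  move=> [I FI]; apply: contrapT => noJ; apply: nomax; exists I; split=> // J FJ IJ.
  by apply: contrapT => nJI; apply: noJ; exists (exist _ J FJ).
pose f n : T := iter n g (exist _ I0 FI0).
have [||n nP] := @noetherian_acc R (fun n => sval (f n)) noeR.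
- by move=> n; exact: idF (svalP (f n)).
- by move=> n; exact: (gP (f n)).1.
- exact: (gP (f n)).2 (nP n.+1).
Qed.

Definition adjoin (R : comNzRingType) (I : R -> Prop) (a : R) : R -> Prop :=
  fun z => exists u c, I u /\ z = u + c * a.

Definition saturation (R : comNzRingType) (p I : R -> Prop) : R -> Prop :=
  fun z => exists t, ~ p t /\ I (t * z).

Definition saturated (R : comNzRingType) (p I : R -> Prop) : Prop :=
  forall t z, ~ p t -> I (t * z) -> I z.

Section IdealOps.
Variable R : comNzRingType.
Implicit Types (I p : R -> Prop).

Lemma adjoin_ideal I a : ideal I -> ideal (adjoin I a).
Proof.
case=> I0 D M; split.
- by exists 0, 0; rewrite mul0r addr0.
- move=> _ _ [u [c [Iu ->]]] [v [d [Iv ->]]]; exists (u + v), (c + d).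
  by split; [exact: D|ring].
- by move=> b _ [u [c [Iu ->]]]; exists (b * u), (b * c); split; [exact: M|ring].
Qed.

Lemma adjoin_sub I a : included I (adjoin I a).
Proof. by move=> x Ix; exists x, 0; rewrite mul0r addr0. Qed.

Lemma adjoin_self I a : ideal I -> adjoin I a a.
Proof. by case=> I0 _ _; exists 0, 1; rewrite mul1r add0r. Qed.

Lemma prime_mulC p x y : prime_ideal p -> ~ p x -> ~ p y -> ~ p (x * y).
Proof. by case=> _ _ pM px py /pM[]. Qed.

Lemma saturation_ideal p I : prime_ideal p -> ideal I -> ideal (saturation p I).
Proof.
move=> pp [I0 D M]; split.
- by exists 1; rewrite mulr0; case: pp.
- move=> x y [t [pt Itx]] [s [ps Isy]]; exists (t * s); split; first exact: prime_mulC.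
  have -> : t * s * (x + y) = s * (t * x) + t * (s * y) by ring.
  by apply: D; apply: M.
- move=> a x [t [pt Itx]]; exists t; split=> //.
  by rewrite mulrCA; apply: M.
Qed.

Lemma saturation_saturated p I : prime_ideal p -> saturated p (saturation p I).
Proof.
move=> pp t z pt [s [ps Istz]]; exists (s * t); split; first exact: prime_mulC.
by rewrite -mulrA.
Qed.

Lemma saturation_sub p I : prime_ideal p -> included I (saturation p I).
Proof. by case=> _ p1 _ x Ix; exists 1; rewrite mul1r. Qed.

Lemma saturationS p I J : included I J -> included (saturation p I) (saturation p J).
Proof. by move=> IJ x [t [pt It]]; exists t; split=> //; exact: IJ. Qed.

Lemma saturated_sub p I : saturated p I -> ~ I 1 -> included I p.
Proof.
by move=> sI I1 x Ix; apply: contrapT => px; apply: I1; apply: (sI x) => //; rewrite mulr1.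
Qed.

End IdealOps.

Section PrincipalIdealTheorem.
Variables (R : comNzRingType) (noeR : noetherian R) (p I0 : R -> Prop).
Hypothesis pp : prime_ideal p.
Hypothesis pmin : forall Q, prime_ideal Q -> included I0 Q -> included Q p -> included p Q.

(** When [p] is minimal over [I0], the localisation at [p] of [R / I0] has only
    one prime, hence should be artinian.  The descending chain condition is
    proved by noetherian induction on the lower bound [U]: some [a] outside [U]
    has [p a] inside [U], so that between [U] and [U + (a)] there is locally
    nothing, and a chain above [U] is controlled by the chain that it induces
    above [U + (a)] and by whether it meets that gap. *)
Lemma saturated_dcc (U : R -> Prop) : ideal U -> saturated p U -> included I0 U ->
  forall L : nat -> R -> Prop,
    (forall i, [/\ ideal (L i), saturated p (L i) & included U (L i)]) ->
    (forall i, included (L i.+1) (L i)) ->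
  exists i, forall j, (i <= j)%N -> included (L i) (L j).
Proof.
move=> idU satU I0U; apply: contrapT => badU.
pose good (U : R -> Prop) := forall L : nat -> R -> Prop,
    (forall i, [/\ ideal (L i), saturated p (L i) & included U (L i)]) ->
    (forall i, included (L i.+1) (L i)) ->
  exists i, forall j, (i <= j)%N -> included (L i) (L j).
pose F U := [/\ ideal U, saturated p U, included I0 U & ~ good U].
have [||V [[idV satV I0V badV] maxV]] := @noetherian_max R F noeR.
- by move=> I [].
- by exists U.
apply: badV => L LP Ldec.
have [V1|V1] := pselect (V 1).
  exists 0%N => j _ x _; have [[_ _ M] _ VL] := LP j.
  by rewrite -[x]mulr1; apply: M; exact: VL.
have Vp := saturated_sub satV V1.
(* a maximal annihilator of an element modulo [V] is a prime, hence [p] *)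
have [a [nVa pa]] : exists a, ~ V a /\ forall x, p x -> V (x * a).
  pose col b : R -> Prop := fun x => V (x * b).
  have idcol b : ideal (col b).
    case: idV => V0 D M; split; rewrite /col ?mul0r //.
      by move=> x y Vx Vy; rewrite mulrDl; exact: D.
    by move=> c x Vx; rewrite -mulrA; exact: M.
  have [||Q [[a nVa QE] Qmax]] :=
      @noetherian_max R (fun I => exists2 b, ~ V b & I = col b) noeR.
  - by move=> I [b _ ->].
  - by exists (col 1), 1.
  exists a; split=> // x px; move: Qmax; rewrite QE => Qmax.
  apply: (pmin (Q := col a)) => //.
  + split=> //; first by rewrite /col mul1r.
    move=> y z Vyza; have [|nVya] := pselect (V (y * a)); first by left.
    right; apply: (Qmax (col (y * a))) => //; first by exists (y * a).
      by move=> w; rewrite /col mulrCA => Vw; case: idV => _ _; apply.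
    by rewrite /col mulrA [z * y]mulrC.
  + by move=> y /I0V Vy; rewrite /col mulrC; case: idV => _ _; apply.
  + move=> y Vya; apply: contrapT => py; exact: nVa (satV _ _ py Vya).
pose W := saturation p (adjoin V a).
have idW : ideal W by apply/saturation_ideal/adjoin_ideal.
have goodW : good W.
  apply: contrapT => badW; apply: nVa; apply: (maxV W).
  - split=> //; first exact: saturation_saturated.
    by move=> x /I0V Vx; apply/saturation_sub/adjoin_sub.
  - by move=> x Vx; apply/saturation_sub/adjoin_sub.
  - exact/saturation_sub/adjoin_self.
have Lle i j : (i <= j)%N -> included (L j) (L i).
  move=> /subnK <-; elim: (j - i)%N => // k IH x.
  by rewrite addSn => /Ldec; exact: IH.
have [||i0 i0P] := goodW (fun i => saturation p (adjoin (L i) a)).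
- move=> i; have [idL satL VL] := LP i; split.
  + exact/saturation_ideal/adjoin_ideal.
  + exact: saturation_saturated.
  + apply: saturationS => x [u [c [Vu ->]]]; exists u, c; split=> //; exact: VL.
- move=> i; apply: saturationS => x [u [c [Lu ->]]]; exists u, c; split=> //.
  exact: Ldec.
have step i j x : (i0 <= i)%N -> (i <= j)%N -> L i x ->
    exists t b c, [/\ ~ p t, L j b, t * x = b + c * a & L i (c * a)].
  move=> ii0 ij Lx.
  have /(i0P j (leq_trans ii0 ij)) [t [pt [b [c [Lb E]]]]] :
      saturation p (adjoin (L i0) a) x.
    by apply/saturation_sub/adjoin_sub => //; exact: Lle Lx.
  exists t, b, c; split=> //; have [idL _ _] := LP i.
  have -> : c * a = t * x - b by rewrite E addrC addKr.
  by apply: idealB => //; [case: idL => _ _; apply|exact: Lle Lb].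
pose e i := exists b, [/\ L i b, W b & ~ V b].
have [[i1 ne]|alle] := pselect (exists i, ~ e i).
  exists (maxn i0 i1) => j ij x Lx.
  have [t [b [c [pt Lb E Lca]]]] := step _ j x (leq_maxl i0 i1) ij Lx.
  have [idL satL VL] := LP j; apply: (satL t) => //; rewrite E.
  case: (idL) => _ D _; apply: D => //; apply: VL; apply: contrapT => nVca.
  apply: ne; exists (c * a); split=> //; first by apply: Lle Lca; exact: leq_maxr.
  by case: idW => _ _; apply; exact/saturation_sub/adjoin_self.
exists i0 => j ij x Lx.
have [t [b [c [pt Lb E _]]]] := step _ j x (leqnn i0) ij Lx.
have [idL satL VL] := LP j; apply: (satL t) => //; rewrite E.
case: (idL) => _ D M; apply: (D) => //; apply: (M).
have [d [Ld [s [ps [u [c' [Vu sd]]]]] nVd]] : e j.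
  by apply: contrapT => nej; apply: alle; exists j.
have nc' : ~ p c'.
  move=> /pa Vc'a; apply: nVd; apply: (satV s) => //; rewrite sd.
  by case: idV => _ DV _; exact: DV.
apply: (satL c') => //; have -> : c' * a = s * d - u by rewrite sd addrC addKr.
by apply: idealB => //; [exact: M|exact: VL].
Qed.

End PrincipalIdealTheorem.

(** Krull's principal ideal theorem, as the statement that a chain [q < q' < p]
    can be moved so that its middle term contains a given element of [p].  If it
    cannot, [p] is minimal over [q + (x)], and the chain condition applies to the
    [q']-saturations [J i] of [q + (y ^ i)], for [y] in [q'] but not in [q]:
    modulo [x] they become stationary locally at [p], then Nakayama's lemma at
    [p] makes [J i] itself stationary, which [y] contradicts. *)
Theorem principal_ideal_theorem (R : comNzRingType) (q q' p : R -> Prop) (x : R) :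
  noetherian R -> prime_ideal q -> prime_ideal q' -> prime_ideal p ->
  included q q' -> ~ included q' q -> included q' p -> ~ included p q' -> p x ->
  exists Q, [/\ prime_ideal Q, included q Q, ~ included Q q,
    included Q p & ~ included p Q /\ Q x].
Proof.
move=> noeR pq pq' pp qq' nq'q q'p npq' px; apply: contrapT => noQ.
have nq'x : ~ q' x by move=> q'x; apply: noQ; exists q'.
have nqx : ~ q x by move/qq'.
have pmin Q : prime_ideal Q -> included (adjoin q x) Q -> included Q p -> included p Q.
  move=> pQ qxQ Qp; apply: contrapT => npQ; apply: noQ; exists Q.
  have Qx : Q x by apply: qxQ; apply: adjoin_self; case: pq.
  by split=> // [y /(adjoin_sub x)/qxQ|/(_ x Qx)].
have [y [q'y nqy]] : exists y, q' y /\ ~ q y.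
  apply: contrapT => noy; apply: nq'q => y q'y; apply: contrapT => nqy.
  by apply: noy; exists y.
have idq : ideal q by case: pq.
have idp : ideal p by case: pp.
have idq' : ideal q' by case: pq'.
pose J i := saturation q' (adjoin q (y ^+ i)).
have idJ i : ideal (J i) by apply/saturation_ideal/adjoin_ideal.
have qJ i : included q (J i).
  by move=> z qz; apply/saturation_sub/adjoin_sub.
have Jdec i : included (J i.+1) (J i).
  apply: saturationS => _ [u [c [qu ->]]]; exists u, (c * y); split=> //.
  by rewrite exprS mulrA.
pose L i := saturation p (adjoin (J i) x).
have [|||||i /(_ i.+1 (leqnSn i)) Li] := @saturated_dcc R noeR p (adjoin q x) pp
    pmin (saturation p (adjoin q x)) _ _ _ L.
- exact/saturation_ideal/adjoin_ideal.
- exact: saturation_saturated.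
- exact: saturation_sub.
- move=> i; split.
  + exact/saturation_ideal/adjoin_ideal.
  + exact: saturation_saturated.
  + apply: saturationS => _ [u [c [qu ->]]]; exists u, c; split=> //; exact: qJ.
- move=> i; apply: saturationS => _ [u [c [Ju ->]]]; exists u, c; split=> //.
  exact: Jdec.
have JxJ a : J i a -> exists t b c, [/\ ~ p t, J i.+1 b, J i c & t * a = b + c * x].
  move=> Ja; have /Li[t [pt [b [c [Jb E]]]]] : L i a.
    exact/saturation_sub/adjoin_sub.
  exists t, b, c; split=> //.
  apply: (saturation_saturated pq' nq'x).
  have -> : x * c = t * a - b by rewrite E; ring.
  by have [_ _ M] := idJ i; apply: (idealB (idJ i)); [exact: M|exact: Jdec].
have JJ : included (J i) (J i.+1).
  have [s [g [Jg Jsp]]] := noetherian_ideal noeR (idJ i).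
  have /choice[t tP] k := JxJ _ (Jg k).
  have /choice[b bP] k := tP k.
  have /choice[c cP] k := bP k.
  have /choice[C CP] k : exists a : 'I_s -> R, c k = \sum_j a j * g j.
    by apply: Jsp; case: (cP k).
  (* [A] maps the generators of [J i] into [J i.+1], and modulo [p] it is diagonal
     with entries outside [p] *)
  pose A := \matrix_(k, j) (t k *+ (k == j) - x * C k j) : 'M[R]_s.
  pose v := \col_k g k : 'cV[R]_s.
  have Av k : J i.+1 ((A *m v) k 0).
    suff -> : (A *m v) k 0 = b k by case: (cP k).
    have [_ _ _ E] := cP k; rewrite !mxE.
    under eq_bigr do rewrite !mxE mulrBl -mulrA.
    rewrite big_split /= sumrN -mulr_sumr -CP (bigD1 k) //= eqxx mulr1n big1 ?addr0.
      by rewrite E; ring.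
    by move=> j; rewrite eq_sym => /negbTE ->; rewrite mulr0n mul0r.
  have detA : ~ p (\det A).
    have dA : p (\det A - \det (diag_mx (\row_k t k))).
      apply: ideal_det_congr => // k j; rewrite !mxE addrAC subrr add0r -mulrN mulrC.
      by case: (idp) => _ _; apply.
    have {}dA : p (\det A - \prod_k t k).
      by move: dA; rewrite det_diag; under eq_bigr do rewrite mxE.
    move=> pA; have : p (\prod_k t k).
      by rewrite -(subKr (\det A) (\prod_k t k)); apply: idealB.
    apply: (big_ind (fun z => ~ p z)) => [|a1 a2|k _]; first by case: pp.
      exact: prime_mulC.
    by case: (cP k).
  have Js' k : J i.+1 (g k).
    apply: (saturation_saturated pq' (t := \det A)); first by move/q'p.
    have -> : \det A * g k = (\adj A *m (A *m v)) k 0.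
      by rewrite mulmxA mul_adj_mx mul_scalar_mx !mxE.
    rewrite mxE; apply: (@ideal_sum R (J i.+1)) => // j _.
    by have [_ _ M] := idJ i.+1; apply: M.
  move=> a /Jsp[u ->]; apply: (@ideal_sum R (J i.+1)) => // j _.
  by have [_ _ M] := idJ i.+1; apply: M.
have /JJ[t [nq't [u [c [qu E]]]]] : J i (y ^+ i).
  by apply/saturation_sub/adjoin_self => //.
have pow k : ~ q (y ^+ k).
  by elim: k => [|k IH]; [case: pq|rewrite exprS; exact: prime_mulC].
have : q (y ^+ i * (t - c * y)).
  have -> : y ^+ i * (t - c * y) = u by rewrite -[u](addrK (c * y ^+ i.+1)) -E exprS; ring.
  by [].
case: pq => _ _ pM /pM[/pow//|/qq' q'tcy]; apply: nq't.
rewrite -(subrK (c * y) t); case: (idq') => _ D M; apply: D => //; exact: M.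
Qed.

Fixpoint prime_chain_between (R : comNzRingType) (l : nat) (q p : R -> Prop) : Prop :=
  match l with
  | 0 => [/\ prime_ideal q, prime_ideal p & included q p]
  | l'.+1 => prime_ideal p /\ exists p', [/\ prime_chain_between l' q p',
      included p' p & ~ included p p']
  end.

Section Chains.
Variable R : comNzRingType.
Implicit Types q p : R -> Prop.

Lemma prime_chain_primeR l q p : prime_chain_between l q p -> prime_ideal p.
Proof. by case: l => [|l] /=; case. Qed.

Lemma prime_chain_sub l q p : prime_chain_between l q p -> included q p.
Proof.
by elim: l p => [|l IH] p /=; [case|case=> _ [p' [/IH qp' p'p _]] x /qp'/p'p].
Qed.

(** Moving the terms of a chain one after another, from the top down, by the
    principal ideal theorem. *)
Lemma prime_chain_push l q p (x : R) : noetherian R ->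
  prime_chain_between l.+1 q p -> p x ->
  exists q1, [/\ prime_chain_between l q1 p, included q q1 & q1 x].
Proof.
move=> noeR; elim: l p => [|l IH] p [pp [p' [cp' p'p npp']]] px.
  have qp : included q p by case: cp' => _ _ qp' y /qp'/p'p.
  by exists p; split=> //; split.
have [pp' [p'' [cp'' p''p' np'p'']]] := cp'.
have [Q [pQ p''Q nQp'' Qp [npQ Qx]]] :=
  principal_ideal_theorem noeR (prime_chain_primeR cp'') pp' pp p''p' np'p'' p'p npp' px.
have [||q1 [cq1 qq1 q1x]] := IH Q => //; first by split=> //; exists p''.
by exists q1; split=> //; split=> //; exists Q.
Qed.

(** Krull's height theorem: [x 0], [x 1], ... are pushed one at a time into the
    bottom of the chain, which costs one term each, and in the end the bottom
    contains [m]. *)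
Lemma prime_chain_bound (x : nat -> R) n m : noetherian R ->
  prime_ideal m -> (forall i, (i < n)%N -> m (x i)) ->
  (forall P, ideal P -> (forall i, (i < n)%N -> P (x i)) -> included m P) ->
  forall l q, prime_chain_between l q m -> (l <= n)%N.
Proof.
move=> noeR pm mx mP l q clq.
suff: forall k i l q, (i + k = n)%N -> prime_chain_between l q m ->
    (forall j, (j < i)%N -> q (x j)) -> (l <= k)%N.
  by apply; [exact: add0n|exact: clq|].
elim=> [|k IH] i {clq}l {}q ikn; case: l => // l clq qx.
  rewrite addn0 in ikn; case: clq => _ [p' [cp' p'm]]; case; apply: mP.
    by case: (prime_chain_primeR cp').
  by move=> j jn; apply: (prime_chain_sub cp'); apply: qx; rewrite ikn.
have lt_in : (i < n)%N by rewrite -ikn -addSnnS leq_addr.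
have [q1 [cq1 qq1 q1x]] := prime_chain_push noeR clq (mx _ lt_in).
rewrite ltnS; apply: (IH i.+1 l q1) => //; first by rewrite addSnnS.
by move=> j; rewrite ltnS leq_eqVlt => /orP[/eqP ->//|/qx/qq1].
Qed.

End Chains.

Lemma prime_idealrP (R : comNzRingType) (P : R -> Prop) : prime_ideal P ->
  exists S : prime_idealr R, forall x, x \in S <-> P x.
Proof.
move=> [[P0 D M] P1 PM]; pose S : R -> bool := [pred x | `[< P x >]].
have idS : idealr_closed S.
  split=> [||a u v]; first exact/asboolP.
    by apply/negP => /asboolP.
  by move=> /asboolP Pu /asboolP Pv; apply/asboolP; apply: (D) => //; apply: (M).
have prS : prime_idealr_closed S.
  move=> u v /asboolP/PM[Pu|Pv]; apply/orP; [left|right]; exact/asboolP.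
pose I := isIdealr.Build R S idS.
pose J := isPrimeIdealrClosed.Build R S prS.
pose T : prime_idealr R := HB.pack S I J.
by exists T => x; split=> [/asboolP|Px] //; apply/asboolP.
Qed.

Lemma prime_idealr_prime (R : comNzRingType) (S : prime_idealr R) :
  prime_ideal (fun x => x \in S).
Proof.
split; first split; rewrite ?rpred0 //.
- by move=> x y; exact: rpredD.
- by move=> a x; exact: idealMr.
- by move/negP: (idealr1 S).
- by move=> x y; rewrite prime_idealrM => /orP.
Qed.

Section Local.
Variable R : localRingType.
Local Notation m := (maxideal R).

Lemma proper_ideal_sub (I : R -> Prop) : ideal I -> ~ I 1 ->
  forall x, I x -> x \in m.
Proof.
move=> idI I1.
have [||J [[[J0 D M] IJ J1] Jmax]] := @noetherian_max R
  (fun J => [/\ ideal J, included I J & ~ J 1]) (@local_noetherian R).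
- by move=> J [].
- by exists I; split.
have mJ : maximal_ideal [pred x : R | `[< J x >]].
  split.
    split=> [||a u v /asboolP Ju /asboolP Jv]; first exact/asboolP.
      by apply/negP => /asboolP.
    by apply/asboolP; apply: (D) => //; exact: M.
  move=> K [K0 K1 KL] JK x Kx; apply/asboolP.
  apply: (Jmax (fun x => x \in K)) => //.
    split=> //; last by exact/negP.
      split=> // [y z Ky Kz|a y Ky]; first by rewrite -[y]mul1r; exact: KL.
      by rewrite -[_ * _]addr0; exact: KL.
    by move=> y /IJ Jy; apply: JK; apply/asboolP.
  by move=> y Jy; apply: JK; apply/asboolP.
by move=> x /IJ Jx; rewrite -(@maxideal_unique R _ mJ); apply/asboolP.
Qed.

Lemma local_inverse (x : R) : x \notin m -> exists y, y * x = 1.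
Proof.
move=> xm; apply: contrapT => noy; move/negP: xm; apply.
apply: (@proper_ideal_sub (fun z => exists y, z = y * x)).
- split; first by exists 0; rewrite mul0r.
    by move=> _ _ [u ->] [v ->]; exists (u + v); rewrite mulrDl.
  by move=> a _ [u ->]; exists (a * u); rewrite mulrA.
- by move=> [y yx]; apply: noy; exists y.
- by exists 1; rewrite mul1r.
Qed.

Lemma maxideal_prime : prime_ideal (fun x => x \in m).
Proof.
split; first split; rewrite ?rpred0 //.
- by move=> x y; exact: rpredD.
- by move=> a x; exact: idealMr.
- by apply/negP; case: (@maxidealP R) => -[].
- move=> x y xym; have [|xm] := boolP (x \in m); first by left.
  have [z zx] := local_inverse xm; right.
  by rewrite -[y]mul1r -zx -mulrA idealMr.
Qed.

Lemma maxideal1 : (1 \in m) = false.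
Proof. by apply/negP; case: maxideal_prime. Qed.

Lemma inverse_add1 (x : R) : x \in m -> exists y, y * (1 - x) = 1.
Proof.
move=> xm; apply: local_inverse; apply/negP => xm'.
by move: maxideal1; rewrite -(subrK x 1) rpredD.
Qed.

Definition span_below (x : nat -> R) (i : nat) (z : R) : Prop :=
  exists a : nat -> R, z = \sum_(j < i) a j * x j.

Lemma span_below_ideal x i : ideal (span_below x i).
Proof.
split; first by exists (fun=> 0); rewrite big1 // => j _; rewrite mul0r.
  move=> _ _ [a ->] [b ->]; exists (fun j => a j + b j).
  by rewrite -big_split; apply: eq_bigr => j _; rewrite mulrDl.
move=> c _ [a ->]; exists (fun j => c * a j).
by rewrite mulr_sumr; apply: eq_bigr => j _; rewrite mulrA.
Qed.

Lemma span_belowS x i z :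
  span_below x i.+1 z <-> exists u c, span_below x i u /\ z = u + c * x i.
Proof.
split=> [[a ->]|[u [c [[a ->] ->]]]].
  by exists (\sum_(j < i) a j * x j), (a i); rewrite big_ord_recr /=; split=> //; exists a.
exists (fun j => if j == i then c else a j); rewrite big_ord_recr /= eqxx.
by congr (_ + _); apply: eq_bigr => j _; rewrite ltn_eqF.
Qed.

Definition regular_sequence (x : nat -> R) (n : nat) : Prop :=
  forall i a, (i < n)%N -> span_below x i (a * x i) -> span_below x i a.

(** Descending induction: if [x i] is regular modulo [P = (x 0, ..., x i.-1)]
    and [P + (x i)] is prime, then every element outside [P] is, modulo [P], a
    power of [x i] times an element outside [P + (x i)], by Krull's intersection
    theorem for a regular element. *)
Lemma regular_sequence_prime x n : (forall i, (i < n)%N -> x i \in m) ->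
  regular_sequence x n -> prime_ideal (span_below x n) ->
  forall i, (i <= n)%N -> prime_ideal (span_below x i).
Proof.
move=> xm rx pn i /subKn <-; have := leq_subr i n.
elim: (n - i)%N => [|k IH] nk; first by rewrite subn0.
have {IH} := IH (ltnW nk); set j := (n - k.+1)%N.
have -> : (n - k = j.+1)%N by rewrite /j subnSK.
have jn : (j < n)%N by rewrite /j -subn_gt0 subKn.
move=> [_ pn1 pM].
have idj : ideal (span_below x j) := span_below_ideal x j.
have [P0 D M] := idj.
have subS z : span_below x j z -> span_below x j.+1 z.
  by move=> Pz; apply/span_belowS; exists z, 0; rewrite mul0r addr0.
have nzd e a : span_below x j (x j ^+ e * a) -> span_below x j a.
  elim: e => [|e IHe]; first by rewrite expr0 mul1r.
  by rewrite exprS -mulrA mulrC => /(rx _ _ jn).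
have fact a : ~ span_below x j a -> exists e u b,
    [/\ span_below x j u, ~ span_below x j.+1 b & a = u + x j ^+ e * b].
  move=> nPa; apply: contrapT => nofact; apply: nPa.
  have /choice[g gP] e : exists b, span_below x j (a - x j ^+ e * b).
    elim: e => [|e [b Pb]]; first by exists a; rewrite mul1r subrr.
    have [/span_belowS[u [c [Pu E]]]|nb] := pselect (span_below x j.+1 b).
      exists c; have -> : a - x j ^+ e.+1 * c = a - x j ^+ e * b + x j ^+ e * u.
        by rewrite E exprS; ring.
      by apply: (D) => //; exact: M.
    by case: nofact; exists e, (a - x j ^+ e * b), b; rewrite subrK.
  have gS e : span_below x j (g e - x j * g e.+1).
    apply: (@nzd e); rewrite mulrBr mulrA -exprSr.
    have -> : x j ^+ e * g e - x j ^+ e.+1 * g e.+1 =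
      (a - x j ^+ e.+1 * g e.+1) - (a - x j ^+ e * g e) by ring.
    exact: idealB.
  have [||e eP] := @noetherian_acc R (fun e => adjoin (span_below x j) (g e)) (@local_noetherian R).
  - by move=> e; exact: adjoin_ideal.
  - move=> e _ [u [c [Pu ->]]]; exists (u + c * (g e - x j * g e.+1)), (c * x j).
    by split; [apply: (D) => //; exact: M|ring].
  have [u [c [Pu E]]] : adjoin (span_below x j) (g e) (g e.+1).
    by apply: (eP e.+1); exact: adjoin_self.
  have Pg : span_below x j (g e.+1).
    have [y yE] : exists y, y * (1 - c * x j) = 1.
      by apply: inverse_add1; rewrite idealMr ?xm.
    rewrite -[g _]mul1r -yE -mulrA; apply: (M).
    have -> : (1 - c * x j) * g e.+1 = u + c * (g e - x j * g e.+1).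
      by rewrite {1}mulrBl mul1r {1}E; ring.
    by apply: (D) => //; apply: (M).
  by rewrite -(subrK (x j ^+ e.+1 * g e.+1) a); apply: (D) => //; apply: (M).
split=> //; first by move/subS.
move=> a b Pab; apply: contrapT => /not_orP[nPa nPb].
have [e [u [a' [Pu na' aE]]]] := fact a nPa.
have [f [v [b' [Pv nb' bE]]]] := fact b nPb.
have : span_below x j (a' * b').
  apply: (@nzd (e + f)%N); have -> : x j ^+ (e + f) * (a' * b') =
     a * b - (u * b + x j ^+ e * a' * v) by rewrite aE bE exprD; ring.
  by apply: idealB => //; apply: (D); [rewrite mulrC|]; apply: (M).
by move=> /subS/pM[].
Qed.

(** The initial segments of [x] generate a chain of primes of length [n].  A chain
    of any length may be assumed to end at the maximal ideal, where the height
    theorem bounds it. *)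
Lemma regular_sequence_regular x n :
  (forall z, z \in m <-> span_below x n z) -> regular_sequence x n -> regular R.
Proof.
move=> mE rx.
have xn i : (i < n)%N -> span_below x n (x i).
  move=> lt_in; exists (fun j => (j == i)%:R).
  rewrite (bigD1 (Ordinal lt_in)) //= eqxx mul1r big1 ?addr0 // => j jn.
  rewrite [_ == _](_ : _ = false) ?mul0r //; apply/negP => /eqP E.
  by move/eqP: jn; apply; exact: val_inj.
have xm i : (i < n)%N -> x i \in m by move/xn/mE.
have pn : prime_ideal (span_below x n).
  have [_ n1 pM] := maxideal_prime; split; first exact: span_below_ideal.
    by move/mE.
  by move=> a b /mE/pM[/mE|/mE]; [left|right].
have pi := regular_sequence_prime xm rx pn.
exists (mkseq x n); rewrite size_mkseq; split.
  move=> z; split=> [/mE[a ->]|[a ->]].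
    rewrite size_mkseq; exists (fun j => a j); apply: eq_bigr => j _.
    by rewrite nth_mkseq.
  apply: rpred_sum => j _; rewrite idealMr // nth_mkseq ?xm //.
    by rewrite -{2}(size_mkseq x n).
  by rewrite -{2}(size_mkseq x n).
split.
  have /choice[p pP] i : exists S : prime_idealr R, (i <= n)%N ->
      forall z, z \in S <-> span_below x i z.
    have [lein|ltni] := leqP i n; last first.
      by have [S _] := prime_idealrP pn; exists S.
    by have [S SP] := prime_idealrP (pi i lein); exists S.
  exists p => i lt_in; have le_in := ltnW lt_in; split.
    move=> z /(pP i le_in) Pz; apply/(pP i.+1 lt_in)/span_belowS.
    by exists z, 0; rewrite mul0r addr0.
  move=> /(_ (x i)) sub.
  have /rx : span_below x i (1 * x i).
    rewrite mul1r; apply/(pP i le_in)/sub/(pP i.+1 lt_in)/span_belowS.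
    by exists 0, 1; rewrite mul1r add0r; split=> //; case: (span_below_ideal x i).
  by move=> /(_ lt_in); case: (pi i le_in).
move=> l [p pP].
have cl : prime_chain_between l (fun z => z \in p 0%N) (fun z => z \in p l).
  elim: l pP => [|l IH] pP; first by split=> //; exact: prime_idealr_prime.
  split; first exact: prime_idealr_prime.
  have [ps nps] := pP l (ltnSn l).
  exists (fun z => z \in p l); split=> //.
  by apply: IH => i /ltnW; exact: pP.
have plm z : z \in p l -> z \in m.
  apply: (proper_ideal_sub (I := fun z => z \in p l)); by case: (prime_idealr_prime (p l)).
have bound k q : prime_chain_between k q (fun z => z \in m) -> (k <= n)%N.
  apply: (prime_chain_bound (@local_noetherian R) maxideal_prime xm).
  move=> P idP Px z /mE[a ->]; apply: (@ideal_sum R P) => // j _.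
  by case: idP => _ _; apply; exact: Px.
case: l pP cl plm => // k pP [_ [p' [cp' p'p npp']]] plm.
apply: (bound k.+1 (fun z => z \in p 0%N)); split; first exact: maxideal_prime.
exists p'; split=> // [z /p'p/plm|mp'] //.
by apply: npp' => z /plm/mp'.
Qed.

End Local.

(** * Syzygies of the maximal ideal *)

Definition submodule_pred (R : comNzRingType) (M : lmodType R) (S : M -> Prop) : Prop :=
  S 0 /\ forall a u v, S u -> S v -> S (a *: u + v).

Section SubmodulePred.
Variables (R : comNzRingType) (M : lmodType R) (S : M -> Prop).
Hypothesis subS : submodule_pred S.

Lemma submodD u v : S u -> S v -> S (u + v).
Proof. by move=> Su Sv; rewrite -[u]scale1r; apply: subS.2. Qed.

Lemma submodZ a u : S u -> S (a *: u).
Proof. by move=> Su; rewrite -[_ *: _]addr0; apply: subS.2 => //; exact: subS.1. Qed.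

Lemma submodN u : S u -> S (- u).
Proof. by rewrite -scaleN1r; exact: submodZ. Qed.

Lemma submodB u v : S u -> S v -> S (u - v).
Proof. by move=> Su Sv; apply: submodD => //; exact: submodN. Qed.

Lemma submod_sum (T : Type) (s : seq T) (P : pred T) (F : T -> M) :
  (forall t, P t -> S (F t)) -> S (\sum_(t <- s | P t) F t).
Proof. by move=> SF; elim/big_ind: _ => //; [exact: subS.1|exact: submodD]. Qed.

End SubmodulePred.

(** By induction on [n]: generators of the ideal of first coordinates are lifted,
    and the vectors whose first coordinate is zero live in dimension [n - 1]. *)
Lemma row_submodule_fg (R : comNzRingType) n (S : 'rV[R]_n -> Prop) :
  noetherian R -> submodule_pred S ->
  exists g (G : 'M[R]_(g, n)), forall u, S u <-> exists w : 'rV_g, u = w *m G.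
Proof.
move=> noeR; elim: n S => [|n IH] S subS.
  exists 0%N, 0 => u; rewrite thinmx0; split=> _; last exact: subS.1.
  by exists 0; rewrite mulmx0.
change (submodule_pred (S : 'rV[R]_(1 + n) -> Prop)) in subS.
pose I c := exists v : 'rV[R]_n, S (row_mx c%:M v : 'rV_(1 + n)).
have idI : ideal I.
  split.
  - by exists 0; rewrite raddf0 row_mx0; exact: subS.1.
  - move=> c d [u Su] [v Sv]; exists (u + v); rewrite raddfD /= -add_row_mx.
    exact: (submodD subS).
  - move=> a c [u Su]; exists (a *: u); rewrite -scale_scalar_mx -scale_row_mx.
    exact: (submodZ subS).
have [k [g [/choice[v vP] gP]]] := noetherian_ideal noeR idI.
have [|l [G' G'P]] := IH (fun v => S (row_mx 0 v : 'rV_(1 + n))).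
  split=> [|a u w Su Sw]; first by rewrite row_mx0; exact: subS.1.
  have -> : row_mx 0 (a *: u + w) = a *: row_mx 0 u + row_mx 0 w :> 'rV_(1 + n).
    by rewrite scale_row_mx add_row_mx scaler0 addr0.
  exact: subS.2.
pose V := \matrix_(i < k) v i.
pose G0 := row_mx (\col_i g i) V : 'M[R]_(k, 1 + n).
have G0S (w : 'rV_k) : S (w *m G0).
  rewrite mulmx_sum_row; apply: (submod_sum subS) => i _; apply: (submodZ subS).
  rewrite row_row_mx rowK; have -> : row i (\col_i g i) = (g i)%:M.
    by apply/matrixP => a b; rewrite !ord1 !mxE mulr1n.
  exact: vP.
exists (k + l)%N, (col_mx G0 (row_mx 0 G')) => u; split=> [Su|[w ->]].
  move: u Su; change n.+1 with (1 + n)%N => u Su.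
  have /gP[a aE] : I (u 0 0).
    exists (rsubmx u); have -> : (u 0 0)%:M = lsubmx u.
      by apply/matrixP => i j; rewrite !ord1 !mxE mulr1n; congr (u _ _); exact: val_inj.
    by rewrite hsubmxK.
  pose w : 'rV_k := \row_i a i.
  have E : u - w *m G0 = row_mx 0 (rsubmx u - w *m V).
    rewrite mul_mx_row -{1}[u]hsubmxK opp_row_mx add_row_mx; congr row_mx.
    apply/matrixP => i j; rewrite !ord1 !mxE.
    have -> : lshift n 0 = 0 :> 'I_(1 + n) by exact: val_inj.
    by rewrite aE; apply/eqP; rewrite subr_eq0; apply/eqP/eq_bigr => t _; rewrite !mxE.
  have /G'P[w' w'E] : S (row_mx 0 (rsubmx u - w *m V) : 'rV_(1 + n)).
    by rewrite -E; apply: (submodB subS).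
  exists (row_mx w w'); rewrite mul_row_col [w' *m _]mul_mx_row mulmx0 -w'E -E.
  by rewrite addrC subrK.
change n.+1 with (1 + n)%N.
rewrite -[w]hsubmxK mul_row_col; apply: (submodD subS) => //.
by rewrite mul_mx_row mulmx0; apply/G'P; exists (rsubmx w).
Qed.

(** Generators satisfy a linear system whose matrix is the identity modulo the
    maximal ideal, hence has an invertible determinant. *)
Lemma nakayama (R : localRingType) n (S B : 'rV[R]_n -> Prop) (x : R) :
  x \in maxideal R -> submodule_pred S -> submodule_pred B ->
  (forall u, S u -> exists b s, [/\ B b, S s & u = b + x *: s]) ->
  forall u, S u -> B u.
Proof.
move=> xm subS subB SBS.
have [g [G GP]] := row_submodule_fg (@local_noetherian R) subS.
have GS i : S (row i G) by apply/GP; exists (delta_mx 0 i); rewrite -rowE.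
have /choice[b bP] i := SBS _ (GS i).
have /choice[s sP] i := bP i.
have /choice[c cP] i : exists w : 'rV_g, s i = w *m G by apply/GP; case: (sP i).
pose C := \matrix_i c i.
pose A : 'M_g := 1%:M - x *: C.
have AG i : B (row i (A *m G)).
  rewrite mulmxBl mul1mx -scalemxAl linearB linearZ /= row_mul rowK -cP.
  by have [Bb _ ->] := sP i; rewrite addrK.
have [y yE] : exists y, y * \det A = 1.
  apply: local_inverse; apply/negP => dA.
  have idm : ideal (fun z => z \in maxideal R) by case: (@maxideal_prime R).
  have d1 : \det A - \det (1%:M : 'M[R]_g) \in maxideal R.
    apply: (ideal_det_congr idm) => i j.
    by rewrite !mxE addrAC subrr add0r -mulrN mulrC idealMr.
  move/negP: (negbT (maxideal1 R)); apply.
  by rewrite -(subKr (\det A) 1) rpredB // -(det1 R g).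
have GB i : B (row i G).
  have -> : row i G = \sum_j (y * \adj A i j) *: row j (A *m G).
    rewrite -{1}[G]scale1r -{1}yE -scalerA -[_ *: G]mul_scalar_mx -mul_adj_mx.
    rewrite linearZ /= -mulmxA row_mul mulmx_sum_row scaler_sumr.
    by apply: eq_bigr => j _; rewrite scalerA !mxE.
  by apply: (submod_sum subB) => j _; exact: (submodZ subB).
move=> u /GP[w ->]; rewrite mulmx_sum_row.
by apply: (submod_sum subB) => j _; exact: (submodZ subB).
Qed.

(** The relations among the entries of [x] that hold for formal reasons; an
    alternating matrix is written as [A - A^T]. *)
Definition koszul (R : comNzRingType) n (x : 'cV[R]_n) (u : 'rV[R]_n) : Prop :=
  exists A : 'M[R]_n, u = x^T *m (A - A^T).

Lemma koszul_submodule (R : comNzRingType) n (x : 'cV[R]_n) :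
  submodule_pred (koszul x).
Proof.
split=> [|a _ _ [A ->] [B ->]]; first by exists 0; rewrite trmx0 subr0 mulmx0.
exists (a *: A + B); have -> : (a *: A + B)^T = a *: A^T + B^T.
  by rewrite linearD linearZ.
by rewrite opprD addrACA -scalerBr [in RHS]mulmxDr -scalemxAr.
Qed.

Definition syzygies_koszul (R : comNzRingType) n (x : 'cV[R]_n) : Prop :=
  forall a : 'rV[R]_n, a *m x = 0 -> koszul x a.

Section KoszulRegular.
Variables (R : localRingType).

Lemma koszul_mul (n : nat) (x : 'cV[R]_n) u : koszul x u -> u *m x = 0.
Proof.
move=> [A ->]; rewrite mulmxBr mulmxBl; apply/eqP; rewrite subr_eq0; apply/eqP.
have -> : x^T *m A^T *m x = (x^T *m A *m x)^T by rewrite !trmx_mul trmxK mulmxA.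
by apply/matrixP => i j; rewrite !ord1 [RHS]mxE.
Qed.

(** If a relation among [x] and [y] comes from Koszul relations, comparing the
    [y]-entries writes a syzygy of [x] as a Koszul one plus [y] times another
    syzygy, so that Nakayama's lemma applies. *)
Lemma syzygies_koszul_usub n (x : 'cV[R]_n) (y : 'cV[R]_1) :
  y 0 0 \in maxideal R -> syzygies_koszul (col_mx x y) -> syzygies_koszul x.
Proof.
move=> ym Kxy a ax0.
apply: (@nakayama R n (fun a => a *m x = 0) (koszul x) (y 0 0)) => //.
- split=> [|c u v u0 v0]; first by rewrite mul0mx.
  by rewrite mulmxDl -scalemxAl u0 v0 scaler0 addr0.
- exact: koszul_submodule.
move=> u ux0; have [|A E] := Kxy (row_mx u 0).
  by rewrite mul_row_col ux0 mul0mx addr0.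
move: E; rewrite -[A]submxK tr_col_mx tr_block_mx opp_block_mx add_block_mx.
rewrite mul_row_block => /eq_row_mx[Eu E0].
exists (x^T *m (ulsubmx A - (ulsubmx A)^T)), (dlsubmx A - (ursubmx A)^T); split.
- by exists (ulsubmx A).
- apply: trmx_inj; rewrite trmx0 trmx_mul linearB /= trmxK.
  move: E0; rewrite [y^T *m _](_ : _ = 0) ?addr0 => [E0|].
    by rewrite -[LHS]opprK -mulmxN opprB -E0 oppr0.
  apply/matrixP => i j; rewrite !ord1 !mxE big_ord_recl big_ord0 !mxE.
  by rewrite subrr mulr0 addr0.
- by rewrite Eu [y^T]mx11_scalar mul_scalar_mx mxE.
Qed.

Lemma syzygies_koszul_regular_sequence (x : nat -> R) n :
  (forall i, (i < n)%N -> x i \in maxideal R) ->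
  syzygies_koszul (\col_(i < n) x i) -> regular_sequence x n.
Proof.
elim: n => [|n IH] xm Kx; first by move=> i a; rewrite ltn0.
have xE : \col_(i < n.+1) x i = castmx (addn1 n, erefl)
    (col_mx (\col_(i < n) x i) (x n)%:M).
  apply/matrixP => i j; rewrite castmxE !mxE; case: splitP => k kE.
    by rewrite !mxE -kE.
  by rewrite !ord1 /= in kE *; rewrite mxE mulr1n; congr x; rewrite addn0 in kE.
have Kx' : syzygies_koszul (col_mx (\col_(i < n) x i) (x n)%:M).
  move=> a a0; move: Kx; rewrite xE; case: _ / (addn1 n) => Kx.
  by apply: Kx; rewrite castmx_id.
move=> i a; rewrite ltnS leq_eqVlt => /orP[/eqP ->|lt_in]; last first.
  apply: IH => //; first by move=> k kn; apply: xm; exact: ltnW.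
  by apply: syzygies_koszul_usub Kx'; rewrite mxE mulr1n xm.
move=> [c cE].
have [|A] := Kx' (row_mx (\row_j - c j) a%:M).
  rewrite mul_row_col; apply/matrixP => k l; rewrite !ord1 !mxE big_ord_recl big_ord0.
  rewrite !mxE !mulr1n addr0 cE -big_split big1 // => j _.
  by rewrite /= !mxE mulNr addNr.
rewrite -[A]submxK tr_col_mx tr_block_mx opp_block_mx add_block_mx mul_row_block.
move=> /eq_row_mx[_ /matrixP/(_ 0 0)].
rewrite !mxE mulr1n big_ord_recl big_ord0 !mxE subrr mulr0 addr0 addr0 => ->.
pose B := ursubmx A - (dlsubmx A)^T.
exists (fun j => if insub j is Some k then B k 0 else 0).
by apply: eq_bigr => j _; rewrite valK mulrC; congr (_ * _); rewrite !mxE.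
Qed.

Lemma syzygies_koszul_regular n (x : 'cV[R]_n) :
  (forall z, z \in maxideal R <-> exists w : 'rV_n, z%:M = w *m x) ->
  syzygies_koszul x -> regular R.
Proof.
move=> xP Kx; pose y i := if insub i is Some k then x k 0 else 0.
have xE : x = \col_(i < n) y i.
  by apply/matrixP => i j; rewrite !ord1 mxE /y valK.
apply: (@regular_sequence_regular R y n).
  move=> z; split=> [/xP[w /matrixP/(_ 0 0)]|[a ->]].
    rewrite !mxE mulr1n => ->; exists (fun j => if insub j is Some k then w 0 k else 0).
    by apply: eq_bigr => j _; rewrite /y !valK.
  apply/xP; exists (\row_j a j); apply/matrixP => i j; rewrite !ord1 !mxE mulr1n.
  by apply: eq_bigr => k _; rewrite !mxE /y valK.
apply: syzygies_koszul_regular_sequence; last by rewrite -xE.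
move=> i lt_in; apply/xP; exists (delta_mx 0 (Ordinal lt_in)).
rewrite -rowE; apply/matrixP => k l; rewrite !ord1 !mxE mulr1n /y.
by rewrite (insubT (fun i => (i < n)%N) lt_in).
Qed.

End KoszulRegular.

(** Minimal generators of [Z] modulo [B]: a relation with an invertible
    coefficient would allow one generator to be dropped. *)
Lemma minimal_row_generators (R : localRingType) p (Z B : 'rV[R]_p -> Prop) :
  submodule_pred Z -> submodule_pred B -> (forall u, B u -> Z u) ->
  exists g (G : 'M[R]_(g, p)), (forall u, Z u <-> exists w : 'rV_g, B (u - w *m G)) /\
    (forall w : 'rV_g, B (w *m G) -> forall i, w 0 i \in maxideal R).
Proof.
move=> subZ subB BZ.
pose gen g (G : 'M[R]_(g, p)) := forall u, Z u <-> exists w : 'rV_g, B (u - w *m G).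
have [g0 [G0 G0P]] := row_submodule_fg (@local_noetherian R) subZ.
have G0gen : gen g0 G0.
  move=> u; split=> [/G0P[w ->]|[w Bw]].
    by exists w; rewrite subrr; exact: subB.1.
  rewrite -(subrK (w *m G0) u); apply: (submodD subZ); first exact: BZ.
  by apply/G0P; exists w.
have exg : exists g, `[< exists G : 'M[R]_(g, p), gen g G >].
  by exists g0; apply/asboolP; exists G0.
case: (ex_minnP exg) => g /asboolP[G Ggen] ming; exists g, G; split=> // w Bw i.
apply: contraPT isT => wi _.
have [y yE] := local_inverse wi.
case: g => [|g] in G Ggen ming w Bw i wi y yE *; first by case: i wi y yE.
have : (g.+1 <= g)%N; last by rewrite ltnn.
apply: ming; apply/asboolP; exists (row' i G) => u.
have drop (v : 'rV_g.+1) : v 0 i = 0 -> v *m G = col' i v *m row' i G.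
  move=> vi; apply/matrixP => k l; rewrite !ord1 !mxE (bigD1_ord i) //= vi mul0r add0r.
  by apply: eq_bigr => j _; rewrite !mxE.
(* a multiple of the relation [w] makes the coefficient at [i] vanish *)
split=> [/Ggen[v Bv]|[v Bv]].
  pose v' := v - (v 0 i * y) *: w.
  exists (col' i v'); rewrite -drop; last by rewrite !mxE -mulrA yE mulr1 subrr.
  rewrite mulmxBl -scalemxAl opprB addrA addrAC.
  by apply: (submodD subB) => //; exact: (submodZ subB).
apply/Ggen; exists (\row_j if unlift i j is Some k then v 0 k else 0).
rewrite drop ?mxE ?unlift_none //.
suff -> : col' i (\row_j (if unlift i j is Some k then v 0 k else 0)) = v by [].
by apply/matrixP => k l; rewrite !ord1 !mxE liftK.
Qed.

Lemma minimal_maxideal_generators (R : localRingType) :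
  exists n (x : 'cV[R]_n),
    (forall z, z \in maxideal R <-> exists w : 'rV_n, z%:M = w *m x) /\
    (forall a : 'rV_n, a *m x = 0 -> forall i, a 0 i \in maxideal R).
Proof.
have [|||n [x [xP xmin]]] := @minimal_row_generators R 1
    (fun u => u 0 0 \in maxideal R) (fun u => u = 0).
- split=> [|a u v um vm]; first by rewrite mxE rpred0.
  by rewrite !mxE rpredD // idealMr.
- by split=> // a u v -> ->; rewrite scaler0 addr0.
- by move=> u ->; rewrite mxE rpred0.
exists n, x; split=> // z; split=> [zm|[w E]].
  have /xP[w /eqP] : (z%:M : 'rV_1) 0 0 \in maxideal R by rewrite mxE mulr1n.
  by rewrite subr_eq0 => /eqP ->; exists w.
have /xP : exists w : 'rV_n, z%:M - w *m x = 0 by exists w; rewrite E subrr.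
by rewrite mxE mulr1n.
Qed.

(** If all syzygies of minimal generators of the maximal ideal were Koszul, the ring
    would be regular.  Here [c] is the coordinate of syzygies along one member of a
    minimal generating set modulo the Koszul syzygies, which is well defined in the
    residue field, and [u0 *m d] is that member. *)
Lemma singular_syzygy (R : localRingType) : singular R ->
  exists n (x : 'cV[R]_n),
    [/\ forall z, z \in maxideal R <-> exists w : 'rV_n, z%:M = w *m x,
        forall a : 'rV_n, a *m x = 0 -> forall i, a 0 i \in maxideal R &
        exists r (d : 'M[R]_(r, n)) (c : 'cV[R]_r) (u0 : 'rV[R]_r),
          [/\ forall u : 'rV_n, u *m x = 0 <-> exists w : 'rV_r, u = w *m d,
              forall u : 'rV_r, koszul x (u *m d) -> (u *m c) 0 0 \in maxideal R &
              (u0 *m c) 0 0 - 1 \in maxideal R]].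
Proof.
move=> singR; have [n [x [xP xmin]]] := minimal_maxideal_generators R.
exists n, x; split=> //.
have subZ : submodule_pred (fun u : 'rV_n => u *m x = 0).
  split=> [|a u v u0 v0]; first by rewrite mul0mx.
  by rewrite mulmxDl -scalemxAl u0 v0 scaler0 addr0.
have subB := koszul_submodule x.
have [g [G [GP Gmin]]] := minimal_row_generators subZ subB (@koszul_mul R n x).
case: g => [|g] in G GP Gmin *.
  case: singR; apply: (syzygies_koszul_regular xP) => a /GP[w].
  by rewrite thinmx0 mul0mx subr0.
have [r [d dP]] := row_submodule_fg (@local_noetherian R) subZ.
have /choice[v vP] i : exists w : 'rV_g.+1, koszul x (row i d - w *m G).
  by apply/GP/dP; exists (delta_mx 0 i); rewrite -rowE.
pose V := \matrix_i v i.
have BV (u : 'rV_r) : koszul x (u *m d - (u *m V) *m G).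
  rewrite -mulmxA -mulmxBr mulmx_sum_row; apply: (submod_sum subB) => i _.
  by apply: (submodZ subB); rewrite linearB /= row_mul rowK.
have cE (u : 'rV_r) : (u *m col 0 V) 0 0 = (u *m V) 0 0.
  by rewrite !mxE; apply: eq_bigr => j _; rewrite !mxE.
have [u0 u0E] : exists u0 : 'rV_r, row 0 G = u0 *m d.
  by apply/dP/GP; exists (delta_mx 0 0); rewrite -rowE subrr; exact: subB.1.
exists r, d, (col 0 V), u0; split=> // [u Bu|].
  rewrite cE; apply: Gmin; rewrite -[X in koszul x X]opprK -[_ *m G](subKr (u *m d)).
  apply: (submodN subB); rewrite opprB; apply: (submodB subB) => //.
rewrite cE; have -> : (u0 *m V) 0 0 - 1 = (u0 *m V - delta_mx 0 0) 0 0.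
  by rewrite !mxE !eqxx.
apply: Gmin; rewrite mulmxBl -rowE u0E -opprB; exact: (submodN subB).
Qed.

(** The Koszul complex on [x], graded modulo 2, with the differential
    [d_x + (z wedge -)], whose square is multiplication by [\sum_i z i * x i].  The
    column [p0] and the matrix [P1] are the components of exterior degree 0 and 1,
    and [b0] is the basis vector of degree 0.  The last two clauses are the
    components of degree 0 and 1 of the differential; the first syzygy that it
    produces from [b0] is [z].  The block matrices in the proof are the tensor
    product with the factor of rank 2 for one more pair of entries. *)
Lemma koszul_factorization (R : comNzRingType) n (I : {pred R}) (x : 'cV[R]_n) (z : 'rV[R]_n) :
  0 \in I -> {in I, forall a, - a \in I} ->
  (forall i, x i 0 \in I) -> (forall i, z 0 i \in I) ->
  exists v (D : 'M[R]_v) (p0 : 'cV[R]_v) (P1 : 'M[R]_(v, n)) (b0 : 'I_v),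
    [/\ D *m D = ((z *m x) 0 0)%:M, forall i j, D i j \in I, p0 b0 0 = 1,
        D *m p0 = P1 *m x & forall b, koszul x (row b (D *m P1) - p0 b 0 *: z)].
Proof.
move=> I0 IN; elim: n x z => [|n IH] x z xI zI.
  exists 1%N, 0, 1%:M, 0, 0; split=> [|||//|b].
  - by rewrite mul0mx thinmx0 mul0mx mxE raddf0.
  - by move=> i j; rewrite mxE.
  - by rewrite mxE.
  - by rewrite mul0mx mul0mx.
  - by exists 0; rewrite [LHS]thinmx0 [RHS]thinmx0.
move: x z xI zI; rewrite -[n.+1]/(1 + n)%N => x z xI zI.
pose y := x 0 0; pose t := z 0 0; pose x' := dsubmx x; pose z' := rsubmx z.
have xE : x = col_mx y%:M x'.
  rewrite -[LHS]vsubmxK; congr col_mx; apply/matrixP => i j.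
  by rewrite !ord1 !mxE mulr1n; congr (x _ _); exact: val_inj.
have zE : z = row_mx t%:M z'.
  rewrite -[LHS]hsubmxK; congr row_mx; apply/matrixP => i j.
  by rewrite !ord1 !mxE mulr1n; congr (z _ _); exact: val_inj.
have [||v [D [p0 [P1 [b0 [DD DI pb0 Dp KP]]]]]] := IH x' z'.
- by move=> i; rewrite mxE.
- by move=> i; rewrite mxE.
exists (v + v)%N, (block_mx D t%:M y%:M (- D)), (col_mx p0 0),
  (block_mx 0 P1 p0 0), (lshift v b0); split.
- rewrite mulmx_block scalar_mx_block xE zE mul_row_col DD -!scalar_mxM.
  rewrite !mul_scalar_mx !mul_mx_scalar scalerN addrN scalerN addrN.
  rewrite mulNmx mulmxN opprK DD -!raddfD /= ![y * t]mulrC.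
  have -> : ((t * y)%:M + z' *m x' : 'M_1) 0 0 = t * y + (z' *m x') 0 0.
    by rewrite mxE [X in X + _]mxE mulr1n.
  by rewrite [(z' *m x') 0 0 + _]addrC.
- move=> i j; case: (split_ordP i) => i' ->; case: (split_ordP j) => j' ->.
  + by rewrite block_mxEul.
  + by rewrite block_mxEur mxE; case: eqP => _; [exact: zI|exact: I0].
  + by rewrite block_mxEdl mxE; case: eqP => _; [exact: xI|exact: I0].
  + by rewrite block_mxEdr mxE; apply/IN.
- by rewrite col_mxEu.
- rewrite mul_block_col xE mul_block_col !mulmx0 !addr0 mul0mx add0r Dp mul0mx addr0.
  by rewrite mul_scalar_mx mul_mx_scalar.
have Kshift u : koszul x' u -> koszul x (row_mx 0 u).
  move=> [A ->]; exists (block_mx 0 0 0 A); rewrite xE tr_col_mx tr_block_mx.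
  rewrite opp_block_mx add_block_mx mul_row_block !trmx0 !subrr !mulmx0.
  by rewrite !addr0 add0r.
move=> b; rewrite mulmx_block !mulmx0 !add0r !addr0 block_mxEv.
case: (split_ordP b) => b' ->.
  rewrite rowKu col_mxEu row_row_mx zE scale_row_mx opp_row_mx add_row_mx.
  rewrite mul_scalar_mx [row b' (t *: p0) - _](_ : _ = 0); first exact: Kshift.
  by apply/matrixP => k l; rewrite !ord1 !mxE mulr1n mulrC subrr.
rewrite rowKd col_mxEd mxE scale0r subr0 row_row_mx mulNmx Dp mul_scalar_mx.
exists (block_mx 0 (row b' P1) 0 0); rewrite xE tr_col_mx tr_block_mx.
rewrite opp_block_mx add_block_mx mul_row_block !trmx0 !subr0 !mulmx0 !add0r addr0.
rewrite tr_scalar_mx mul_scalar_mx linearZ /= mulmxN -trmx_mul -row_mul.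
by congr row_mx; apply/matrixP => k l; rewrite !ord1 !mxE.
Qed.
Local Open Scope quotient_scope.

(** * Free resolutions of the residue field by matrices *)

Section Reduction.
Variable R : localRingType.

Definition residue_mx m n (A : 'M[R]_(m, n)) : 'M[residue R]_(m, n) :=
  map_mx (\pi_(residue R)) A.

Lemma residue_mxM m n p (A : 'M[R]_(m, n)) (B : 'M[R]_(n, p)) :
  residue_mx (A *m B) = residue_mx A *m residue_mx B.
Proof. exact: map_mxM. Qed.

Lemma residue_mxD m n (A B : 'M[R]_(m, n)) : residue_mx (A + B) = residue_mx A + residue_mx B.
Proof. exact: map_mxD. Qed.

Lemma residue_mxB m n (A B : 'M[R]_(m, n)) : residue_mx (A - B) = residue_mx A - residue_mx B.
Proof. exact: map_mxB. Qed.

Lemma residue_mx_tr m n (A : 'M[R]_(m, n)) : residue_mx A^T = (residue_mx A)^T.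
Proof. by rewrite /residue_mx map_trmx. Qed.

Lemma residue_mx_eq0 m n (A : 'M[R]_(m, n)) :
  residue_mx A = 0 <-> forall i j, A i j \in maxideal R.
Proof.
split=> [A0 i j|Am]; last first.
  by apply/matrixP => i j; rewrite !mxE; apply/eqP; rewrite residue_eq0.
by rewrite -residue_eq0; move/matrixP: A0 => /(_ i j); rewrite !mxE => ->.
Qed.

Lemma residue_mx_lift m n (A : 'M[residue R]_(m, n)) : exists B, residue_mx B = A.
Proof.
by exists (map_mx repr A); apply/matrixP => i j; rewrite !mxE reprK.
Qed.

End Reduction.

Section MatrixResolution.
Variables (R : localRingType) (r : nat -> nat) (d : forall j, 'M[R]_(r j.+1, r j)).

(** Chains in degree [j] are row vectors of length [r j], and [d j] is the
    differential from degree [j.+1] to degree [j], acting on the right.  A chain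
    of degree 0 counts as a cycle when it dies in the residue field. *)
Definition rows_cycle m j : 'M[R]_(m, r j) -> Prop :=
  match j with
  | 0 => fun X => residue_mx X = 0
  | j'.+1 => fun X => X *m d j' = 0
  end.

Definition matrix_resolution : Prop := forall j (u : 'rV[R]_(r j)),
  rows_cycle u <-> exists w : 'rV_(r j.+1), u = w *m d j.

(** The cycles of the reduction modulo the maximal ideal, whose homology is
    [Tor (k, k)]. *)
Definition residue_cycle m j : 'M[residue R]_(m, r j) -> Prop :=
  match j with
  | 0 => fun=> True
  | j'.+1 => fun u => u *m residue_mx (d j') = 0
  end.

Definition degree_shift (Th : forall j, 'M[R]_(r j.+2, r j)) : Prop :=
  forall j, d j.+2 *m Th j = Th j.+1 *m d j.

Definition onto_homology (Th : forall j, 'M[R]_(r j.+2, r j)) : Prop :=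
  forall m (z : 'rV_(r m)), residue_cycle z -> exists w h,
    residue_cycle (w : 'rV_(r m.+2)) /\
    w *m residue_mx (Th m) - z = h *m residue_mx (d m).

Lemma rows_cycle_row m j (X : 'M[R]_(m, r j)) :
  rows_cycle X -> forall i, rows_cycle (row i X).
Proof.
case: j X => [|j] X /= X0 i; last by rewrite -row_mul X0 row0.
by apply/residue_mx_eq0 => k l; move/residue_mx_eq0: X0; rewrite mxE.
Qed.

Hypothesis resd : matrix_resolution.

Lemma matrix_resolution_lift m j (X : 'M[R]_(m, r j)) :
  rows_cycle X -> exists W, W *m d j = X.
Proof.
move=> cX; have /choice[w wP] i : exists w : 'rV_(r j.+1), row i X = w *m d j.
  by apply/resd; exact: rows_cycle_row.
exists (\matrix_i w i); apply/row_matrixP => i.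
by rewrite row_mul rowK -wP.
Qed.

Definition lift_rows_spec m j (X : 'M[R]_(m, r j)) :
  {W : 'M_(m, r j.+1) | rows_cycle X -> W *m d j = X}.
Proof.
apply: cid; have [/matrix_resolution_lift[W]|nc] := pselect (rows_cycle X).
  by exists W.
by exists 0.
Qed.

Definition lift_rows m j (X : 'M[R]_(m, r j)) : 'M_(m, r j.+1) := sval (lift_rows_spec X).

Lemma lift_rowsP m j (X : 'M[R]_(m, r j)) : rows_cycle X -> lift_rows X *m d j = X.
Proof. exact: (svalP (lift_rows_spec X)). Qed.

Lemma matrix_resolution_dd j : d j.+1 *m d j = 0.
Proof.
apply/row_matrixP => i; rewrite row_mul row0.
by apply/(resd (row i (d j.+1))); exists (delta_mx 0 i); rewrite -rowE.
Qed.

Lemma residue_mx_d0 : residue_mx (d 0) = 0.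
Proof.
apply/residue_mx_eq0 => i j.
have /residue_mx_eq0/(_ 0 j) : @rows_cycle 1 0 (row i (d 0)).
  by apply/resd; exists (delta_mx 0 i); rewrite -rowE.
by rewrite mxE.
Qed.

Lemma residue_cycle_shift Th m j (z : 'M_(m, r j.+2)) :
  degree_shift Th -> residue_cycle z -> residue_cycle (z *m residue_mx (Th j)).
Proof.
move=> ThP; case: j z => [|j] z //= z0.
by rewrite -mulmxA -residue_mxM -ThP residue_mxM mulmxA z0 mul0mx.
Qed.

End MatrixResolution.

(** A chain map of degree -2 which is onto on [Tor (k, k)].  The functional [c] on
    degree 2 kills the chains whose boundary is a Koszul relation; the chain map
    [Th] extends it.  To invert [Th], the family [M] makes the periodic complex with
    differential [D] act on the resolution: [M m b j] is the product by the basis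
    vector [b], from degree [j] to degree [m], in homological degree [m - j] of the
    periodic complex.  The products by [b0] play the part of divided powers of a
    class on which [Th] takes the value 1, and [Th] is a derivation for them up to
    the homotopy [H].  The rank function is written so that the rank in degree 0 is 1
    by computation. *)
Section DegreeShift.
Variables (R : localRingType) (s : nat -> nat).
Let r j := if j is j'.+1 then s j' else 1%N.
Variable d : forall j, 'M[R]_(r j.+1, r j).
Hypothesis resd : matrix_resolution d.
Variables (c : 'cV[R]_(r 2)) (u0 : 'rV[R]_(r 2)).
Hypothesis cK : forall u : 'rV_(r 2), koszul (d 0) (u *m d 1) ->
  (u *m c) 0 0 \in maxideal R.
Hypothesis cu0 : (u0 *m c) 0 0 - 1 \in maxideal R.
Variables (v : nat) (D : 'M[R]_v) (p0 : 'cV[R]_v) (P1 : 'M[R]_(v, r 1)) (b0 : 'I_v).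
Hypotheses (DD : D *m D = 0) (Dm : forall i j, D i j \in maxideal R).
Hypotheses (pb0 : p0 b0 0 = 1) (Dp : D *m p0 = P1 *m d 0).
Hypothesis KP : forall b, koszul (d 0) (row b (D *m P1) - p0 b 0 *: (u0 *m d 1)).

Let dd : forall j, d j.+1 *m d j = 0 := matrix_resolution_dd resd.

Let lft m j (X : 'M[R]_(m, r j)) : 'M_(m, r j.+1) := lift_rows resd X.

Let lftP m j (X : 'M[R]_(m, r j)) : rows_cycle d X -> lft X *m d j = X.
Proof. exact: lift_rowsP. Qed.

Fixpoint shift_map (j : nat) : 'M[R]_(r j.+2, r j) :=
  if j is j'.+1 then lft (d j'.+2 *m shift_map j') else c.
Local Notation Th := shift_map.

Lemma shift_mapP : degree_shift d Th.
Proof.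
move=> j; symmetry; apply: lftP; elim: j => [|j IH].
  apply/residue_mx_eq0 => i k; rewrite ord1 -[_ i 0](_ : (row i (d 2 *m c)) 0 0 = _).
    rewrite row_mul cK // -row_mul dd row0; exact: (koszul_submodule (d 0)).1.
  by rewrite mxE.
rewrite /= -mulmxA lftP // mulmxA dd mul0mx //.
Qed.

Section Families.
Variable m : nat.
Implicit Types F G : 'I_v -> forall j, 'M[R]_(r j, r m).

Definition Dop F : 'I_v -> forall j, 'M[R]_(r j, r m) :=
  fun b j => \sum_b' D b b' *: F b' j.

Definition dop F : 'I_v -> forall j, 'M[R]_(r j, r m) :=
  fun b j => match j with
  | 0 => 0
  | j'.+1 => (-1) ^+ j' *: (d j' *m F b j')
  end.

(** The differential on maps out of the tensor product of the periodic complex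
    and the resolution; [e] is the sign of the degree. *)
Definition tot (e : R) F : 'I_v -> forall j, 'M[R]_(r j, r m) :=
  fun b j => Dop F b j + e *: dop F b j.

Definition shift_source F : 'I_v -> forall j, 'M[R]_(r j, r m) :=
  fun b j => match j with j'.+2 => Th j' *m F b j' | _ => 0 end.

Lemma tot_ext e F G : (forall b j, F b j = G b j) -> forall b j, tot e F b j = tot e G b j.
Proof.
move=> FG b j; rewrite /tot /Dop; congr (_ + e *: _).
  by apply: eq_bigr => b' _; rewrite FG.
by case: j => //= j; rewrite FG.
Qed.

Lemma totB e F G b j :
  tot e (fun b j => F b j - G b j) b j = tot e F b j - tot e G b j.
Proof.
rewrite /tot opprD addrACA -scalerBr; congr (_ + e *: _).
  by rewrite -sumrB; apply: eq_bigr => b' _; rewrite scalerBr.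
by case: j => [|j] /=; rewrite ?subr0 // mulmxBr scalerBr.
Qed.

Lemma tot_tot e F b j : tot e (tot (- e) F) b j = 0.
Proof.
have -> : tot e (tot (- e) F) b j = Dop (Dop F) b j - e *: Dop (dop F) b j
    + (e *: dop (Dop F) b j - e *: (e *: dop (dop F) b j)).
  rewrite /tot; congr (_ + _).
    rewrite scaler_sumr -sumrB /Dop; apply: eq_bigr => b' _.
    by rewrite scalerDr scaleNr scalerN !scalerA [e * _]mulrC.
  rewrite -scalerBr; congr (_ *: _); case: j => [|j] /=; first by rewrite scaler0 subr0.
  by rewrite mulmxDr scalerDr scaleNr mulmxN scalerN -scalemxAr !scalerA [e * _]mulrC.
have DDF : Dop (Dop F) b j = 0.
  rewrite /Dop; under eq_bigr do rewrite scaler_sumr.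
  rewrite exchange_big big1 //= => b' _; under eq_bigr do rewrite scalerA.
  by rewrite -scaler_suml; have /matrixP/(_ b b') := DD; rewrite !mxE => ->; rewrite scale0r.
have ddF : dop (dop F) b j = 0.
  case: j {DDF} => [|[|j]] //=; first by rewrite mulmx0 scaler0.
  by rewrite -scalemxAr mulmxA dd mul0mx !scaler0.
have dD : dop (Dop F) b j = Dop (dop F) b j.
  case: j {DDF ddF} => [|j] /=; rewrite /Dop; first by rewrite big1 // => b' _; rewrite scaler0.
  rewrite mulmx_sumr scaler_sumr; apply: eq_bigr => b' _.
  by rewrite -scalemxAr !scalerA mulrC.
by rewrite DDF ddF dD !scaler0 subr0 sub0r addNr.
Qed.

Lemma tot_shift_source e F b j :
  tot e (shift_source F) b j = shift_source (tot e F) b j.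
Proof.
case: j => [|[|j]] /=; rewrite /tot /Dop /=.
- by rewrite scaler0 addr0 big1 // => b' _; rewrite scaler0.
- by rewrite mulmx0 !scaler0 addr0 big1 // => b' _; rewrite scaler0.
rewrite mulmxDr mulmx_sumr; congr (_ + _).
  by apply: eq_bigr => b' _; rewrite -scalemxAr.
case: j => [|j]; first by rewrite /= mulmx0 !scaler0 mulmx0.
rewrite -!scalemxAr !mulmxA -shift_mapP !exprS.
by rewrite !mulN1r opprK.
Qed.

Lemma residue_cycle_tot e F b j (z : 'rV_(r j)) :
  residue_cycle d z -> z *m residue_mx (tot e F b j) = 0.
Proof.
have D0 : residue_mx (Dop F b j) = 0.
  apply/residue_mx_eq0 => i k; rewrite summxE rpred_sum // => b' _.
  by rewrite mxE mulrC idealMr.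
rewrite /tot residue_mxD D0 add0r; case: j z {D0} => [|j] z /= cz.
  by rewrite scaler0 /residue_mx raddf0 mulmx0.
by rewrite scalerA scalemxAr residue_mxM mulmxA cz mul0mx.
Qed.

End Families.

Lemma tot_mul m p e F (B : 'M[R]_(r m, r p)) b j :
  tot e F b j *m B = tot e (fun b j => F b j *m B) b j.
Proof.
rewrite /tot /Dop mulmxDl mulmx_suml -scalemxAl; congr (_ + e *: _).
  by apply: eq_bigr => b' _; rewrite scalemxAl.
by case: j => [|j] /=; rewrite ?mul0mx // -scalemxAl mulmxA.
Qed.

Definition diagonal j m (a : R) : 'M[R]_(r j, r m) :=
  if j == m then \matrix_(i, k) (a *+ (i == k :> nat)) else 0.

Lemma diagonal_eq j a : diagonal j j a = a%:M.
Proof. by rewrite /diagonal eqxx; apply/matrixP => i k; rewrite !mxE. Qed.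

Lemma diagonal_neq j m a : j != m -> diagonal j m a = 0.
Proof. by rewrite /diagonal => /negbTE ->. Qed.

(** In homological degree 0 of the periodic complex the products are multiplication
    by [p0], and from degree 0 to degree 1 they are given by [P1]; [defect0] depends
    on these only, and all other products are lifted. *)
Fixpoint product (m : nat) : 'I_v -> forall j, 'M[R]_(r j, r m) :=
  match m with
  | 0 => fun b j => diagonal j 0 (p0 b 0)
  | m'.+1 => fun b j =>
      if (m'.+1 <= j)%N then diagonal j m'.+1 (p0 b 0) else
      (match m' return ('I_v -> forall j, 'M[R]_(r j, r m')) -> 'M[R]_(r j, r m'.+1) with
       | 0 => fun=> match j with 0 => row b P1 | _ => 0 end
       | m''.+1 => fun F => lft (tot ((-1) ^+ m''.+1) F b j)
       end) (product m')
  end.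
Local Notation M := product.

Lemma product_gt m b j : (m < j)%N -> M m b j = 0.
Proof.
move=> mj; case: m mj => [|m] mj /=; first by rewrite diagonal_neq // -lt0n.
by rewrite (ltnW mj) diagonal_neq // gtn_eqF.
Qed.

Lemma product_diag m b : M m b m = (p0 b 0)%:M.
Proof. by case: m => [|m] /=; rewrite ?leqnn diagonal_eq. Qed.

Lemma product_step m b j : M m.+1 b j *m d m = tot ((-1) ^+ m) (M m) b j.
Proof.
have high k b' j' : (k < j')%N ->
    M k.+1 b' j' *m d k = tot ((-1) ^+ k) (M k) b' j'.
  move=> kj; rewrite /tot /Dop big1 ?add0r; last first.
    by move=> b'' _; rewrite product_gt // scaler0.
  case: j' kj => // j'; rewrite ltnS leq_eqVlt => /orP[/eqP <-|kj] /=.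
    rewrite leqnn diagonal_eq product_diag mul_scalar_mx mul_mx_scalar scalerA.
    by rewrite -expr2 sqrr_sign scale1r.
  rewrite ltnS (ltnW kj) diagonal_neq ?gtn_eqF // mul0mx product_gt //.
  by rewrite mulmx0 !scaler0.
elim: m b j => [|m IH] b j.
  have [|jm] := ltnP 0 j; first exact: high.
  case: j jm => // _ /=; rewrite /tot /Dop /= scaler0 addr0.
  have -> : row b P1 *m d 0 = row b (D *m p0) by rewrite Dp row_mul.
  rewrite row_mul mulmx_sum_row; apply: eq_bigr => b' _; rewrite diagonal_eq mxE.
  by congr (_ *: _); apply/matrixP => i k; rewrite !ord1 !mxE mulr1n.
have [|jm] := ltnP m.+1 j; first exact: high.
have -> : M m.+2 b j = lft (tot ((-1) ^+ m.+1) (M m.+1) b j).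
  by rewrite [LHS]/= ltnNge jm.
apply: lftP; rewrite /rows_cycle.
rewrite tot_mul (tot_ext _ (G := tot ((-1) ^+ m) (M m))) //.
by rewrite -[(-1) ^+ m]opprK exprS mulN1r tot_tot.
Qed.

(** The failure of the Leibniz rule for [Th]: differentiating a product, minus the
    product by the shifted element, minus the product after differentiation. *)
Definition defect m b j : 'M[R]_(r j, r m) :=
  M m.+2 b j *m Th m - M m b j - shift_source (M m) b j.

Lemma defect_step m b j : defect m.+1 b j *m d m = tot ((-1) ^+ m) (defect m) b j.
Proof.
rewrite /defect !mulmxBl !totB -tot_mul -product_step; congr (_ - _ - _).
- by rewrite -!mulmxA -shift_mapP !mulmxA product_step -signr_odd /= negbK signr_odd.
- rewrite tot_shift_source; case: j => [|[|j]] /=; rewrite ?mul0mx //.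
  by rewrite -mulmxA product_step.
Qed.

(** The obstruction to a null-homotopy lies in target degree 0 and vanishes there because
    [c] kills Koszul relations: this says that the class of [c] is primitive. *)
Lemma defect0 b j : residue_mx (defect 0 b j) = 0.
Proof.
rewrite /defect; case: j => [|[|[|j]]].
- rewrite /shift_source subr0 product_diag.
  pose u := M 2 b 0 - p0 b 0 *: u0.
  have cu : (u *m c) 0 0 \in maxideal R.
    apply: cK; rewrite mulmxBl (product_step 1 b 0) -scalemxAl /tot /Dop /= scaler0 addr0.
    have -> : \sum_b' D b b' *: row b' P1 = row b (D *m P1).
      by rewrite row_mul mulmx_sum_row; apply: eq_bigr => b' _; rewrite mxE.
    exact: KP.
  apply/residue_mx_eq0 => i k; rewrite !ord1 mxE [X in _ + X]mxE [X in _ - X]mxE mulr1n.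
  have -> : (M 2 b 0 *m Th 0) 0 0 - p0 b 0 =
      (u *m c) 0 0 + p0 b 0 * ((u0 *m c) 0 0 - 1).
    have -> : (u *m c) 0 0 = (M 2 b 0 *m c) 0 0 - p0 b 0 * (u0 *m c) 0 0.
      by rewrite mulmxBl -scalemxAl mxE [X in _ + X]mxE [X in _ - X]mxE.
    by rewrite mulrBr mulr1 addrA subrK.
  by rewrite rpredD // idealMr.
- rewrite (@product_gt 0 b 1) // [shift_source _ _ _]/= !subr0; apply/residue_mx_eq0 => i k.
  rewrite ord1 -[_ i 0](_ : (row i (M 2 b 1 *m c)) 0 0 = _); last by rewrite mxE.
  rewrite row_mul cK // -row_mul (product_step 1 b 1).
  exists ((row b P1)^T *m delta_mx 0 i); rewrite trmx_mul trmxK trmx_delta.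
  rewrite mulmxBr !mulmxA -trmx_mul.
  have -> : tot ((-1) ^+ 1) (M 1) b 1 = ((D *m p0) b 0)%:M - d 0 *m row b P1.
    rewrite /tot /Dop /= expr1 expr0 scale1r scaleN1r; congr (_ - _).
    rewrite mxE raddf_sum; apply: eq_bigr => b' _.
    by rewrite diagonal_eq scale_scalar_mx.
  rewrite Dp linearB /= [row i _%:M]rowE mul_mx_scalar.
  have -> : row b P1 *m d 0 = ((P1 *m d 0) b 0)%:M.
    by rewrite -row_mul; apply/matrixP => k1 k2; rewrite !ord1 !mxE mulr1n.
  rewrite tr_scalar_mx mul_scalar_mx row_mul; congr (_ - _ *m _).
  rewrite -trmx_delta -trmx_mul -rowE.
  by apply/matrixP => k1 k2; rewrite !ord1 !mxE.
- rewrite (@product_gt 0 b 2) // product_diag subr0 [shift_source _ _ _]/= diagonal_eq.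
  by rewrite mul_scalar_mx mul_mx_scalar subrr /residue_mx raddf0.
- rewrite (@product_gt 2 b j.+3) // (@product_gt 0 b j.+3) // mul0mx.
  by rewrite [shift_source _ _ _]/= diagonal_neq // mulmx0 !subr0 /residue_mx raddf0.
Qed.

Fixpoint homotopy (m : nat) : 'I_v -> forall j, 'M[R]_(r j, r m) :=
  match m with
  | 0 => fun b j => 0
  | m'.+1 => fun b j => lft (defect m' b j - tot ((-1) ^+ m'.+1) (homotopy m') b j)
  end.
Local Notation H := homotopy.

Let homotopyS m b j :
  H m.+1 b j = lft (defect m b j - tot ((-1) ^+ m.+1) (H m) b j).
Proof. by []. Qed.

Lemma homotopyP m b j :
  H m.+1 b j *m d m + tot ((-1) ^+ m.+1) (H m) b j = defect m b j.
Proof.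
elim: m b j => [|m IH] b j; rewrite [H _.+1 _ _]homotopyS lftP ?subrK //.
  rewrite /rows_cycle residue_mxB defect0 [tot _ _ _ _](_ : _ = 0) ?subr0 //.
    by rewrite /residue_mx raddf0 subr0.
  rewrite /tot /Dop big1 ?add0r => [|b' _]; last by rewrite scaler0.
  by case: (j) => [|j'] /=; rewrite ?mulmx0 !scaler0.
have -> : (-1) ^+ m.+2 = (-1) ^+ m :> R by rewrite !exprS !mulN1r opprK.
rewrite /rows_cycle mulmxBl defect_step tot_mul -totB.
rewrite (tot_ext _ (G := tot ((-1) ^+ m.+1) (H m))).
  by rewrite exprS mulN1r tot_tot.
by move=> b' j'; rewrite -[defect m b' j']IH addrAC subrr add0r.
Qed.

(** By the Leibniz rule, [Th] maps the product of [z] by [b0] to [z] itself plus a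
    product of [Th z], which has smaller degree and is in the image by induction. *)
Lemma shift_map_onto : onto_homology d Th.
Proof.
move=> m z cz.
(* the induction needs all products of [z], not only [z] *)
have image : forall j (z : 'rV_(r j)), residue_cycle d z ->
    exists w h, residue_cycle d (w : 'rV_(r m.+2)) /\
      w *m residue_mx (Th m) - z *m residue_mx (M m b0 j) = h *m residue_mx (d m).
  move=> {z cz} j; elim/ltn_ind: j => j IH z cz.
  have [w1 [h1 [cw1 E1]]] : exists w h, residue_cycle d (w : 'rV_(r m.+2)) /\
      w *m residue_mx (Th m) - z *m residue_mx (shift_source (M m) b0 j) = h *m residue_mx (d m).
    case: j IH z cz => [|[|j]] IH z cz.
    - by exists 0, 0; rewrite !mul0mx /residue_mx raddf0 mulmx0 subr0 /= mul0mx.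
    - by exists 0, 0; rewrite !mul0mx /residue_mx raddf0 mulmx0 subr0 /= mul0mx.
    have [|w [h [cw E]]] := IH j _ _ (residue_cycle_shift shift_mapP cz) => //.
    by exists w, h; split=> //; rewrite /shift_source residue_mxM mulmxA.
  exists (z *m residue_mx (M m.+2 b0 j) - w1), (z *m residue_mx (H m.+1 b0 j) - h1); split.
    rewrite /residue_cycle mulmxBl -mulmxA -residue_mxM product_step residue_cycle_tot //.
    by rewrite cw1 subr0.
  have /(congr1 (fun X => z *m residue_mx X)) := homotopyP m b0 j.
  rewrite residue_mxD mulmxDr residue_cycle_tot // addr0 /defect !residue_mxB !mulmxBr.
  rewrite !residue_mxM !mulmxA !mulmxBl => ->; rewrite -E1.
  by rewrite opprB addrA subrK addrAC.
have [w [h [cw E]]] := image m z cz; exists w, h; split=> //.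
by rewrite -E product_diag pb0 /residue_mx map_scalar_mx rmorph1 mulmx1.
Qed.

End DegreeShift.

Lemma row_syzygies (R : comNzRingType) m n (A : 'M[R]_(m, n)) : noetherian R ->
  exists p (B : 'M[R]_(p, m)), forall u : 'rV_m, u *m A = 0 <-> exists w, u = w *m B.
Proof.
move=> noeR; apply: (row_submodule_fg noeR).
split=> [|a u v u0 v0]; first by rewrite mul0mx.
by rewrite mulmxDl -scalemxAl u0 v0 scaler0 addr0.
Qed.

Section ExtendResolution.
Variable R : localRingType.

Let stage := {m & {p & 'M[R]_(p, m)}}.
Let src (S : stage) : nat := projT1 S.
Let tgt (S : stage) : nat := projT1 (projT2 S).
Let mat (S : stage) : 'M[R]_(tgt S, src S) := projT2 (projT2 S).

Let next_spec (S : stage) : {T : {p & 'M[R]_(p, tgt S)} |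
  forall u : 'rV_(tgt S), u *m mat S = 0 <-> exists w, u = w *m projT2 T}.
Proof.
apply: cid; have [p [B BP]] := row_syzygies (mat S) (@local_noetherian R).
by exists (existT _ p B).
Qed.

Let next (S : stage) : stage := existT _ (tgt S) (sval (next_spec S)).

(** The first two matrices [x] and [d1] can be prescribed; stating that they are
    kept through an arbitrary property [Q] avoids casts between dimensions. *)
Lemma extend_resolution n (x : 'M[R]_(n, 1)) r2 (d1 : 'M[R]_(r2, n))
    (Q : forall n, 'M[R]_(n, 1) -> forall r2, 'M[R]_(r2, n) -> Prop) :
  Q n x r2 d1 ->
  (forall z, z \in maxideal R <-> exists w : 'rV_n, z%:M = w *m x) ->
  (forall u : 'rV_n, u *m x = 0 <-> exists w : 'rV_r2, u = w *m d1) ->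
  exists s : nat -> nat, let r j := if j is j'.+1 then s j' else 1%N in
    exists d : forall j, 'M[R]_(r j.+1, r j),
      matrix_resolution d /\ Q (r 1%N) (d 0%N) (r 2) (d 1%N).
Proof.
move=> Qxd xP d1P; pose st j : stage := iter j next (existT _ n (existT _ r2 d1)).
pose s j := if j is j'.+1 then tgt (st j') else n.
exists s => r.
pose d j : 'M[R]_(r j.+1, r j) := match j with
  | 0 => x : 'M[R]_(r 1%N, r 0%N)
  | 1 => d1 : 'M[R]_(r 2, r 1%N)
  | j'.+2 => mat (st j'.+1) : 'M[R]_(r j'.+3, r j'.+2)
  end.
exists d; split=> //.
case=> [|[|j]] u.
- have uE : u = (u 0 0)%:M by apply/matrixP => i k; rewrite !ord1 mxE mulr1n.
  split=> [/residue_mx_eq0/(_ 0 0)/xP[w E]|[w E]]; first by exists w; rewrite uE E.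
  by apply/residue_mx_eq0 => i k; rewrite !ord1; apply/xP; exists w; rewrite -uE.
- exact: d1P.
by case: j u => [|j] u; exact: (svalP (next_spec (st _)) u).
Qed.

End ExtendResolution.

Lemma singular_degree_shift (R : localRingType) : singular R ->
  exists (r : nat -> nat) (d : forall j, 'M[R]_(r j.+1, r j)),
    [/\ r 0%N = 1%N, matrix_resolution d &
        exists Th, degree_shift d Th /\ onto_homology d Th].
Proof.
move=> /singular_syzygy[n [x [xP xmin [r2 [d1 [c [u0 [d1P cK cu0]]]]]]]].
pose Q n (x : 'M[R]_(n, 1)) r2 (d1 : 'M[R]_(r2, n)) :=
  (forall a : 'rV_n, a *m x = 0 -> forall i, a 0 i \in maxideal R) /\
  exists (c : 'cV[R]_r2) (u0 : 'rV[R]_r2),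
    [/\ forall u : 'rV_r2, koszul x (u *m d1) -> (u *m c) 0 0 \in maxideal R &
        (u0 *m c) 0 0 - 1 \in maxideal R].
have [|s [d [resd [dmin [c' [u0' [cK' cu0']]]]]]] := @extend_resolution R n x r2 d1 Q _ xP d1P.
  by split=> //; exists c, u0.
set r := fun j => _ in d resd dmin c' u0' cK' cu0'.
exists r, d; split=> //.
have dd := matrix_resolution_dd resd.
pose z : 'rV_(r 1%N) := u0' *m d 1%N.
have zx : z *m d 0%N = 0 by rewrite -mulmxA dd mulmx0.
have [||||v [D [p0 [P1 [b0 [DD DI pb0 Dp KP]]]]]] :=
  @koszul_factorization R (r 1%N) (mem (maxideal R)) (d 0%N) z.
- exact: rpred0.
- by move=> a am; apply: etrans am; exact: rpredN.
- by move=> i; have /residue_mx_eq0 := residue_mx_d0 resd; apply.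
- exact: dmin zx.
rewrite zx mxE raddf0 in DD.
exists (shift_map resd c'); split; first exact: shift_mapP.
exact: (shift_map_onto resd cK' cu0' DD DI pb0 Dp KP).
Qed.

(** * Linear forms on modules of finite projective dimension *)

Section Act.
Variables (R : comNzRingType) (L : lmodType R).

(** A vector of elements of [L] times a matrix over [R]: the complex
    [L (x) Y] for a complex [Y] of free modules given by matrices. *)
Definition act m n (A : 'M[R]_(m, n)) (w : 'I_m -> L) : 'I_n -> L :=
  fun c => \sum_e A e c *: w e.

Lemma actM m n p (A : 'M[R]_(m, n)) (B : 'M[R]_(n, p)) w :
  act (A *m B) w = act B (act A w).
Proof.
apply/funext => c; rewrite /act; under [RHS]eq_bigr do rewrite scaler_sumr.
rewrite exchange_big; apply: eq_bigr => e _ /=; rewrite mxE scaler_suml.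
by apply: eq_bigr => k _; rewrite scalerA mulrC.
Qed.

Lemma actBl m n (A B : 'M[R]_(m, n)) w c : act (A - B) w c = act A w c - act B w c.
Proof. by rewrite /act -sumrB; apply: eq_bigr => e _; rewrite !mxE scalerBl. Qed.

Lemma actB m n (A : 'M[R]_(m, n)) w w' c :
  act A (fun e => w e - w' e) c = act A w c - act A w' c.
Proof. by rewrite /act -sumrB; apply: eq_bigr => e _; rewrite scalerBr. Qed.

Lemma act0 m n (A : 'M[R]_(m, n)) c : act A (fun=> 0) c = 0.
Proof. by rewrite /act big1 // => e _; rewrite scaler0. Qed.

Lemma act0l m n (w : 'I_m -> L) (c : 'I_n) : act 0 w c = 0.
Proof. by rewrite /act big1 // => e _; rewrite mxE scale0r. Qed.

End Act.

Lemma act_linear (R : comNzRingType) (L L' : lmodType R) (f : {linear L -> L'}) m n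
    (A : 'M[R]_(m, n)) w c : f (act A w c) = act A (fun e => f (w e)) c.
Proof. by rewrite linear_sum; apply: eq_bigr => e _; rewrite linearZ. Qed.

Lemma act_residue (R : localRingType) m n (A : 'M[R]_(m, n)) (w : 'I_m -> residue R) :
  \row_c act A w c = (\row_e w e) *m residue_mx A.
Proof.
by apply/matrixP => i c; rewrite !mxE; apply: eq_bigr => e _; rewrite !mxE mulrC.
Qed.

Lemma freeg_sum_dom (R : nzRingType) (V : lmodType R) (S : choiceType) (g : S -> V)
    (D : {freeg S / R}) (Z : seq S) : uniq Z -> {subset dom D <= Z} ->
  fglift g D = \sum_(z <- Z) coeff z D *: g z.
Proof.
move=> uZ DZ; rewrite -[in LHS](freeg_sumE D) linear_sum /=.
under eq_bigr do rewrite liftU.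
rewrite [RHS](bigID (mem (dom D))) /= addrC [X in _ = X + _]big1 ?add0r => [|z zD]; last first.
  by rewrite coeff_outdom // scale0r.
rewrite -[RHS]big_filter; apply: perm_big; apply: uniq_perm; rewrite ?filter_uniq ?uniq_dom //.
by move=> z; rewrite mem_filter; apply/idP/andP => [zD|[]//]; split=> //; exact: DZ.
Qed.

(** The dual basis property of projective modules, for finitely many vectors. *)
Lemma projective_coordinates (R : comNzRingType) (P : lmodType R) m (w : 'I_m -> P) :
  projective P -> exists (Z : seq P) (f : P -> {linear P -> R^o}),
    forall e, w e = \sum_(z <- Z) (f z (w e) : R) *: z.
Proof.
move=> projP.
have [s sP] := projP _ _ (free_aug P) idfun (@free_aug_surj R P).
have lin z : linear (fun x => coeff z (s x) : R^o).
  by move=> a x y; rewrite linearP coeffD coeffZ.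
pose f z : {linear P -> R^o} :=
  HB.pack (fun x => coeff z (s x) : R^o) (GRing.isLinear.Build _ _ _ _ _ (lin z)).
exists (undup (flatten [seq dom (s (w e)) | e <- enum 'I_m])), f => e.
rewrite -[LHS](sP (w e)); apply: freeg_sum_dom; first exact: undup_uniq.
move=> z zD; rewrite mem_undup; apply/flattenP; exists (dom (s (w e))) => //.
by apply: map_f; rewrite mem_enum.
Qed.

Section TorVanishing.
Variables (R : localRingType) (r : nat -> nat) (d : forall j, 'M[R]_(r j.+1, r j)).
Hypothesis resd : matrix_resolution d.

(** Projective modules are flat: the coordinates of a cycle are cycles of the
    resolution itself. *)
Lemma projective_acyclic (P : lmodType R) j (w : 'I_(r j.+1) -> P) : projective P ->
  (forall c, act (d j) w c = 0) -> exists w', forall c, w c = act (d j.+1) w' c.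
Proof.
move=> projP w0; have [Z [f fP]] := projective_coordinates w projP.
have /choice[u uP] z : exists u : 'rV_(r j.+2), \row_e f z (w e) = u *m d j.+1.
  apply/resd; apply/matrixP => i c; rewrite !mxE.
  have /(congr1 (f z)) := w0 c; rewrite act_linear linear0 => E; rewrite -[RHS]E /act.
  by apply: eq_bigr => e _; rewrite !mxE mulrC.
exists (fun e => \sum_(z <- Z) u z 0 e *: z) => c.
rewrite fP /act; under [RHS]eq_bigr do rewrite scaler_sumr.
rewrite exchange_big; apply: eq_bigr => z _ /=.
have /matrixP/(_ 0 c) := uP z; rewrite !mxE => ->; rewrite scaler_suml.
by apply: eq_bigr => e _; rewrite scalerA mulrC.
Qed.

(** By dimension shifting: each syzygy of [N] lowers the degree by one. *)
Lemma tor_vanishing (N : lmodType R) (P : resolution N) p :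
  (forall i, (p < i)%N -> forall x : P i, x = 0) ->
  forall j (w : 'I_(r j.+1) -> N), (p <= j)%N ->
    (forall c, act (d j) w c = 0) -> exists w', forall c, w c = act (d j.+1) w' c.
Proof.
move=> P0.
have syz : forall j i (w : 'I_(r j.+1) -> P i) (v : 'I_(r j) -> P i.+1),
    (p <= i + j)%N -> (forall c, act (d j) w c = res_diff P i (v c)) ->
    exists w' v', forall c, w c = act (d j.+1) w' c + res_diff P i (v' c).
  elim=> [|j IH] i w v pij wv.
    have [|w' w'P] := @projective_acyclic (P i) 0%N w (@res_proj _ _ P i).
      move=> c; have -> := wv c; have -> : v c = 0; last by rewrite linear0.
      by apply: P0; rewrite ltnS -[i]addn0.
    by exists w', (fun=> 0) => c; rewrite linear0 addr0.
  have /choice[u uP] c : exists u, res_diff P i.+1 u = act (d j) v c.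
    apply/res_exactS; rewrite act_linear.
    have -> : (fun e => res_diff P i (v e)) = act (d j.+1) w.
      by apply/funext => e; rewrite wv.
    by rewrite -actM matrix_resolution_dd // act0l.
  have [||w1 [v1 w1P]] := IH i.+1 v u; first by rewrite addSnnS.
    by move=> c; rewrite uP.
  have [|w' w'P] := @projective_acyclic (P i) j.+1 (fun e => w e - res_diff P i (w1 e)) (@res_proj _ _ P i).
    move=> c; rewrite actB wv -act_linear -linearB w1P addrC addKr.
    by apply/res_exactS; exists (v1 c).
  by exists w', w1 => c; rewrite -w'P subrK.
move=> j w pj w0.
have /choice[u uP] c := res_aug_surj P (w c).
have /choice[v vP] c : exists v, res_diff P 0 v = act (d j) u c.
  apply/res_exact0; rewrite act_linear -[RHS](w0 c).
  by congr (act _ _ c); apply/funext => e; rewrite uP.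
have [//||w' [v' w'P]] := @syz j 0%N u v; first by move=> c; rewrite vP.
exists (fun e => res_aug P (w' e)) => c.
rewrite -act_linear -uP w'P linearD.
by rewrite [X in _ + X](_ : _ = 0) ?addr0 //; apply/res_exact0; exists (v' c).
Qed.

End TorVanishing.

Lemma choice_dep (I : Type) (A : I -> Type) (P : forall i, A i -> Prop) :
  (forall i, exists z, P i z) -> exists f : forall i, A i, forall i, P i (f i).
Proof. by move=> exz; exists (fun i => sval (cid (exz i))) => i; exact: svalP. Qed.

Lemma family_with_value (A : nat -> Type) (P : forall j, A j -> Prop) n (a : A n) :
  (forall j, exists z, P j z) -> P n a -> exists f : forall j, A j, f n = a /\ forall j, P j (f j).
Proof.
move=> exz Pa; pose z j := sval (cid (exz j)).
pose f j := match pselect (n = j) with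
  | left e => eq_rect n A a j e
  | right _ => z j
  end.
exists f; split=> [|j]; rewrite /f; case: pselect => [e|ne] //.
- by rewrite (Prop_irrelevance e erefl).
- by case: j / e.
- exact: (svalP (cid (exz j))).
Qed.

Section Vanishing.
Variables (R : localRingType) (r : nat -> nat) (d : forall j, 'M[R]_(r j.+1, r j)).
Hypothesis resd : matrix_resolution d.
Local Notation k := (residue R).

(** Cycles of the total complex of [Y (x) Y], all total degrees taken together
    and up to signs. *)
Definition double_cycle (q : forall i j, 'M[R]_(r i, r j)) : Prop :=
  forall i j, (d i)^T *m q i.+1 j = q i j.+1 *m d j.

Lemma rows_cycle_trmx i j (X : 'M[R]_(r i.+1, r j)) : (d i)^T *m X = 0 -> rows_cycle d X^T.
Proof. by move=> X0; rewrite /= -[d i]trmxK -trmx_mul X0 trmx0. Qed.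

(** A cycle of [k (x) Y] is spread over the double complex, column by column.  With
    [double_cycle_trmx], which exchanges the two factors, this is the balance of
    [Tor (k, k)]. *)
Lemma double_cycle_lift (t : forall j, 'M[k]_(r 0, r j)) :
  (forall j, residue_cycle d (t j)) ->
  exists q, double_cycle q /\ forall j, residue_mx (q 0%N j) = t j.
Proof.
move=> ct; have /choice_dep[q0 q0P] j := residue_mx_lift (t j).
pose q := fix q i : forall j, 'M[R]_(r i, r j) := match i with
  | 0 => q0
  | i'.+1 => fun j => (lift_rows resd (q i' j.+1 *m d j)^T)^T
  end.
exists q; split=> // i j.
suff cyc : rows_cycle d (q i j.+1 *m d j)^T.
  by rewrite /= -trmx_mul lift_rowsP // trmxK.
elim: i j => [|i IH] j.
  rewrite /rows_cycle residue_mx_tr residue_mxM q0P.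
  by rewrite (ct j.+1) trmx0.
apply: rows_cycle_trmx; rewrite mulmxA.
have -> : (d i)^T *m q i.+1 j.+1 = q i j.+2 *m d j.+1.
  by rewrite /= -trmx_mul lift_rowsP // trmxK.
by rewrite -mulmxA matrix_resolution_dd // mulmx0.
Qed.

Lemma double_cycle_trmx q : double_cycle q -> double_cycle (fun i j => (q j i)^T).
Proof. by move=> qc i j; rewrite -trmx_mul -qc trmx_mul trmxK. Qed.

(** Being a boundary propagates from the edge of the double complex to every place
    of it, so that the class at any place depends only on the class at the edge. *)
Lemma double_cycle_boundary e : double_cycle e ->
  (forall j, exists h, residue_mx (e 0%N j) = h *m residue_mx (d j)) ->
  forall i j, exists g1 g2, e i j = g1 *m d j + (d i)^T *m g2.
Proof.
move=> ec e0.
have /choice_dep[h hP] j := e0 j.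
have /choice_dep[g0 g0P] j := residue_mx_lift (h j).
pose g := fix g i : forall j, 'M[R]_(r i, r j) := match i with
  | 0 => fun j => match j with 0 => 0 | j'.+1 => g0 j' end
  | i'.+1 => fun j => (lift_rows resd (e i' j - g i' j.+1 *m d j)^T)^T
  end.
suff gP i j : e i j = g i j.+1 *m d j + (d i)^T *m g i.+1 j.
  by move=> i j; exists (g i j.+1), (g i.+1 j).
suff cyc : rows_cycle d (e i j - g i j.+1 *m d j)^T.
  by rewrite [g i.+1 j]/= -trmx_mul lift_rowsP // trmxK addrC subrK.
elim: i j => [|i IH] j.
  rewrite /rows_cycle residue_mx_tr residue_mxB residue_mxM.
  by rewrite hP g0P subrr trmx0.
apply: rows_cycle_trmx; rewrite mulmxBr ec mulmxA.
have -> : (d i)^T *m g i.+1 j.+1 = e i j.+1 - g i j.+2 *m d j.+1.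
  by rewrite [g i.+1 _]/= -trmx_mul lift_rowsP // trmxK.
by rewrite mulmxBl -[g i _ *m _ *m _]mulmxA matrix_resolution_dd // mulmx0 subr0 subrr.
Qed.

Variable Th : forall j, 'M[R]_(r j.+2, r j).
Hypotheses (ThP : degree_shift d Th) (Thonto : onto_homology d Th).

Lemma onto_homology_rows m j (z : 'M[k]_(m, r j)) : residue_cycle d z ->
  exists w h, residue_cycle d (w : 'M_(m, r j.+2)) /\
    w *m residue_mx (Th j) - z = h *m residue_mx (d j).
Proof.
move=> cz; have cr i : residue_cycle d (row i z).
  by case: j z cz => [|j] z //= cz; rewrite -row_mul cz row0.
have /choice[w wP] i := Thonto (cr i).
have /choice[h hP] i := wP i.
exists (\matrix_i w i), (\matrix_i h i); split.
  by apply/row_matrixP => i; rewrite row_mul rowK row0; case: (hP i).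
apply/row_matrixP => i; rewrite linearB /= !row_mul !rowK.
by case: (hP i).
Qed.

Definition residue_coboundary n : ('I_(r n) -> k) -> Prop :=
  match n with
  | 0 => fun b => forall e, b e = 0
  | n'.+1 => fun b => exists h, forall e, b e = act (d n')^T h e
  end.

(** [Ext^n (k, k)] is dual to [Tor_n (k, k)]. *)
Lemma residue_coboundaryP n (b : 'I_(r n) -> k) :
  (forall X : 'cV_(r n), residue_cycle d X^T -> (\row_e b e) *m X = 0) ->
  residue_coboundary b.
Proof.
case: n b => [|n] b orth.
  move=> e; have := orth (delta_mx e 0) I.
  by rewrite -colE => /matrixP/(_ 0 0); rewrite !mxE.
have : (\row_e b e <= (residue_mx (d n))^T)%MS.
  rewrite submxE; apply/eqP/matrixP => i c; rewrite ord1.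
  have -> (A : 'M[k]_(1, r n.+1)) : A 0 c = col c A 0 0 by rewrite mxE.
  rewrite colE -mulmxA -colE orth ?mxE //=; apply: trmx_inj.
  by rewrite trmx_mul trmxK trmx0 colE mulmxA mulmx_coker mul0mx.
move=> /submxP[h hE]; exists (fun c => h 0 c) => e.
move/matrixP: hE => /(_ 0 e); rewrite mxE => ->.
by rewrite mxE; apply: eq_bigr => c _; rewrite !mxE mulrC.
Qed.

(** The pairing of a class [alpha] in [Ext^n (k, N)] with [Tor (k, k)] has values in
    [Tor (k, N)], which is zero in high degrees.  Lifting classes along the
    surjection induced by [Th], which acts on the other factor, brings this down
    to degree 0. *)
Section Pairing.
Variables (N : lmodType R) (P : resolution N) (p : nat).
Hypothesis P0 : forall i, (p < i)%N -> forall x : P i, x = 0.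
Variables (n : nat) (alpha : 'I_(r n) -> N) (phi : {linear N -> k}).
Hypothesis alphaC : forall c, act (d n)^T alpha c = 0.

Lemma pairing_boundary q j : double_cycle q ->
  exists h : 'rV[k]_(r j.+1),
    \row_c phi (act (q n j) alpha c) = h *m residue_mx (d j).
Proof.
move=> qc.
have high q' i : double_cycle q' -> (p <= i)%N -> exists h : 'rV[k]_(r i.+2),
    \row_c phi (act (q' n i.+1) alpha c) = h *m residue_mx (d i.+1).
  move=> q'c pi; have [|w' w'P] := tor_vanishing resd P0 pi (w := act (q' n i.+1) alpha).
    move=> c; rewrite -actM -q'c actM.
    have -> : act (d n)^T alpha = fun=> 0 by apply/funext => e; rewrite alphaC.
    by rewrite act0.
  exists (\row_e phi (w' e)); rewrite -act_residue.
  by apply/matrixP => a c; rewrite !mxE w'P act_linear.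
have down q' i : double_cycle q' ->
    (forall q'', double_cycle q'' -> exists h : 'rV[k]_(r i.+3),
       \row_c phi (act (q'' n i.+2) alpha c) = h *m residue_mx (d i.+2)) ->
    exists h : 'rV[k]_(r i.+1),
      \row_c phi (act (q' n i) alpha c) = h *m residue_mx (d i).
  move=> q'c up.
  have ct l : residue_cycle d (residue_mx (q' 0%N l)).
    case: l => [|l] //=; rewrite -residue_mxM -q'c residue_mxM.
    by rewrite residue_mx_tr residue_mx_d0 // trmx0 mul0mx.
  have /choice_dep[w wP] l := onto_homology_rows (ct l).
  have /choice_dep[h hP] l := wP l.
  pose t l : 'M[k]_(r 0, r l) := match l with l'.+2 => w l' | _ => 0 end.
  have [|q'' [q''c q''t]] := @double_cycle_lift t.
    case=> [|[|l]] //=; first by rewrite mul0mx.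
    by case: (hP l).
  pose e a b := q'' a b.+2 *m Th b - q' a b.
  have ec : double_cycle e.
    move=> a b; rewrite /e mulmxBr mulmxBl q'c mulmxA q''c; congr (_ - _).
    by rewrite -!mulmxA ThP.
  have [l|g1 [g2 eE]] := double_cycle_boundary ec _ n i.
    by exists (h l); rewrite residue_mxB residue_mxM q''t; case: (hP l).
  have [u uP] := up q'' q''c.
  exists (u *m residue_mx (Th i.+1) - (\row_c phi (act g1 alpha c))).
  have -> : q' n i = q'' n i.+2 *m Th i - g1 *m d i - (d n)^T *m g2.
    by rewrite -addrA -opprD -eE /e subKr.
  rewrite mulmxBl -[_ *m _ *m residue_mx (d i)]mulmxA -residue_mxM -ThP residue_mxM mulmxA.
  rewrite -uP -!act_residue.
  have z c : phi (act g2 (act (d n)^T alpha) c) = 0.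
    have -> : act (d n)^T alpha = fun=> 0 by apply/funext => b; rewrite alphaC.
    by rewrite act0 linear0.
  apply/matrixP => a c; rewrite !mxE !actBl !linearB /= !actM z subr0.
  by rewrite !act_linear.
have [K jK] : exists K, (p < j + K.*2)%N by exists p.+1; rewrite -addnn addnCA leq_addr.
elim: K j q qc jK => [|K IH] j q qc jK.
  by case: j jK => // j jK; apply: high => //; rewrite -ltnS -[j.+1]addn0.
apply: down => // q'' q''c; apply: IH => //.
by move: jK; rewrite doubleS !addnS !addSn.
Qed.

Lemma ext_map_zero : (0 < r 0)%N ->
  residue_coboundary (fun e => phi (alpha e)).
Proof.
move=> r0; pose beta : 'rV[k]_(r n) := \row_e phi (alpha e).
pose i0 := Ordinal r0.
have orth (X : 'cV[k]_(r n)) : residue_cycle d X^T -> beta *m X = 0.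
  move=> cX; pose X0 : 'M[k]_(r n, r 0) := X *m delta_mx 0 i0.
  have cX0 : residue_cycle d X0^T.
    rewrite trmx_mul; case: (n) (X^T) cX => //= n' Y cY.
    by rewrite -mulmxA cY mulmx0.
  have [||t [tn ct]] := @family_with_value (fun j => 'M[k]_(r 0, r j))
    (fun j z => residue_cycle d z) n X0^T.
  - by move=> j; exists 0; case: j => //= j; rewrite mul0mx.
  - exact: cX0.
  have [q [qc qt]] := double_cycle_lift ct.
  have [h hP] := pairing_boundary 0 (double_cycle_trmx qc).
  have : beta *m X0 = 0.
    rewrite -[X0]trmxK -tn -qt -residue_mx_tr /beta -act_residue.
    rewrite residue_mx_d0 // mulmx0 in hP; rewrite -[RHS]hP.
    by apply/matrixP => a c; rewrite !mxE act_linear.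
  rewrite mulmxA => /matrixP bX; apply/matrixP => a b; rewrite !ord1.
  have := bX 0 i0; rewrite [in RHS]mxE mxE big_ord_recl big_ord0 addr0.
  by rewrite [delta_mx _ _ _ _]mxE !eqxx mulr1 => ->; rewrite mxE.
exact: residue_coboundaryP.
Qed.

End Pairing.
End Vanishing.
Local Open Scope card_scope.

(** * Bases of vector spaces over the residue field *)

Section Freeg.
Variables (R : nzRingType).

Lemma fgliftU1 (V : lmodType R) (S : choiceType) (g : S -> V) i : fglift g << i >> = g i.
Proof. by rewrite liftU scale1r. Qed.

Lemma freeg_linear_ext (V : lmodType R) (S : choiceType)
    (f g : {linear {freeg S / R} -> V}) :
  (forall i, f << i >> = g << i >>) -> forall x, f x = g x.
Proof.
move=> fg x; rewrite -[x]freeg_sumE !linear_sum; apply: eq_bigr => i _.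
have -> : << coeff i x *g i >> = coeff i x *: << i >> :> {freeg S / R}.
  by apply/eqP/freeg_eqP => y; rewrite coeffZ !coeffU mul1r.
by rewrite !linearZ /= fg.
Qed.

Lemma fglift_comp (V W : lmodType R) (S : choiceType) (g : S -> V)
    (f : {linear V -> W}) x : f (fglift g x) = fglift (fun i => f (g i)) x.
Proof.
apply: (freeg_linear_ext (f := f \o fglift g) (g := fglift (fun i => f (g i)))) => i /=.
by rewrite !fgliftU1.
Qed.

Lemma coeffU1 (S : choiceType) (i j : S) : coeff i (<< j >> : {freeg S / R}) = (j == i)%:R.
Proof. by rewrite coeffU mul1r. Qed.

End Freeg.

Section RelativeBasis.
Variable R : localRingType.
Local Notation m := (maxideal R).

(** [c] induces a basis over the residue field of the subquotient [Z / B] of [C].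
    Families are used instead of sets so that indices can be sums and products. *)
Definition relative_basis (C : lmodType R) (Z B : C -> Prop) (I : choiceType)
    (c : I -> C) : Prop :=
  [/\ forall i, Z (c i),
      forall x : {freeg I / R}, B (fglift c x) -> forall i, coeff i x \in m &
      forall z, Z z -> exists x : {freeg I / R}, B (z - fglift c x)].

Definition basis_family (E : lmodType R) (I : choiceType) (e : I -> E) : Prop :=
  relative_basis (fun=> True) (fun x => x = 0) e.

Lemma coeff_fglift_maxideal (S T : choiceType) (F : S -> {freeg T / R}) y t :
  (forall i, coeff i y \in m) -> coeff t (fglift F y) \in m.
Proof.
move=> ym; rewrite -[y in fglift F y]freeg_sumE linear_sum raddf_sum /=.
by apply: rpred_sum => i _; rewrite liftU coeffZ mulrC idealMr.
Qed.

Lemma freeg_preimage (S T : choiceType) (g : S -> T) (x : {freeg T / R}) :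
  (forall t, t \in dom x -> exists i, g i = t) ->
  exists y, x = fglift (fun i => << g i >> : {freeg T / R}) y.
Proof.
move=> xg; rewrite -[x]freeg_sumE big_seq.
elim/big_ind: _ => [|_ _ [y1 ->] [y2 ->]|t /xg[i <-]].
- by exists 0; rewrite linear0.
- by exists (y1 + y2); rewrite linearD.
exists (<< coeff (g i) x *g i >>); rewrite liftU.
by apply/eqP/freeg_eqP => t'; rewrite coeffZ !coeffU mul1r.
Qed.

Section Exchange.
Variables (E : lmodType R) (kE : killed E).
Implicit Types S : choiceType.

Definition free_on (S : choiceType) (h : S -> E) (A : S -> Prop) : Prop :=
  forall x : {freeg S / R}, (forall i, i \in dom x -> A i) -> fglift h x = 0 ->
  forall i, coeff i x \in m.

Definition spanned_on (S : choiceType) (h : S -> E) (A : S -> Prop) (v : E) : Prop :=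
  exists x : {freeg S / R}, (forall i, i \in dom x -> A i) /\ v = fglift h x.

Lemma spanned_lin S (h : S -> E) A a u v :
  spanned_on h A u -> spanned_on h A v -> spanned_on h A (a *: u + v).
Proof.
move=> [x [xA ->]] [y [yA ->]]; exists (a *: x + y); split; last by rewrite linearP.
move=> i /domD_subset; rewrite mem_cat => /orP[/domZ_subset/xA//|/yA//].
Qed.

Lemma spanned0 S (h : S -> E) A : spanned_on h A 0.
Proof. by exists 0; rewrite linear0; split=> // i; rewrite dom0. Qed.

Lemma spanned_self S (h : S -> E) (A : S -> Prop) i : A i -> spanned_on h A (h i).
Proof. by move=> Ai; exists << i >>; rewrite fgliftU1; split=> // j; rewrite domU1 inE => /eqP ->. Qed.

Lemma spanned_fglift S (h : S -> E) A (T : choiceType) (g : T -> E) x :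
  (forall t, spanned_on h A (g t)) -> spanned_on h A (fglift g x).
Proof.
move=> gA; rewrite -[x]freeg_sumE linear_sum; elim/big_ind: _ => [|u v Au Av|t _].
- exact: spanned0.
- by rewrite -[u]scale1r; exact: spanned_lin.
- by rewrite /= liftU -[_ *: _]addr0; apply: spanned_lin => //; exact: spanned0.
Qed.

Lemma free_adjoin (S : choiceType) (h : S -> E) (A : S -> Prop) i :
  free_on h A -> ~ spanned_on h A (h i) -> free_on h (fun j => A j \/ j = i).
Proof.
move=> fA nsp x xA x0.
have [im|im] := boolP (coeff i x \in m); last first.
  have [b bE] := local_inverse im; case: nsp.
  have -> : h i = - b *: fglift h (x - coeff i x *: << i >>) + 0.
    rewrite linearB linearZ /= x0 fgliftU1 sub0r scaleNr scalerN opprK addr0.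
    by rewrite scalerA bE scale1r.
  apply: spanned_lin; last exact: spanned0.
  exists (x - coeff i x *: << i >>); split=> // j.
  rewrite mem_dom coeffB coeffZ coeffU1; have [<-|ij] := eqVneq i j.
    by rewrite mulr1 subrr eqxx.
  rewrite mulr0 subr0 -mem_dom => /xA[//|ji].
  by rewrite ji eqxx in ij.
have y0 : fglift h (x - coeff i x *: << i >>) = 0.
  by rewrite linearB linearZ /= x0 fgliftU1 kE // subr0.
have := fA _ _ y0.
move=> H j; have [<-//|ij] := eqVneq i j.
have /(_ j) : forall j, coeff j (x - coeff i x *: << i >>) \in m.
  apply: H => l; rewrite mem_dom coeffB coeffZ coeffU1.
  have [<-|il] := eqVneq i l; first by rewrite mulr1 subrr eqxx.
  rewrite mulr0 subr0 -mem_dom => /xA[//|li].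
  by rewrite li eqxx in il.
by rewrite coeffB coeffZ coeffU1 (negbTE ij) mulr0 subr0.
Qed.

(** Steinitz exchange for families of any cardinality.  Zorn's lemma is applied to
    the partial injections [G] from [I] to [J] such that [e], with its members
    replaced along [G] by members of [f], is still free. *)
Lemma exchange (I J : choiceType) (e : I -> E) (f : J -> E) :
  free_on e (fun=> True) -> (forall v, spanned_on f (fun=> True) v) ->
  [set: I] #<= [set: J].
Proof.
move=> fe sf.
pose h (s : I + J) := match s with inl i => e i | inr j => f j end.
pose S (G : set (I * J)) (s : I + J) := match s with
  | inl i => ~ exists j, G (i, j) | inr j => exists i, G (i, j) end.
pose good (G : set (I * J)) := [/\ forall i j j', G (i, j) -> G (i, j') -> j = j',
  forall i i' j, G (i, j) -> G (i', j) -> i = i' & free_on h (S G)].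
have good0 : good set0.
  split=> // x xS x0 s.
  have [|y xE] := @freeg_preimage _ _ (@inl I J) x.
    by move=> [i|j] /xS; [exists i|case].
  rewrite xE; apply: coeff_fglift_maxideal; apply: fe => //.
  rewrite -[RHS]x0 xE fglift_comp; congr (fglift _ y); apply/funext => i.
  by rewrite /= fgliftU1.
have [F Fgood Ftot|G [[Gfun Ginj Gfree] Gmax]] := @Zorn_bigcup _ good.
  have two G1 G2 : F G1 -> F G2 -> exists2 G, F G & (G1 `<=` G)%classic /\ (G2 `<=` G)%classic.
    by move=> F1 F2; have [G12|G21] := Ftot _ _ F1 F2; [exists G2 => //; split=> // x|exists G1 => //; split=> // x].
  split.
  - move=> i j j' [G1 F1 G1ij] [G2 F2 G2ij]; have [G FG [H1 H2]] := two _ _ F1 F2.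
    by have [Gfun _ _] := Fgood G FG; apply: (Gfun i); [exact: H1|exact: H2].
  - move=> i i' j [G1 F1 G1ij] [G2 F2 G2ij]; have [G FG [H1 H2]] := two _ _ F1 F2.
    by have [_ Ginj _] := Fgood G FG; apply: (Ginj i i' j); [exact: H1|exact: H2].
  - move=> x xS; suff [G [gG sG]] : exists G, good G /\ forall s, s \in dom x -> S G s.
      by case: gG => _ _; apply.
    have : forall s, s \in dom x -> S (\bigcup_(X in F) X)%classic s by [].
    have [[G0 FG0]|noF] := pselect (exists G, F G); last first.
      move=> xS'; exists set0; split=> // -[i|j] /xS' //=; first by move=> _ [j].
      by move=> [i [G FG]]; case: noF; exists G.
    move=> {}xS; suff [G FG GS] : exists2 G, F G & forall s, s \in dom x -> S G s.
      by exists G; split=> //; exact: Fgood.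
    elim: (dom x) xS => [|s l IH] lS; first by exists G0.
    have {IH} [|G1 FG1 G1l] := IH; first by move=> t tl; apply: lS; rewrite inE tl orbT.
    have [G [FG G1G Gs]] : exists G, [/\ F G, (G1 `<=` G)%classic & S G s].
      case: s lS => [i|j] lS.
        exists G1; split=> // -[j Gij]; apply: (lS (inl i) (mem_head _ _)).
        by exists j; exists G1.
      have [i [G2 FG2 G2ij]] := lS (inr j) (mem_head _ _).
      by have [G FG [G1G G2G]] := two _ _ FG1 FG2; exists G; split=> //; exists i; exact: G2G.
    exists G => // t; rewrite inE => /orP[/eqP -> //|tl].
    have := lS t; rewrite inE tl orbT => /(_ isT); have := G1l t tl.
    case: t {tl} => [i|j] /= G1t Ut; last by have [i /G1G] := G1t; exists i.
    by move=> [j Gij]; apply: Ut; exists j; exists G.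
have total i : exists j, G (i, j).
  apply: contrapT => noj.
  pose A s := S G s /\ s <> inl i.
  have Sinl : S G (inl i) by [].
  have [j nsp] : exists j, ~ spanned_on h A (f j).
    apply: contrapT => allsp; have [x [_ eE]] := sf (e i).
    have [|y [yA yE]] := @spanned_fglift _ h A _ f x.
      by move=> j; apply: contrapT => nsp; apply: allsp; exists j.
    have : coeff (inl i) (y - << inl i >>) \in m.
      apply: (Gfree (y - << inl i >>)) => [s|].
        by move=> /domB; rewrite mem_cat domU1 inE => /orP[/yA[]|/eqP ->].
      by rewrite linearB /= fgliftU1 -yE -eE subrr.
    rewrite coeffB coeffU1 eqxx coeff_outdom; last by apply/negP => /yA[].
    by rewrite sub0r rpredN maxideal1.
  have nGj i' : ~ G (i', j).
    move=> Gi'j; apply: nsp; apply: (@spanned_self _ h A (inr j)).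
    by split=> //; exists i'.
  pose G' := [set p | G p \/ p = (i, j)]%classic.
  apply: (Gmax G'); first split; [by move=> p Gp; left| |].
    by move/(_ (i, j) (or_intror erefl)) => Gij; apply: noj; exists j.
  split.
  - move=> a b b' [Gab|/pair_equal_spec[ai bj]] [Gab'|/pair_equal_spec[ai' bj']].
    + exact: Gfun Gab Gab'.
    + by case: noj; exists b; rewrite -ai'.
    + by case: noj; exists b'; rewrite -ai.
    + by rewrite bj bj'.
  - move=> a a' b [Gab|/pair_equal_spec[ai bj]] [Ga'b|/pair_equal_spec[ai' bj']].
    + exact: Ginj Gab Ga'b.
    + by case: (nGj a); rewrite -bj'.
    + by case: (nGj a'); rewrite -bj.
    + by rewrite ai ai'.
  have fA : free_on h A by move=> x xA; apply: Gfree => s /xA[].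
  move=> x xS; apply: (free_adjoin fA (i := inr j) nsp) => -[i'|j'] /xS /= H.
    left; split=> [[j' Gij']|[ii']]; first by apply: H; exists j'; left.
    by apply: H; exists j; right; rewrite ii'.
  have [i' [Gij'|[_ ->]]] := H; last by right.
  by left; split=> //; exists i'.
have /choice[g gP] := total.
have [k] : $|{injfun [set: I]%classic >-> [set: J]%classic}|.
  apply/injfunPex; exists g => // i i' _ _ gii'.
  by apply: (Ginj i i' (g i)) => //; rewrite gii'.
exact: (inj_card_le k).
Qed.

Lemma basis_family_card (I J : choiceType) (e : I -> E) (f : J -> E) :
  basis_family e -> basis_family f -> [set: I] #= [set: J].
Proof.
move=> [_ fe se] [_ ff sf]; rewrite card_eq_le; apply/andP; split.
  apply: (exchange (e := e) (f := f)) => [x _ x0|v]; first exact: fe x x0.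
  by have [x /eqP] := sf v Logic.I; rewrite subr_eq0 => /eqP ->; exists x.
apply: (exchange (e := f) (f := e)) => [x _ x0|v]; first exact: ff x x0.
by have [x /eqP] := se v Logic.I; rewrite subr_eq0 => /eqP ->; exists x.
Qed.

Lemma rank_basis : exists e : {classic rank kE} -> E, basis_family e.
Proof.
pose B : set (kspace kE) := sval (cid (basis_exists (kspace kE))).
have [freeB spanB] : is_basis B := svalP (cid (basis_exists (kspace kE))).
pose I : choiceType := {classic rank kE}.
pose e (i : I) : E := sval i.
have eI i : B (e i) := svalP i.
have mkI v : B v -> exists i : I, e i = v by move=> Bv; exists (exist _ v Bv).
have injE : injective e.
  by move=> [v Bv] [w Bw]; rewrite /e /= => vw; case: w / vw Bw => Bw; congr exist; exact: Prop_irrelevance.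
exists e; split=> // [x x0 i|v _].
  have [ix|ix] := boolP (i \in dom x); last by rewrite coeff_outdom // rpred0.
  pose a (v : kspace kE) : residue R :=
    if pselect (exists i, e i = v) is left p then \pi_(residue R) (coeff (sval (cid p)) x) else 0.
  have aE j : a (e j) = \pi_(residue R) (coeff j x).
    rewrite /a; case: pselect => [p|[]]; last by exists j.
    by case: cid => j' /= /injE ->.
  have := freeB [seq e j | j <- dom x] a; rewrite map_inj_uniq // uniq_dom.
  have ae0 : \sum_(y <- [seq e j | j <- dom x]) a y *: (y : kspace kE) = 0.
    rewrite big_map; have : fglift e x = \sum_(j <- dom x) coeff j x *: e j.
      by rewrite -[x in LHS]freeg_sumE linear_sum; apply: eq_bigr => j _; rewrite /= liftU.
    rewrite x0 => E0; rewrite [RHS]E0; apply: eq_bigr => j _.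
    by rewrite aE; exact: kspace_pi.
  move=> /(_ isT _ ae0 (e i)); rewrite map_f // => a0.
  rewrite -residue_eq0 -aE a0 //.
  by move=> y /mapP[j _ ->]; exact: eI.
have [s [a [sB ->]]] := spanB v; rewrite big_seq.
suff [x ->] : exists x, \sum_(i <- s | i \in s) a i *: i = fglift e x by exists x; rewrite subrr.
elim/big_ind: _ => [|_ _ [y1 ->] [y2 ->]|w /sB/mkI[i <-]].
- by exists 0; rewrite linear0.
- by exists (y1 + y2); rewrite linearD.
- by exists (<< repr (a (e i)) *g i >>); rewrite liftU.
Qed.

End Exchange.
Lemma coeff_linear (S : choiceType) (i : S) :
  linear (fun x : {freeg S / R} => coeff i x : R^o).
Proof. by move=> a x y; rewrite coeffD coeffZ. Qed.

Definition coeff_map (S : choiceType) (i : S) : {linear {freeg S / R} -> R^o} :=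
  HB.pack (fun x : {freeg S / R} => coeff i x : R^o)
    (GRing.isLinear.Build _ _ _ _ _ (coeff_linear i)).

Lemma submodule_fglift (C : lmodType R) (Z : C -> Prop) (I : choiceType) (c : I -> C) x :
  submodule_pred Z -> (forall i, Z (c i)) -> Z (fglift c x).
Proof.
move=> subZ Zc; rewrite -[x]freeg_sumE linear_sum; apply: (submod_sum subZ) => i _.
by rewrite /= liftU; exact: (submodZ subZ).
Qed.

(** Bases are carried over by a linear relation between two subquotients, as long
    as it induces an isomorphism. *)
Lemma relative_basis_transport (C1 C2 : lmodType R) (Z1 B1 : C1 -> Prop)
    (Z2 B2 : C2 -> Prop) (T : C1 -> C2 -> Prop) (I : choiceType) (c1 : I -> C1) :
  submodule_pred Z1 -> submodule_pred Z2 ->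
  T 0 0 -> (forall a u v u' v', T u u' -> T v v' -> T (a *: u + v) (a *: u' + v')) ->
  (forall z1, Z1 z1 -> exists z2, Z2 z2 /\ T z1 z2) ->
  (forall z2, Z2 z2 -> exists z1, Z1 z1 /\ T z1 z2) ->
  (forall z1 z2, Z1 z1 -> Z2 z2 -> T z1 z2 -> (B1 z1 <-> B2 z2)) ->
  relative_basis Z1 B1 c1 -> exists c2 : I -> C2, relative_basis Z2 B2 c2.
Proof.
move=> subZ1 subZ2 T0 TL T12 T21 TB [Zc1 free1 span1].
have /choice[c2 c2P] i := T12 _ (Zc1 i).
have Zc2 i : Z2 (c2 i) by case: (c2P i).
have Tlift x : T (fglift c1 x) (fglift c2 x).
  rewrite -[x]freeg_sumE !linear_sum; elim/big_ind2: _ => // [u u' v v' Tu Tv|i _].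
    by rewrite -[u]scale1r -[u']scale1r; exact: TL.
  rewrite /= !liftU -[X in T X]addr0 -[X in T _ X]addr0; apply: TL => //.
  by case: (c2P i).
exists c2; split=> // [x Bx|z2 Zz2].
  apply: free1; apply/TB; last exact: Bx; last exact: Tlift.
    exact: submodule_fglift.
  exact: submodule_fglift.
have [z1 [Zz1 Tz]] := T21 _ Zz2; have [x Bx] := span1 _ Zz1.
exists x; apply/(TB (z1 - fglift c1 x)) => //.
- by apply: (submodB subZ1) => //; exact: submodule_fglift.
- by apply: (submodB subZ2) => //; exact: submodule_fglift.
- have := TL (-1) _ _ _ _ (Tlift x) Tz.
  by rewrite !scaleN1r ![- _ + _]addrC.
Qed.

Lemma relative_basis_sum (C : lmodType R) (Z Z' B : C -> Prop) (I J : choiceType)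
    (c : I -> C) (c' : J -> C) :
  submodule_pred Z -> submodule_pred Z' -> submodule_pred B ->
  (forall z, Z' z -> Z z) -> (forall z, B z -> Z' z) ->
  (forall a z, a \in m -> Z z -> B (a *: z)) ->
  relative_basis Z Z' c -> relative_basis Z' B c' ->
  relative_basis Z B (fun s : I + J => match s with inl i => c i | inr j => c' j end).
Proof.
move=> subZ subZ' subB Z'Z BZ' mZB [Zc freec spanc] [Zc' freec' spanc'].
set h := fun s : I + J => _.
pose pl : {linear {freeg (I + J) / R} -> {freeg I / R}} :=
  fglift (fun s => if s is inl i then << i >> else 0).
pose pr : {linear {freeg (I + J) / R} -> {freeg J / R}} :=
  fglift (fun s => if s is inr j then << j >> else 0).
have hE x : fglift h x = fglift c (pl x) + fglift c' (pr x).
  rewrite !fglift_comp.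
  apply: (freeg_linear_ext (f := fglift h)
    (g := fglift (fun s => fglift c _) \+ fglift (fun s => fglift c' _))) => s.
  rewrite /= !fgliftU1; case: s => [i|j]; rewrite ?fgliftU1 linear0 ?addr0 ?add0r //.
have plE x i : coeff (inl i) x = coeff i (pl x).
  apply: (freeg_linear_ext (f := coeff_map (inl i)) (g := coeff_map i \o pl)) => s.
  by rewrite /= fgliftU1 coeffU1; case: s => [i'|j]; rewrite ?coeffU1 ?coeff0.
have prE x j : coeff (inr j) x = coeff j (pr x).
  apply: (freeg_linear_ext (f := coeff_map (inr j)) (g := coeff_map j \o pr)) => s.
  by rewrite /= fgliftU1 coeffU1; case: s => [i|j']; rewrite ?coeffU1 ?coeff0.
split.
- by case=> [i|j] /=; [exact: Zc|apply: Z'Z; exact: Zc'].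
- move=> x; rewrite hE => Bx.
  have plm : forall i, coeff i (pl x) \in m.
    apply: freec; rewrite -[X in Z' X](addrK (fglift c' (pr x))).
    apply: (submodB subZ'); first exact: BZ'.
    exact: submodule_fglift.
  have Bl : B (fglift c (pl x)).
    rewrite -[pl x]freeg_sumE linear_sum; apply: (submod_sum subB) => i _.
    by rewrite /= liftU; apply: mZB.
  have prm : forall j, coeff j (pr x) \in m.
    apply: freec'; rewrite -[X in B X](addKr (fglift c (pl x))) addrC.
    exact: (submodB subB).
  by case=> [i|j]; rewrite ?plE ?prE.
- move=> z Zz; have [y Z'y] := spanc z Zz; have [y' By'] := spanc' _ Z'y.
  exists (fglift (fun i => << inl i >> : {freeg (I + J) / R}) y
    + fglift (fun j => << inr j >> : {freeg (I + J) / R}) y').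
  have -> : fglift h (fglift (fun i => << inl i >> : {freeg (I + J) / R}) y
    + fglift (fun j => << inr j >> : {freeg (I + J) / R}) y') = fglift c y + fglift c' y'.
    rewrite linearD /= !fglift_comp /=; congr (fglift _ y + fglift _ y');
      by apply/funext => s; rewrite fgliftU1.
  by rewrite opprD addrA.
Qed.

Section Coordinates.
Variables (C : lmodType R) (B : C -> Prop) (I : choiceType) (c : I -> C).
Hypotheses (subB : submodule_pred B) (mB : forall a z, a \in m -> B (a *: z)).
Hypothesis basisc : relative_basis (fun=> True) B c.

Lemma dual_basis_exists : exists f : I -> {linear C -> residue R},
  (forall i j, f i (c j) = (j == i)%:R) /\ (forall i v, B v -> f i v = 0).
Proof.
have [_ freec spanc] := basisc.
have /choice[x xP] v : exists x : {freeg I / R}, B (v - fglift c x) by exact: spanc.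
have xE v y i : B (v - fglift c y) ->
    \pi_(residue R) (coeff i (x v)) = \pi_(residue R) (coeff i y).
  move=> By; apply/eqP; rewrite -subr_eq0 -rmorphB residue_eq0 -coeffB.
  apply: freec; rewrite linearB /=.
  have -> : fglift c (x v) - fglift c y = (v - fglift c y) - (v - fglift c (x v)).
    by rewrite opprB [RHS]addrC addrA subrK.
  exact: (submodB subB).
have lin i : linear (fun v => \pi_(residue R) (coeff i (x v))).
  move=> a u v; rewrite (@xE _ (a *: x u + x v)).
    by rewrite coeffD coeffZ rmorphD rmorphM.
  rewrite linearP opprD addrACA -scalerBr; exact: (subB.2).
pose f i : {linear C -> residue R} := HB.pack (fun v => \pi_(residue R) (coeff i (x v)))
  (GRing.isLinear.Build _ _ _ _ _ (lin i)).
exists f; split=> [i j|i v Bv] /=.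
  rewrite (@xE _ << j >>) ?coeffU1 ?rmorph_nat //.
  by rewrite fgliftU1 subrr; exact: subB.1.
by rewrite (@xE _ 0) ?coeff0 ?rmorph0 // linear0 subr0.
Qed.

Lemma dual_basis_expansion (f : I -> {linear C -> residue R}) :
  (forall i j, f i (c j) = (j == i)%:R) -> (forall i v, B v -> f i v = 0) ->
  forall v, exists s : seq I, forall S, uniq S -> {subset s <= S} ->
    B (v - \sum_(i <- S) repr (f i v) *: c i).
Proof.
move=> fc fB v; have [_ _ /(_ v Logic.I)[x Bx]] := basisc.
have fE i : f i v = \pi_(residue R) (coeff i x).
  rewrite -(subrK (fglift c x) v) linearD /= fB // add0r fglift_comp.
  rewrite (_ : coeff i x = fglift (fun j => (j == i)%:R : R^o) x) //.
  rewrite -[in LHS](freeg_sumE x) -[in RHS](freeg_sumE x) !linear_sum /= rmorph_sum.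
  by apply: eq_bigr => j _; rewrite !liftU fc rmorphM /= rmorph_nat.
exists (dom x) => S uS xS; rewrite -(subrK (fglift c x) v) -addrA.
rewrite subrK; apply: (submodD subB) => //; rewrite (freeg_sum_dom c uS xS) -sumrB.
apply: (submod_sum subB) => i _; rewrite -scalerBl; apply: mB.
by rewrite Quotient.idealrBE reprK fE.
Qed.

End Coordinates.

Lemma quotmod_proj_linear (M : lmodType R) (U : submodule M) :
  linear (\pi_(quotmod U) : M -> quotmod U).
Proof. by move=> a x y; rewrite raddfD /= -quotmodZ. Qed.

Definition quotmod_proj (M : lmodType R) (U : submodule M) : {linear M -> quotmod U} :=
  HB.pack (\pi_(quotmod U) : M -> quotmod U)
    (GRing.isLinear.Build _ _ _ _ _ (@quotmod_proj_linear M U)).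

Lemma quotmod_basis (M : lmodType R) (U : submodule M) (kQ : killed (quotmod U)) :
  exists c : {classic rank kQ} -> M, relative_basis (fun=> True) (fun x => x \in smem U) c.
Proof.
have [e [_ freee spane]] := rank_basis kQ.
have lift x : fglift e x = quotmod_proj U (fglift (fun i => repr (e i)) x).
  by rewrite fglift_comp; congr (fglift _ x); apply/funext => i /=; rewrite reprK.
exists (fun i => repr (e i)); split=> // [x /quotmod_eq0 Ux|z _].
  by apply: freee; rewrite lift.
have [x xE] := spane (\pi_(quotmod U) z) Logic.I; exists x.
by apply/quotmod_eq0; rewrite -[LHS]/(quotmod_proj U _) linearB -lift.
Qed.

Section Subquotient.
Variables (C : lmodType R) (Z : submodule C) (U : submodule (submod Z)) (B : C -> Prop).
Hypothesis UB : forall z : submod Z, z \in smem U <-> B (val z).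
Hypothesis kQ : killed (quotmod U).

Lemma subquotient_basis :
  exists c : {classic rank kQ} -> C, relative_basis (fun x => x \in smem Z) B c.
Proof.
have [c [_ freec spanc]] := quotmod_basis kQ.
have lift x : fglift (fun i => val (c i)) x = val (fglift c x).
  by rewrite -[RHS]/((\val : {linear _ -> _}) _) fglift_comp.
exists (fun i => val (c i)); split=> [i|x Bx|z Zz]; first exact: submod_valP.
  by apply: freec; apply/UB; rewrite -lift.
have [x /UB xE] := spanc (SubMod Zz) Logic.I; exists x.
by rewrite lift; rewrite linearB in xE.
Qed.

Lemma subquotient_rank (I : choiceType) (c : I -> C) :
  relative_basis (fun x => x \in smem Z) B c -> [set: rank kQ] #= [set: I].
Proof.
move=> [Zc freec spanc].
have [e basise] := rank_basis kQ.
pose c' i : submod Z := SubMod (Zc i).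
have lift x : val (fglift c' x) = fglift c x.
  by rewrite -[LHS]/((\val : {linear _ -> _}) _) fglift_comp.
apply: (basis_family_card kQ basise (f := fun i => quotmod_proj U (c' i))).
split=> // [x|v _].
  by rewrite -fglift_comp => /quotmod_eq0/UB; rewrite lift; exact: freec.
have [x Bx] := spanc _ (submod_valP (repr v)); exists x.
have vE : v = quotmod_proj U (repr v) by rewrite /= reprK.
rewrite -fglift_comp [in X in X - _]vE -linearB.
by apply/quotmod_eq0/UB; rewrite linearB /= lift.
Qed.

End Subquotient.

End RelativeBasis.

(** * Cohomology *)

Section Projective.
Variable R : comNzRingType.

Definition linear_map (V W : lmodType R) (f : V -> W) (fL : linear f) : {linear V -> W} :=
  HB.pack f (GRing.isLinear.Build _ _ _ _ f fL).

Lemma projective_lift (Q B C : lmodType R) (g : {linear B -> C}) (f : {linear Q -> C}) :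
  projective Q -> (forall x, exists y, g y = f x) ->
  exists s : {linear Q -> B}, forall x, g (s x) = f x.
Proof.
move=> projQ fg.
have Icl : submod_closed [pred c | `[< exists b, g b = c >]].
  split=> [|a u v /asboolP[x <-] /asboolP[y <-]]; apply/asboolP.
    by exists 0; rewrite linear0.
  by exists (a *: x + y); rewrite linearP.
have fU x : f x \in smem (Submodule Icl) by apply/asboolP.
have gU x : g x \in smem (Submodule Icl) by apply/asboolP; exists x.
have [[c cU]|s sP] := projQ _ _ (corestr gU : {linear _ -> _}) (corestr fU : {linear _ -> _}).
  by have /asboolP[b bc] := cU; exists b; apply: val_inj.
by exists s => x; have /(congr1 val) := sP x.
Qed.

Lemma row_projective n : projective ('rV[R]_n : lmodType R).
Proof.
move=> A B g f gsurj.
have /choice[a aP] i : exists a, g a = f (delta_mx 0 i) by [].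
have lin : linear (fun u : 'rV[R]_n => \sum_i u 0 i *: a i).
  move=> c u v; rewrite scaler_sumr -big_split; apply: eq_bigr => i _ /=.
  by rewrite !mxE scalerDl scalerA.
exists (linear_map lin) => u /=; rewrite [u in RHS]row_sum_delta !linear_sum.
by apply: eq_bigr => i _; rewrite !linearZ /= aP.
Qed.

End Projective.

Section Cochains.
Variables (R : comNzRingType) (A : lmodType R) (P : resolution A).
Implicit Types M N : lmodType R.

Lemma res_dd n x : res_diff P n (res_diff P n.+1 x) = 0.
Proof. by apply/res_exactS; exists x. Qed.

Lemma cocycle_submodule M n : submodule_pred (@is_cocycle R A P M n).
Proof.
have [B0 BL] := @cocycle_closed R A P M n; split; first exact/asboolP.
by move=> a u v /asboolP Bu /asboolP Bv; apply/asboolP; exact: BL.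
Qed.

Lemma coboundary_submodule M n : submodule_pred (@is_coboundary R A P M n).
Proof.
have [B0 BL] := @coboundaryP R A P M n; split; first exact/asboolP.
by move=> a u v /asboolP Bu /asboolP Bv; apply/asboolP; exact: BL.
Qed.

Lemma coboundary_cocycle M n (f : P n -> M) : is_coboundary f -> is_cocycle f.
Proof.
case: n f => [|n] f /=.
  by move=> f0; split=> [a x y|x]; rewrite !f0 ?scaler0 ?addr0.
by move=> [g fE]; split=> [a x y|x]; rewrite !fE ?linearP // res_dd linear0.
Qed.

Lemma cocycle_comp M N n (L : {linear M -> N}) (f : P n -> M) :
  is_cocycle f -> is_cocycle (fun x => L (f x)).
Proof.
by move=> [fL f0]; split=> [a x y|x]; [rewrite fL linearP|rewrite f0 linear0].
Qed.

Lemma coboundary_comp M N n (L : {linear M -> N}) (f : P n -> M) :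
  is_coboundary f -> is_coboundary (fun x => L (f x)).
Proof.
case: n f => [|n] f /=; first by move=> f0 x; rewrite f0 linear0.
by move=> [g fE]; exists (L \o g) => x; rewrite fE.
Qed.

Lemma coboundary_ext M n (f g : P n -> M) :
  (forall x, f x = g x) -> is_coboundary f -> is_coboundary g.
Proof. by move=> /funext ->. Qed.

(** A chain endomorphism over the identity of [A] is homotopic to the identity. *)
Lemma cocycle_endomorphism M (eta : forall n, {linear P n -> P n}) :
  (forall x, res_aug P (eta 0%N x) = res_aug P x) ->
  (forall n x, res_diff P n (eta n.+1 x) = eta n (res_diff P n x)) ->
  forall n (f : P n -> M), is_cocycle f -> is_coboundary (fun x => f x - f (eta n x)).
Proof.
move=> eta0 etaS.
have homot n : exists s : {linear P n -> P n.+1}, forall y,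
    res_diff P n (y - eta n.+1 y - s (res_diff P n y)) = 0.
  elim: n => [|n [s sP]].
    have [|s sP] := @projective_lift R (P 0%N) _ _ (res_diff P 0) (idfun \- eta 0%N)
      (@res_proj _ _ P 0%N).
      by move=> x; apply/res_exact0; rewrite linearB /= eta0 subrr.
    by exists s => y; rewrite linearB linearB /= sP /= etaS subrr.
  have [|t tP] := @projective_lift R (P n.+1) _ _ (res_diff P n.+1)
    ((idfun \- eta n.+1) \- (s \o res_diff P n)) (@res_proj _ _ P n.+1).
    by move=> x; apply/res_exactS; exact: sP.
  exists t => y; rewrite linearB linearB /= tP /= etaS.
  by rewrite res_dd linear0 subr0 subrr.
move=> [|n] f [fL f0] /=.
  move=> x; have /res_exact0[y yE] : res_aug P (x - eta 0%N x) = 0.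
    by rewrite linearB eta0 subrr.
  by rewrite -[f x - _](linearB (linear_map fL)) /= -yE f0.
have [s sP] := homot n; exists (linear_map fL \o s) => x /=.
have /res_exactS[y yE] := sP x.
apply/eqP; rewrite -subr_eq0 -[X in X - _](linearB (linear_map fL)).
by rewrite -[X in _ - X]/(linear_map fL _) -linearB /= -yE f0.
Qed.

End Cochains.

Section Comparison.
Variables (R : comNzRingType) (A : lmodType R).
Implicit Types M : lmodType R.

Lemma comparison_map (P P' : resolution A) : exists phi : forall n, {linear P n -> P' n},
  (forall x, res_aug P' (phi 0%N x) = res_aug P x) /\
  (forall n x, res_diff P' n (phi n.+1 x) = phi n (res_diff P n x)).
Proof.
pose ok n (f : {linear P n -> P' n}) :=
  forall x, exists y, res_diff P' n y = f (res_diff P n x).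
have [|f0 f0P] := @projective_lift R (P 0%N) _ _ (res_aug P') (res_aug P) (@res_proj _ _ P 0%N).
  by move=> x; exact: res_aug_surj.
have ok0 : ok 0%N f0.
  by move=> x; apply/res_exact0; rewrite f0P; apply/res_exact0; exists x.
have step n (f : {linear P n -> P' n}) : exists g : {linear P n.+1 -> P' n.+1},
    ok n f -> forall x, res_diff P' n (g x) = f (res_diff P n x).
  have [okf|nok] := pselect (ok n f); last by exists \0.
  have [g gP] := @projective_lift R (P n.+1) _ _ (res_diff P' n) (f \o res_diff P n)
    (@res_proj _ _ P n.+1) okf.
  by exists g.
pose next n f := sval (cid (step n f)).
have nextP n f : ok n f -> forall x, res_diff P' n (next n f x) = f (res_diff P n x).
  exact: (svalP (cid (step n f))).
pose phi := fix phi n : {linear P n -> P' n} :=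
  match n with 0 => f0 | n'.+1 => next n' (phi n') end.
have okphi n : ok n (phi n).
  elim: n => [|n IH] //= x; apply/res_exactS.
  by rewrite nextP // res_dd linear0.
by exists phi; split=> // n x; exact: nextP.
Qed.

Lemma cocycle_precomp (P P' : resolution A) (phi : forall n, {linear P' n -> P n}) M n (f : P n -> M) :
  (forall n x, res_diff P n (phi n.+1 x) = phi n (res_diff P' n x)) ->
  is_cocycle f -> is_cocycle (fun x => f (phi n x)).
Proof.
move=> phiS [fL f0]; split=> [a x y|x]; first by rewrite linearP fL.
by rewrite -phiS f0.
Qed.

Lemma coboundary_precomp (P P' : resolution A) (phi : forall n, {linear P' n -> P n}) M n (f : P n -> M) :
  (forall n x, res_diff P n (phi n.+1 x) = phi n (res_diff P' n x)) ->
  is_coboundary f -> is_coboundary (fun x => f (phi n x)).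
Proof.
move=> phiS; case: n f => [|n] f /=; first by move=> f0 x.
by move=> [g gE]; exists (g \o phi n) => x; rewrite gE phiS.
Qed.

End Comparison.

Lemma cohomology_basis_change (R : localRingType) (A M : lmodType R) (P P' : resolution A) n
    (I : choiceType) (c : I -> (P n -> M)) :
  relative_basis (@is_cocycle R A P M n) (@is_coboundary R A P M n) c ->
  exists c' : I -> (P' n -> M),
    relative_basis (@is_cocycle R A P' M n) (@is_coboundary R A P' M n) c'.
Proof.
have [phi [phi0 phiS]] := comparison_map P' P.
have [psi [psi0 psiS]] := comparison_map P P'.
have BP := @coboundary_submodule R A P M n.
have BP' := @coboundary_submodule R A P' M n.
have backP (f : P n -> M) : is_cocycle f -> is_coboundary (f - (fun x => f (phi n (psi n x)))).
  move=> cf; apply: (coboundary_ext (f := fun x => f x - f (phi n (psi n x)))) => //.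
  apply: (@cocycle_endomorphism R A P M (fun n => phi n \o psi n)) => //=.
  - by move=> x; rewrite phi0 psi0.
  - by move=> l x; rewrite phiS psiS.
have backP' (f : P' n -> M) : is_cocycle f -> is_coboundary (f - (fun x => f (psi n (phi n x)))).
  move=> cf; apply: (coboundary_ext (f := fun x => f x - f (psi n (phi n x)))) => //.
  apply: (@cocycle_endomorphism R A P' M (fun n => psi n \o phi n)) => //=.
  - by move=> x; rewrite psi0 phi0.
  - by move=> l x; rewrite psiS phiS.
apply: (relative_basis_transport (T := fun f f' => is_coboundary (f' - (fun x => f (phi n x))))).
- exact: cocycle_submodule.
- exact: cocycle_submodule.
- have -> : 0 - (fun x => (0 : P n -> M) (phi n x)) = 0 :> (P' n -> M) by rewrite subrr.
  exact: BP'.1.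
- move=> a u v u' v' Tu Tv.
  have -> : a *: u' + v' - (fun x => (a *: u + v) (phi n x)) =
    a *: (u' - (fun x => u (phi n x))) + (v' - (fun x => v (phi n x))).
    by rewrite scalerBr addrACA -opprD.
  exact: BP'.2.
- move=> f cf; exists (fun x => f (phi n x)); split.
    exact: (@cocycle_precomp R A P P' phi M n f phiS cf).
  by rewrite subrr; exact: BP'.1.
- move=> f' cf'; exists (fun x => f' (psi n x)); split.
    exact: (@cocycle_precomp R A P' P psi M n f' psiS cf').
  exact: backP'.
- move=> f f' cf cf' T; split=> [bf|bf'].
    rewrite -(subrK (fun x => f (phi n x)) f'); apply: (submodD BP') => //.
    exact: (@coboundary_precomp R A P P' phi M n f phiS bf).
  rewrite -(subrK (fun x => f (phi n (psi n x))) f); apply: (submodD BP); first exact: backP.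
  have bfp : is_coboundary (fun x => f (phi n x)).
    rewrite -[X in is_coboundary X](subKr f'); exact: (submodB BP' bf' T).
  exact: (@coboundary_precomp R A P' P psi M n _ psiS bfp).
Qed.

(** * The exact sequence of a submodule and its quotient *)

(** The long exact sequence of the submodule [U] of [M], when the projection to
    the quotient is zero on cohomology: it splits into short exact sequences,
    and bases of its outer terms give a basis of the middle one. *)
Section ShortExact.
Variables (R : localRingType) (A : lmodType R) (kA : killed A) (P : resolution A).
Variables (M : lmodType R) (U : submodule M).
Hypothesis zero_map : forall n (f : P n -> M), is_cocycle f ->
  is_coboundary (fun x => quotmod_proj U (f x)).

Local Notation Msub := (submod U).
Local Notation Q := (quotmod U).

(** Cocycles with values in the submodule that bound in [M]: the image of the
    connecting map. *)
Definition bounds_above n (f : P n -> Msub) : Prop :=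
  is_cocycle f /\ is_coboundary (fun x => val (f x)).

Lemma quotmod_projP (x : M) : quotmod_proj U x = 0 <-> x \in smem U.
Proof. exact: quotmod_eq0. Qed.

Lemma quotmod_proj_surj (q : Q) : exists x, quotmod_proj U x = q.
Proof. by exists (repr q); rewrite /= reprK. Qed.

Lemma val_comp_sub n (a : R) (u v : P n -> Msub) :
  (fun x => val ((a *: u + v) x)) = a *: (fun x => val (u x)) + (fun x => val (v x)).
Proof. by apply/funext => x; rewrite [LHS](linearP (val : Msub -> M)). Qed.

Lemma bounds_above_submodule n : submodule_pred (@bounds_above n).
Proof.
have BP := @coboundary_submodule R A P M n.
have [c0 cL] := @cocycle_submodule R A P Msub n.
split=> [|a u v [cu bu] [cv bv]]; split=> //.
- apply: (coboundary_ext (f := 0)); first by move=> x; rewrite linear0.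
  exact: BP.1.
- exact: cL.
- by rewrite val_comp_sub; exact: BP.2.
Qed.

Lemma corestrict n (f : P n -> M) : is_cocycle f -> (forall x, f x \in smem U) ->
  exists2 f' : P n -> Msub, is_cocycle f' & forall x, val (f' x) = f x.
Proof.
move=> [fL f0] fU; exists (fun x => SubMod (fU x)) => //; split=> [a x y|x]; apply: val_inj => /=.
  by rewrite fL.
exact: f0.
Qed.

(** Up to coboundaries, cocycles of [M] have values in the submodule, since their
    image in the quotient bounds. *)
Lemma basis_above n (I : choiceType) (c : I -> (P n -> M)) :
  relative_basis (@is_cocycle R A P M n) (@is_coboundary R A P M n) c ->
  exists c' : I -> (P n -> Msub),
    relative_basis (@is_cocycle R A P Msub n) (@bounds_above n) c'.
Proof.
have BP := @coboundary_submodule R A P M n.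
apply: (relative_basis_transport
  (T := fun f (f' : P n -> Msub) => is_coboundary (f - (fun x => val (f' x))))).
- exact: cocycle_submodule.
- exact: cocycle_submodule.
- have -> : 0 - (fun x => val ((0 : P n -> Msub) x)) = 0 :> (P n -> M).
    apply/funext => x; change (0 - val (0 : Msub) = 0 :> M).
    by rewrite [X in _ - X]linear0 subr0.
  exact: BP.1.
- move=> a u v u' v' Tu Tv.
  rewrite val_comp_sub opprD addrACA -scalerBr; exact: BP.2.
- move=> f cf; have := zero_map cf; case: n f cf {c} BP => [|n] f cf BP /=.
    move=> fU; have [|f' cf' ff'] := corestrict cf; first by move=> x; apply/quotmod_projP; exact: fU.
    exists f'; split=> //.
    have -> : f - (fun x => val (f' x)) = 0 by apply/funext => x; change (f x - val (f' x) = 0); rewrite ff' subrr.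
    exact: BP.1.
  move=> [g gE]; have [|s sP] := @projective_lift R (P n) _ _ (quotmod_proj U) g (@res_proj _ _ P n).
    by move=> x; exact: quotmod_proj_surj.
  pose h : P n.+1 -> M := fun x => s (res_diff P n x).
  have ch : is_cocycle h by apply: (@coboundary_cocycle R A P M n.+1); exists s.
  have [||f' cf' ff'] := @corestrict n.+1 (f - h).
  - by apply: submodB => //; exact: cocycle_submodule.
  - move=> x; apply/quotmod_projP; rewrite [(f - h) x]/(f x - h x) linearB [quotmod_proj U (f x)]gE -sP.
    exact: subrr.
  exists f'; split=> //; exists s => x.
  change (f x - val (f' x) = h x); rewrite ff'.
  by change (f x - (f x - h x) = h x); rewrite subKr.
- move=> f' [fL f0]; exists (fun x => val (f' x)); split.
    by split=> [a x y|x]; rewrite ?fL ?linearP // f0 linear0.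
  by rewrite subrr; exact: BP.1.
- move=> f f' cf cf' T; split=> [bf|[_ bf']].
    split=> //; rewrite -[X in is_coboundary X](subKr f); exact: (submodB BP bf T).
  by rewrite -(subrK (fun x => val (f' x)) f); exact: (submodD BP T bf').
Qed.

(** The connecting map is injective, as a cocycle of [Q] that lifts to a cocycle of
    [M] bounds. *)
Lemma basis_connecting n (I : choiceType) (c : I -> (P n -> Q)) :
  relative_basis (@is_cocycle R A P Q n) (@is_coboundary R A P Q n) c ->
  exists c' : I -> (P n.+1 -> Msub),
    relative_basis (@bounds_above n.+1) (@is_coboundary R A P Msub n.+1) c'.
Proof.
pose T (h : P n -> Q) (f : P n.+1 -> Msub) := exists g : {linear P n -> M},
  (forall x, quotmod_proj U (g x) = h x) /\ forall x, val (f x) = g (res_diff P n x).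
apply: (relative_basis_transport (T := T)).
- exact: cocycle_submodule.
- exact: bounds_above_submodule.
- by exists \0; split=> x //; exact: (linear0 (quotmod_proj U)).
- move=> a u v u' v' [g [gu gu']] [k [kv kv']].
  exists ((a \*: g) \+ k); split=> x.
    by change (quotmod_proj U (a *: g x + k x) = a *: u x + v x); rewrite linearP gu kv.
  change (val (a *: u' x + v' x) = a *: g (res_diff P n x) + k (res_diff P n x)).
  by rewrite linearP /= gu' kv'.
- move=> h [hL h0].
  have [|g gP] := @projective_lift R (P n) _ _ (quotmod_proj U) (linear_map hL) (@res_proj _ _ P n).
    by move=> x; exact: quotmod_proj_surj.
  pose gd : P n.+1 -> M := fun x => g (res_diff P n x).
  have cgd : is_cocycle gd by apply: (@coboundary_cocycle R A P M n.+1); exists g.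
  have [|f cf fE] := corestrict cgd; first by move=> x; apply/quotmod_projP; rewrite gP /= h0.
  exists f; split; last by exists g.
  by split=> //; exists g => x; rewrite fE.
- move=> f [cf [g gE]].
  exists (fun x => quotmod_proj U (g x)); split; last by exists g.
  split=> [a x y|x]; first by rewrite !linearP.
  by rewrite -gE; apply/quotmod_projP; exact: submod_valP.
- move=> h f [hL h0] cf [g [gh gf]]; split.
    move=> bh; have [s [sU sd]] : exists s : {linear P n -> M},
        (forall x, s x \in smem U) /\ forall x, s (res_diff P n x) = g (res_diff P n x).
      case: n h f g hL h0 gh gf bh {cf T c} => [|n] h f g hL h0 gh gf /=.
        by move=> bh; exists g; split=> // x; apply/quotmod_projP; rewrite gh bh.
      move=> [l lE]; have [|l' l'P] := @projective_lift R (P n) _ _ (quotmod_proj U) l (@res_proj _ _ P n).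
        by move=> x; exact: quotmod_proj_surj.
      exists (g \- (l' \o res_diff P n)); split=> x /=; last by rewrite res_dd linear0 subr0.
      by apply/quotmod_projP; rewrite linearB gh lE l'P subrr.
    exists (corestr sU : {linear _ -> _}) => x; apply: val_inj.
    by rewrite /= sd -gf.
  move=> [e eE].
  have cge : is_cocycle (fun x => g x - val (e x)).
    split=> [|x]; last by rewrite -gf eE subrr.
    exact: (linearP (g \- ((val : Msub -> M) \o e))).
  apply: (coboundary_ext _ (zero_map cge)) => x; rewrite linearB gh.
  by rewrite [X in _ - X](_ : _ = 0) ?subr0 //; apply/quotmod_projP; exact: submod_valP.
Qed.

Lemma submodule_basis n (I J : choiceType) (c : I -> (P n -> M)) (c' : J -> (P n -> Msub)) :
  relative_basis (@is_cocycle R A P M n) (@is_coboundary R A P M n) c ->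
  relative_basis (@bounds_above n) (@is_coboundary R A P Msub n) c' ->
  exists b : I + J -> (P n -> Msub),
    relative_basis (@is_cocycle R A P Msub n) (@is_coboundary R A P Msub n) b.
Proof.
move=> /basis_above[c1 basis1] basis2; eexists.
apply: (relative_basis_sum _ _ _ _ _ _ basis1 basis2).
- exact: cocycle_submodule.
- exact: bounds_above_submodule.
- exact: coboundary_submodule.
- by move=> f [].
- move=> f bf; split; first exact: coboundary_cocycle.
  exact: (@coboundary_comp R A P Msub M n (val : Msub -> M)).
- by move=> a f am cf; exact: cocycle_killed.
Qed.

End ShortExact.

(** * Cochains on a resolution by finitely generated modules *)

Section FiniteResolution.
Variables (R : localRingType) (r : nat -> nat) (d : forall j, 'M[R]_(r j.+1, r j)).
Hypotheses (r0 : r 0%N = 1%N) (resd : matrix_resolution d).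
Local Notation k := (residue R).

Let Ymod (n : nat) : lmodType R := 'rV[R]_(r n).
Let Ydiff (n : nat) : {linear Ymod n.+1 -> Ymod n} := mulmxr (d n).

(** The sum has a single term, as the module of degree 0 has rank 1. *)
Let aug (u : Ymod 0%N) : k := \sum_i \pi_k (u 0 i).

Let aug_linear : linear aug.
Proof.
move=> a u v; rewrite /aug scaler_sumr -big_split; apply: eq_bigr => i _ /=.
by rewrite !mxE rmorphD rmorphM.
Qed.

Let sum_rank1 n (F : 'I_n -> k) i : n = 1%N -> \sum_j F j = F i.
Proof. by move=> n1; move: F i; rewrite n1 => F i; rewrite big_ord1 [i]ord1. Qed.

Definition matrix_res : resolution k.
Proof.
refine (@Resolution R k Ymod Ydiff (linear_map aug_linear)
  (fun n => @row_projective R (r n)) _ _ _).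
- move=> x; have i0 : 'I_(r 0%N) by rewrite r0; exact: ord0.
  exists (const_mx (repr x)); rewrite /= /aug (sum_rank1 _ i0 r0) mxE; exact: reprK.
- move=> u; rewrite /= /aug; have -> : \sum_i \pi_k (u 0 i) = 0 <-> rows_cycle d u.
    split=> [u0|/residue_mx_eq0 um]; last first.
      by rewrite big1 // => i _; apply/eqP; rewrite residue_eq0.
    apply/residue_mx_eq0 => a i; rewrite ord1 -residue_eq0.
    by rewrite -(sum_rank1 (fun i => \pi_k (u 0 i)) i r0) u0.
  by split=> [/resd[w ->]|[w <-]]; [exists w|apply/resd; exists w].
- move=> n u; have -> : Ydiff n u = 0 <-> rows_cycle d (u : 'rV_(r n.+1)) by [].
  by split=> [/resd[w ->]|[w <-]]; [exists w|apply/resd; exists w].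
Defined.

Local Notation Y := matrix_res.

Lemma row_linear_sum (L : lmodType R) n (f : {linear 'rV[R]_n -> L}) u :
  f u = \sum_e u 0 e *: f (delta_mx 0 e).
Proof. by rewrite {1}[u]row_sum_delta linear_sum; apply: eq_bigr => e _; rewrite linearZ. Qed.

(** Cochains with values in [N] are determined by their values on the standard basis
    vectors, to which [ext_map_zero] applies. *)
Lemma finite_pd_form_zero (N : lmodType R) (phi : {linear N -> k})
    (Th : forall j, 'M[R]_(r j.+2, r j)) n (f : Y n -> N) :
  degree_shift d Th -> onto_homology d Th -> finite_pd N ->
  is_cocycle f -> is_coboundary (fun x => phi (f x)).
Proof.
move=> ThP Thonto [P [p P0]] [fL f0].
pose F : {linear 'rV[R]_(r n) -> N} := linear_map fL.
pose alpha e := F (delta_mx 0 e).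
have alphaC c : act (d n)^T alpha c = 0.
  rewrite -[RHS](f0 (delta_mx 0 c)) -[f _]/(F (delta_mx 0 c *m d n)) -rowE.
  by rewrite [RHS]row_linear_sum; apply: eq_bigr => e _; rewrite !mxE.
have r0gt : (0 < r 0)%N by rewrite r0.
have := ext_map_zero resd ThP Thonto P0 phi alphaC r0gt.
have phiF u : phi (f u) = \sum_e (u : 'rV_(r n)) 0 e *: phi (alpha e).
  by rewrite -[f u]/(F u) row_linear_sum linear_sum; apply: eq_bigr => e _; rewrite linearZ.
case: n f fL f0 F alpha alphaC phiF => [|n] f fL f0 F alpha alphaC phiF /=.
  by move=> b0 u; rewrite phiF big1 // => e _; rewrite b0 scaler0.
move=> [h hE].
have lin : linear (fun u : 'rV[R]_(r n) => \sum_c u 0 c *: h c).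
  move=> a u v; rewrite scaler_sumr -big_split; apply: eq_bigr => i _ /=.
  by rewrite !mxE scalerDl scalerA.
exists (linear_map lin) => u; rewrite phiF /=.
under eq_bigr do rewrite hE /act scaler_sumr.
rewrite exchange_big; apply: eq_bigr => c _ /=.
by rewrite mxE scaler_suml; apply: eq_bigr => e _; rewrite scalerA mxE.
Qed.

Section KilledCoefficients.
Variables (Q : lmodType R) (kQ : killed Q).

(** [repr] is not additive, but it is modulo the maximal ideal, which kills [Q]. *)
Lemma line_linear (q : Q) : linear (fun x : k => repr x *: q).
Proof.
move=> a x y; rewrite scalerA -scalerDl; apply/eqP; rewrite -subr_eq0 -scalerBl; apply/eqP.
apply: kQ; rewrite -residue_eq0 rmorphB rmorphD rmorphM /= !reprK.
by apply/eqP; exact: subrr.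
Qed.

Definition line (q : Q) : {linear k -> Q} := linear_map (line_linear q).

End KilledCoefficients.

Lemma finite_expansion (C : lmodType R) (B : C -> Prop) (I : choiceType) (c : I -> C)
    (f : I -> {linear C -> k}) n (g : {linear 'rV[R]_n -> C}) :
  submodule_pred B -> (forall a z, a \in maxideal R -> B (a *: z)) ->
  relative_basis (fun=> True) B c ->
  (forall i j, f i (c j) = (j == i)%:R) -> (forall i v, B v -> f i v = 0) ->
  exists2 S : seq I, uniq S & forall u, B (g u - \sum_(i <- S) repr (f i (g u)) *: c i).
Proof.
move=> subB mB basisc fc fB.
have /choice[s sP] e := dual_basis_expansion subB mB basisc fc fB (g (delta_mx 0 e)).
pose S := undup (flatten [seq s e | e <- enum 'I_n]).
exists S => [|u]; first exact: undup_uniq.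
have SP e : B (g (delta_mx 0 e) - \sum_(i <- S) repr (f i (g (delta_mx 0 e))) *: c i).
  apply: sP; first exact: undup_uniq.
  move=> i is_; rewrite mem_undup; apply/flattenP; exists (s e) => //.
  by apply: map_f; rewrite mem_enum.
pose w := \sum_e u 0 e *: (g (delta_mx 0 e) - \sum_(i <- S) repr (f i (g (delta_mx 0 e))) *: c i).
have Bw : B w by apply: (submod_sum subB) => e _; exact: (submodZ subB).
rewrite -(subrK w (g u - _)); apply: (submodD subB) => //.
have -> : g u - \sum_(i <- S) repr (f i (g u)) *: c i - w =
    \sum_(i <- S) (\sum_e u 0 e * repr (f i (g (delta_mx 0 e))) - repr (f i (g u))) *: c i.
  rewrite /w; under [X in _ - _ - X]eq_bigr do rewrite scalerBr scaler_sumr.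
  rewrite sumrB -row_linear_sum exchange_big /= opprB [LHS]addrC addrA subrK.
  rewrite -sumrB; apply: eq_bigr => i _; rewrite scalerBl; congr (_ - _).
  by rewrite scaler_suml; apply: eq_bigr => e _; rewrite scalerA.
apply: (submod_sum subB) => i _; apply: mB.
rewrite -residue_eq0 rmorphB rmorph_sum /= reprK row_linear_sum linear_sum subr_eq0.
by apply/eqP/eq_bigr => e _; rewrite rmorphM /= reprK linearZ.
Qed.

Lemma coboundary_sum (L : lmodType R) n (I : Type) (S : seq I) (F : I -> Y n -> L) :
  (forall i, is_coboundary (F i)) -> is_coboundary (fun x => \sum_(i <- S) F i x).
Proof.
move=> Fc; rewrite (_ : (fun x => _) = \sum_(i <- S) F i); last first.
  by apply/funext => x; rewrite fct_sumE.
by apply: (submod_sum (@coboundary_submodule R k Y L n)) => i _.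
Qed.

(** [Ext (k, -)] of a direct sum of copies of [k]: cocycles have values in the span
    of finitely many basis vectors, as the modules of the resolution are finitely
    generated. *)
Lemma product_basis (Q : lmodType R) (kQ : killed Q) (I J : choiceType) (e : I -> Q) n
    (h : J -> (Y n -> k)) :
  basis_family e -> relative_basis (@is_cocycle R k Y k n) (@is_coboundary R k Y k n) h ->
  exists c : I * J -> (Y n -> Q),
    relative_basis (@is_cocycle R k Y Q n) (@is_coboundary R k Y Q n) c.
Proof.
move=> basise [hc freeh spanh].
have sub0 : submodule_pred (fun x : Q => x = 0).
  by split=> // a u v -> ->; rewrite scaler0 addr0.
have m0 (a : R) (z : Q) : a \in maxideal R -> a *: z = 0 by exact: kQ.
have [f [fe f0]] := dual_basis_exists sub0 basise.
pose c (s : I * J) : Y n -> Q := fun x => line kQ (e s.1) (h s.2 x).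
have subk := @coboundary_submodule R k Y k n.
have subQ := @coboundary_submodule R k Y Q n.
have fline i i' (y : k) : f i (line kQ (e i') y) = if i' == i then y else 0.
  rewrite /= linearZ /= fe -[LHS]/(\pi_k (repr y) * _) reprK.
  by case: eqP => _; rewrite ?mulr1 ?mulr0.
have post (V W : lmodType R) (L : {linear V -> W}) :
    linear (fun (g : Y n -> V) => (fun x => L (g x)) : Y n -> W).
  by move=> a u v; apply/funext => x; exact: linearP.
exists c; split=> [[i j]|x Bx [i j]|g cg].
- exact: cocycle_comp.
- pose p : {linear {freeg (I * J) / R} -> {freeg J / R}} :=
    fglift (fun s => if s.1 == i then << s.2 >> else 0).
  have -> : coeff (i, j) x = coeff j (p x).
    apply: (@freeg_linear_ext _ _ _ (coeff_map _ (i, j)) (coeff_map R j \o p) _ x) => s.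
    rewrite /= fgliftU1 coeffU1 -pair_eqE /pair_eq /=.
    by case: eqP => _; rewrite ?coeffU1 ?coeff0.
  apply: freeh; have := coboundary_comp (f i) Bx.
  rewrite -[X in is_coboundary X]/(linear_map (post _ _ (f i)) (fglift c x)).
  rewrite fglift_comp /p fglift_comp; congr (is_coboundary (fglift _ x)).
  apply/funext => s; apply/funext => y /=; rewrite fline.
  by case: eqP => _; rewrite ?fgliftU1 ?linear0.
have [gL g0] := cg; pose G : {linear 'rV[R]_(r n) -> Q} := linear_map gL.
have [S uS gE] := finite_expansion G sub0 m0 basise fe f0.
have /choice[x xP] i : exists x, is_coboundary ((fun y => f i (g y)) - fglift h x).
  by apply: spanh; exact: cocycle_comp.
exists (\sum_(i <- S) fglift (fun j => << (i, j) >> : {freeg (I * J) / R}) (x i)).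
have -> : g - fglift c (\sum_(i <- S) fglift (fun j => << (i, j) >> : {freeg (I * J) / R}) (x i)) =
    (fun y => \sum_(i <- S) line kQ (e i) (((fun y => f i (g y)) - fglift h (x i)) y)).
  rewrite linear_sum /=; apply/funext => y.
  rewrite -[LHS]/(g y - (\sum_(i <- S) _) y) fct_sumE.
  have /eqP := gE y; rewrite subr_eq0 -[G y]/(g y) => /eqP {1}->.
  rewrite -sumrB; apply: eq_bigr => i _.
  rewrite [in RHS](_ : ((fun y => f i (g y)) - fglift h (x i)) y = f i (g y) - fglift h (x i) y) //.
  rewrite -[RHS]/(line kQ (e i) (f i (g y) - fglift h (x i) y)) linearB; congr (_ - _); rewrite fglift_comp.
  rewrite -[RHS]/(linear_map (post _ _ (line kQ (e i))) (fglift h (x i)) y) fglift_comp.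
  by congr (fglift _ (x i) y); apply/funext => j; rewrite /= fgliftU1.
by apply: coboundary_sum => i; exact: coboundary_comp.
Qed.

(** A basis of [M / (M cap m N)] stays free in [N / m N], so that its coordinate
    forms extend to [N]; the cohomology of the map to that quotient is computed
    coordinate by coordinate. *)
Lemma cap_mmul_zero (M N : lmodType R) (beta : {linear M -> N})
    (Th : forall j, 'M[R]_(r j.+2, r j)) n (f : Y n -> M) :
  degree_shift d Th -> onto_homology d Th -> finite_pd N ->
  is_cocycle f -> is_coboundary (fun x => quotmod_proj (cap_mmul beta) (f x)).
Proof.
move=> ThP Thonto pdN cf; set U := cap_mmul beta.
have kQ := quot_cap_mmul_killed beta.
have [c basisc] := quotmod_basis kQ.
have [_ freec spanc] := basisc.
have subN : submodule_pred (fun y => y \in smem (mmul N)).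
  by split; [exact: rpred0|move=> a u v Bu Bv; rewrite rpredD ?rpredZ].
have mN (a : R) (z : N) : a \in maxideal R -> a *: z \in smem (mmul N).
  by move=> am; apply/asboolP; exists 1%N, (fun=> a), (fun=> z); rewrite big_ord1.
pose Z' : N -> Prop := fun y => exists x, y - beta x \in smem (mmul N).
have subZ' : submodule_pred Z'.
  split; first by exists 0; rewrite linear0 subrr; exact: subN.1.
  move=> a u v [x xP] [y yP]; exists (a *: x + y).
  rewrite linearP opprD addrACA -scalerBr; exact: subN.2.
have NZ' y : y \in smem (mmul N) -> Z' y by move=> yN; exists 0; rewrite linear0 subr0.
have betaE x : fglift (fun i => beta (c i)) x = beta (fglift c x) by rewrite fglift_comp.
have basisb : relative_basis Z' (fun y => y \in smem (mmul N)) (fun i => beta (c i)).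
  split=> [i|x|y [z yz]].
  - by exists (c i); rewrite subrr; exact: subN.1.
  - by rewrite betaE => Bx; exact: (freec x Bx).
  - have [x Bx] := spanc z I; exists x; rewrite betaE -(subrK (beta z) y) -addrA.
    by rewrite -linearB; apply: (submodD subN).
have Zcl : submod_closed [pred y | `[< Z' y >]].
  split=> [|a u v /asboolP Zu /asboolP Zv]; apply/asboolP; first exact: subZ'.1.
  exact: subZ'.2.
have kN : killed (quotmod (Submodule Zcl)).
  move=> a q am; rewrite -[q]reprK quotmodZ; apply/quotmod_eq0/asboolP.
  by apply: NZ'; exact: mN.
have [c' basisc'] := quotmod_basis kN.
have smemZ : (fun x => is_true (x \in smem (Submodule Zcl))) = Z'.
  by apply/funext => x; apply/propext; split=> [/asboolP|Zx] //; apply/asboolP.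
rewrite smemZ in basisc'.
have subT : submodule_pred (fun _ : N => True) by [].
have basisN := relative_basis_sum subT subZ' subN (fun _ _ => I) NZ' (fun a z am _ => mN a z am) basisc' basisb.
have [phi [phic phiN]] := dual_basis_exists subN basisN.
pose G i : {linear M -> k} := phi (inr i) \o beta.
have subU : submodule_pred (fun x => x \in smem U).
  by split; [exact: rpred0|move=> a u v Bu Bv; rewrite rpredD ?rpredZ].
have mU (a : R) (z : M) : a \in maxideal R -> a *: z \in smem U.
  move=> am; have : beta (a *: z) \in smem (mmul N) by rewrite linearZ; exact: mN.
  by [].
have [fL f0] := cf; pose F : {linear 'rV[R]_(r n) -> M} := linear_map fL.
have [|i v Uv|S uS fE] := @finite_expansion M (fun x => x \in smem U) _ c G _ F subU mU basisc.
- by move=> i j; rewrite /= (phic (inr i) (inr j)).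
- exact: phiN.
apply: (coboundary_ext (f := fun x => \sum_(i <- S)
  line kQ (quotmod_proj U (c i)) (phi (inr i) (beta (f x))))).
  move=> x; apply/eqP; rewrite eq_sym -subr_eq0; apply/eqP.
  have /quotmod_eq0 := fE x; rewrite -[LHS]/(quotmod_proj U _) linearB linear_sum => E.
  rewrite -[RHS]E; congr (_ - _); apply: eq_bigr => i _.
  by rewrite [in RHS]linearZ.
apply: coboundary_sum => i; apply: coboundary_comp.
apply: (finite_pd_form_zero _ ThP Thonto pdN (f := fun x => beta (f x))).
exact: cocycle_comp.
Qed.

End FiniteResolution.

Section Ext.
Variables (R : localRingType) (A : lmodType R) (P : resolution A) (M : lmodType R) (n : nat).

Let cocycleE : (fun f => is_true (f \in smem (cocycle P M n))) = @is_cocycle R A P M n.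
Proof. by apply/funext => f; apply/propext; split=> [/asboolP|cf] //; apply/asboolP. Qed.

Let coboundaryE (f : submod (cocycle P M n)) :
  f \in smem (coboundary P M n) <-> is_coboundary (val f).
Proof. by split=> [/asboolP|bf] //; apply/asboolP. Qed.

Lemma cohom_basis (kH : killed (cohom P M n)) :
  exists c : {classic rank kH} -> (P n -> M),
    relative_basis (@is_cocycle R A P M n) (@is_coboundary R A P M n) c.
Proof. by have := subquotient_basis coboundaryE kH; rewrite cocycleE. Qed.

Lemma cohom_rank (kH : killed (cohom P M n)) (I : choiceType) (c : I -> (P n -> M)) :
  relative_basis (@is_cocycle R A P M n) (@is_coboundary R A P M n) c ->
  [set: rank kH] #= [set: I].
Proof. by rewrite -cocycleE; exact: subquotient_rank. Qed.

End Ext.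
Local Open Scope classical_set_scope.

(** * Bass numbers *)

Lemma empty_relative_basis (R : localRingType) (C : lmodType R) (Z B : C -> Prop)
    (I : choiceType) : (I -> False) -> (forall z, Z z -> B z) ->
  exists c : I -> C, relative_basis Z B c.
Proof.
move=> I0 ZB; exists (fun=> 0); split=> [i|x _ i|z Zz]; try by case: (I0 i).
by exists 0; rewrite linear0 subr0; exact: ZB.
Qed.

Theorem theorem3p1 (R : localRingType) (M N : lmodType R)
    (beta : {linear M -> N}) :
  let r := rank (quot_cap_mmul_killed beta) in
  singular R -> finite_pd N ->
  forall n : int,
    [set: bass n (submod (cap_mmul beta))] #=
    [set: (bass n M + r * bass (n - 1)%R (residue R))%type].
Proof.
move=> r singR pdN; case=> [n|n]; last first.
  have -> : Negz n - 1 = Negz n.+1 by rewrite !NegzE -opprD -[1]/(1%:Z) -PoszD addn1.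
  have empty (T : Type) : (T -> False) -> [set: T] = set0.
    by move=> T0; apply/seteqP; split=> // x; case: (T0 x).
  rewrite (empty (bass (Negz n) M + r * bass (Negz n.+1) (residue R))%type); last first.
    by case=> [[]|[_ []]].
  by rewrite (empty (bass (Negz n) _)) ?card_eq00 // => -[].
have [s [d [s0 resd [Th [ThP Thonto]]]]] := singular_degree_shift singR.
pose Y := matrix_res s0 resd.
pose k := residue R; pose U := cap_mmul beta.
have kk : killed k := @residue_killed R.
have zero m (f : Y m -> M) : is_cocycle f -> is_coboundary (fun x => quotmod_proj U (f x)).
  exact: (cap_mmul_zero beta ThP Thonto pdN).
have toY (L : lmodType R) m : exists c : {classic rank (@Ext_residue_killed R m L)} -> (Y m -> L),
    relative_basis (@is_cocycle R k Y L m) (@is_coboundary R k Y L m) c.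
  have [c basisc] := cohom_basis (@Ext_residue_killed R m L).
  exact: (cohomology_basis_change Y basisc).
(* the choice structure on the index type depends on the case, only the type is
   fixed *)
have [J [JE [c basisc]]] : exists J : choiceType, (J : Type) = (r * bass (n%:Z - 1) k)%type /\
    exists c : J -> (Y n -> submod U),
    relative_basis (@bounds_above R k Y M U n) (@is_coboundary R k Y (submod U) n) c.
  case: n => [|n].
    exists {classic (r * bass (0%:Z - 1) k)%type}; split=> //.
    apply: empty_relative_basis => [[_ []]|f [[fL f0] bf] x].
    by apply: val_inj; rewrite linear0; exact: bf.
  have -> : n.+1%:Z - 1 = n by rewrite -addn1 PoszD addrK.
  have [e basise] := rank_basis (quot_cap_mmul_killed beta).
  have [h basish] := toY k n.
  have [c basisc] := product_basis (quot_cap_mmul_killed beta) basise basish.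
  by eexists; split; last exact: (basis_connecting zero basisc).
rewrite -JE.
have [c0 basisc0] := toY M n.
have [b basisb] := submodule_basis kk zero basisc0 basisc.
have [b' basisb'] := cohomology_basis_change (std_resolution k) basisb.
exact: (cohom_rank (@Ext_residue_killed R n (submod U)) basisb').
Qed.
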